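(* Let $p>1$, $d\ge 2$, let $\Omega\subset\mathbb R^d$ be a domain and let $\psi$ be a $p$-harmonic function on $\Omega$, i.e. $\nabla\cdot(|\nabla\psi|^{p-2}\nabla\psi)=0$, with $\nabla\psi(\boldsymbol r)\ne\mathbf 0$ for all $\boldsymbol r\in\Omega$. Put $F=|\nabla\psi|$. (i) The level sets of $\psi$ satisfy $$\frac{\partial}{\partial\psi}\frac{\mathcal R}{F^p}=\frac{1}{F^{p-1}\sqrt g}\,\partial_{i}\left[\frac{1}{p-1}\left(g^{ij}F^{p-1}\sqrt{g}\,\partial_j\frac{\operatorname{Tr}(\hat W)}{F^{p+1}}\right)-\frac{2}{p}\left(g^{ik}b^j_kF^{p-2}\sqrt{g}\,\partial_j\frac1{F^{p}}\right)\right]+\frac{\partial^{2}}{\partial\psi^{2}}\frac{\operatorname{Tr}(\hat W)}{F^{p-1}},$$ where $(b^j_k)$ is the matrix representation of the Weingarten transform $\hat W$. (ii) Let $d=2$ and $\kappa:=-\operatorname{Tr}(\hat W)$. Then $$\left(\frac{\Delta_\Sigma}{p-1}+F^{2}\frac{\partial^{2}}{\partial\psi^{2}}\right)\frac{\kappa}{F^{p-1}}+2\,\frac{\kappa}{F^{p-1}}\,\frac{(p-2)^2}{p-1}\left(\frac{\partial\log F}{\partial s}\right)^2=0$$ at every point where $\nabla(F^{1-p}\kappa)=\mathbf 0$. Consequently, if $D$ is a bounded domain with $D\cup\partial D\subset\Omega$ and $|\nabla\psi|^{1-p}\kappa$ is non-negative on $D\cup\partial D$, then $|\nabla\psi|^{1-p}\kappa$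 attains its minimum over $D\cup\partial D$ on $\partial D$. (iii) Let $d=2$, $\kappa:=-\operatorname{Tr}(\hat W)$ and $\alpha\in\mathbb R$. Then $$F^{\alpha}\left(\frac{\Delta_\Sigma}{p-1}+F^{2}\frac{\partial^{2}}{\partial\psi^{2}}\right)\frac{\kappa}{F^{p-1+\alpha}}=-\frac{\kappa^{3}}{F^{p-1}}\,\frac{\alpha(\alpha+2-p)}{(p-1)^{2}}-\frac{\kappa}{F^{p-1}}\,\frac{2(p-2)^2+\alpha(\alpha+3p-6)}{p-1}\left(\frac{\partial\log F}{\partial s}\right)^2$$ at every point where $\nabla(F^{1-p-\alpha}\kappa)=\mathbf 0$. Consequently, if either $1<p\le2$ and $\alpha\in(-\infty,p-2]\cup[0,2-p]\cup[2(2-p),+\infty)$, or $p>2$ and $\alpha\in(-\infty,2(2-p)]\cup[2-p,0]\cup[p-2,+\infty)$, then for every bounded domain $D$ with $D\cup\partial D\subset\Omega$ on whose closure $|\nabla\psi|^{1-p-\alpha}\kappa$ is non-negative, $|\nabla\psi|^{1-p-\alpha}\kappa$ attains its minimum over $D\cup\partial D$ on $\partial D$. In particular, for $3/2\le p\le 3$, if $\kappa$ is non-negative on $D\cup\partial D$, then the minimum of $\kappa$ over $D\cup\partial D$ is attained on $\partial D$.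
   Context: Since $\nabla\psi\neq\mathbf 0$, $\psi$ is smooth, and all expressions are understood classically. Set $n=d-1$; level sets are hypersurfaces of dimension $n$ with the metric induced from $\mathbb R^d$ and unit normal $\boldsymbol n=-\nabla\psi/|\nabla\psi|$. Curvilinear coordinates: near each point of $\Omega$ use local coordinates $(u^0,u^1,\dots,u^n)$, $\boldsymbol r=\boldsymbol r(u^0,\dots,u^n)$, with $u^0=\psi(\boldsymbol r)$ and $u^1,\dots,u^n$ constant along the integral curves of $\nabla\psi$; thus $\partial\boldsymbol r/\partial u^0=\nabla\psi/F^2=-\boldsymbol n/F$. Here $\partial/\partial\psi=\partial/\partial u^0$ with $u^1,\dots,u^n$ fixed, and $\partial_i=\partial/\partial u^i$. Latin indices run over $1,\dots,n$ with the summation convention. Set $g_{ij}=\partial_i\boldsymbol r\cdot\partial_j\boldsymbol r$, $(g^{ij})=(g_{ij})^{-1}$, $g=\det(g_{ij})$, $b_{ij}=\partial_i\partial_j\boldsymbol r\cdot\boldsymbol n$, $b_i^j=g^{jk}b_{ki}$, $\hat W=(b_i^j)$ (Weingarten transform). $\mathcal R$ is the Ricci scalar curvature of the level set through the point (so $\mathcal R\equiv0$ when $d=2$; a round $n$-sphere of radius $r$ has $\mathcal R=n(n-1)/r^2$). For $d=2$: $\partial/\partial s$ is the tangential derivative with respect to the arc length parameter of the level set, and $\Delta_\Sigma=\partial^2/\partial s^2$ is the Laplace–Beltrami operator on the level set (computed at fixed $\psi$). *)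

(* Defs.v *)
From HB Require Import structures.
From mathcomp Require Import all_boot all_order all_algebra.
From mathcomp Require Import all_classical all_reals all_analysis.

Set Implicit Arguments.
Unset Strict Implicit.
Unset Printing Implicit Defensive.
Import Order.TTheory GRing.Theory Num.Theory numFieldNormedType.Exports.
Local Open Scope classical_set_scope.
Local Open Scope ring_scope.

(* R^m is 'rV[R]_m.  Its library norm is the sup norm, which gives the usual  *)
(* topology and bounded sets; Euclidean lengths are expressed with [enorm].   *)

Section calculus.
Context {R : realType}.

Definition dot m (v w : 'rV[R]_m) : R := \sum_i v 0 i * w 0 i.

Definition enorm m (v : 'rV[R]_m) : R := Num.sqrt (dot v v).

Definition partial m (W : normedModType R) (i : 'I_m) (f : 'rV[R]_m -> W) :
  'rV[R]_m -> W := fun x => 'D_(delta_mx 0 i) f x.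

Definition grad m (f : 'rV[R]_m -> R) (x : 'rV[R]_m) : 'rV[R]_m :=
  \row_i partial i f x.

Definition divergence m (X : 'rV[R]_m -> 'rV[R]_m) (x : 'rV[R]_m) : R :=
  \sum_i partial i (fun y => X y 0 i) x.

(* C^oo on the open set A: every iterated partial derivative (of any order,   *)
(* including order 0) is differentiable at every point of A.                  *)
Definition smooth_on m (A : set 'rV[R]_m) (f : 'rV[R]_m -> R) : Prop :=
  forall (s : seq 'I_m) x, A x ->
    differentiable (foldr (fun i g => partial i g) f s) x.

Definition smooth_map_on m k (A : set 'rV[R]_m) (f : 'rV[R]_m -> 'rV[R]_k) :=
  forall j, smooth_on A (fun x => f x 0 j).

Definition domain m (A : set 'rV[R]_m) : Prop :=
  [/\ A !=set0, open A & connected A].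

Definition boundary m (A : set 'rV[R]_m) : set 'rV[R]_m :=
  closure A `\` interior A.

(* For a bounded domain D with boundary dD, closure D is D `|` dD.            *)
Definition attains_min_on_boundary m (D : set 'rV[R]_m) (f : 'rV[R]_m -> R) :=
  exists2 y, boundary D y & forall x, closure D x -> f y <= f x.

Definition p_harmonic (p : R) m (Omega : set 'rV[R]_m) (psi : 'rV[R]_m -> R) :=
  forall x, Omega x ->
    divergence (fun y => enorm (grad psi y) `^ (p - 2) *: grad psi y) x = 0.

End calculus.

(* The dimension is d = n + 1.  Coordinates are u = (u^0, u^1, ..., u^n); the *)
(* Latin index i : 'I_n stands for the coordinate u^(i+1), that is for        *)
(* [lift ord0 i : 'I_n.+1], and u^0 is the value of psi.                      *)
Section coordinates.
Context {R : realType} {n : nat}.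
Implicit Types (Omega U : set 'rV[R]_n.+1) (psi : 'rV[R]_n.+1 -> R).
Implicit Types (r : 'rV[R]_n.+1 -> 'rV[R]_n.+1) (u x : 'rV[R]_n.+1).

Definition dpsi (W : normedModType R) (f : 'rV[R]_n.+1 -> W) :=
  partial ord0 f.

Definition dtan (W : normedModType R) (i : 'I_n) (f : 'rV[R]_n.+1 -> W) :=
  partial (lift ord0 i) f.

(* r : U -> r @` U is a smooth diffeomorphism, with inverse q, onto an open   *)
(* subset of Omega; u^0 = psi, and u^1, ..., u^n are constant along the       *)
(* integral curves of grad psi, i.e. their derivatives along the vector       *)
(* field grad psi vanish.                                                     *)
Definition curvilinear Omega psi U r : Prop :=
  [/\ open U, open (r @` U), r @` U `<=` Omega, smooth_map_on U r &
      exists q : 'rV[R]_n.+1 -> 'rV[R]_n.+1,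
        [/\ smooth_map_on (r @` U) q,
            forall u, U u -> q (r u) = u,
            forall x, (r @` U) x -> q x 0 ord0 = psi x &
            forall x i, (r @` U) x ->
              'D_(grad psi x) (fun y => q y 0 (lift ord0 i)) x = 0]].

Definition unit_normal psi x : 'rV[R]_n.+1 :=
  - (enorm (grad psi x))^-1 *: grad psi x.

Definition metric r u : 'M[R]_n :=
  \matrix_(i, j) dot (dtan i r u) (dtan j r u).

Definition inv_metric r u : 'M[R]_n := invmx (metric r u).

Definition sqrt_g r u : R := Num.sqrt (\det (metric r u)).

Definition second_form psi r u : 'M[R]_n :=
  \matrix_(i, j) dot (dtan i (dtan j r) u) (unit_normal psi (r u)).

(* Row index up, column index down: the (j, i) entry is                       *)
(* b_i^j = g^{jk} b_{ki}.                                                     *)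
Definition weingarten psi r u : 'M[R]_n :=
  inv_metric r u *m second_form psi r u.

(* Gamma^k_{ij} of the Levi-Civita connection of (g_ij) on the level set.     *)
Definition christoffel r (k i j : 'I_n) u : R :=
  2^-1 * \sum_l inv_metric r u k l *
    (dtan i (fun v => metric r v j l) u + dtan j (fun v => metric r v i l) u
     - dtan l (fun v => metric r v i j) u).

(* Sign convention: the round sphere has positive Ricci curvature.            *)
Definition ricci r (i j : 'I_n) u : R :=
  \sum_k (dtan k (christoffel r k i j) u - dtan j (christoffel r k i k) u
    + \sum_l (christoffel r k k l u * christoffel r l i j u
              - christoffel r k j l u * christoffel r l i k u)).

Definition scalar_curvature r u : R :=
  \sum_i \sum_j inv_metric r u i j * ricci r i j u.

(* - Tr W as a function of the point x: its value in any curvilinear          *)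
(* coordinates around x, on which it does not depend.                         *)
Definition kappa Omega psi x : R :=
  xget 0 [set k | exists U r u,
    [/\ curvilinear Omega psi U r, U u, r u = x & k = - \tr (weingarten psi r u)]].

End coordinates.

Section dimension2.
Context {R : realType}.
Implicit Types (r : 'rV[R]_2 -> 'rV[R]_2) (h psi : 'rV[R]_2 -> R).

(* Functions h are expressed in the coordinates (u^0, u^1); the arc length    *)
(* element of the level set is ds = |d r / d u^1| du^1.                       *)
Definition darc r h : 'rV[R]_2 -> R :=
  fun u => (enorm (dtan ord0 r u))^-1 * dtan ord0 h u.

Definition laplace_beltrami r h : 'rV[R]_2 -> R := darc r (darc r h).

(* Delta_Sigma / (p - 1) + F^2 d^2/dpsi^2 *)
Definition level_operator (p : R) psi r h : 'rV[R]_2 -> R :=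
  fun u => laplace_beltrami r h u / (p - 1)
           + enorm (grad psi (r u)) ^+ 2 * dpsi (dpsi h) u.

End dimension2.

(* Main.v *)
Require Import Defs.
From HB Require Import structures.
From mathcomp Require Import all_boot all_order all_algebra.
From mathcomp Require Import all_classical all_reals all_analysis.
From mathcomp Require Import perm ring lra.

Set Implicit Arguments.
Unset Strict Implicit.
Unset Printing Implicit Defensive.
Import Order.TTheory GRing.Theory Num.Theory numFieldNormedType.Exports.
Local Open Scope classical_set_scope.
Local Open Scope ring_scope.

(** In curvilinear coordinates put phi = -1/F, so that d_0 r = phi N for the unit
    normal N.  Differentiating the frame E_i = d_i r gives the evolution of the
    first form, d_0 g = - 2 phi b, of the area element, d_0 sqrt g = - phi H sqrt g,
    and of the mean curvature H = Tr W, d_0 H = Delta phi + phi Tr W^2.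
    p-harmonicity reads H = -(p-1) d_0 F, so F^(p-1) sqrt g is independent of u^0;
    with Gauss' equation R = H^2 - Tr W^2 this yields
    R / F^p = d_0 (H / F^(p-1)) + F^(1-p) Delta (1/F), and (i) is its d_0-derivative.

    For d = 2 the same formulas close up into a second order identity for
    h = kappa / F^(p-1+alpha) in which, where d_s h = 0, the only additional term is
    a multiple of d_0 h.  The minimum principle follows by comparing h with
    h - eps exp (lam psi), lam large: it cannot have an interior minimum.  Charts
    around every point are obtained from psi and its p-harmonic conjugate by the
    inverse function theorem. *)

(** * Partial derivatives and smooth functions *)

(** The identities of (ii) and (iii) concern points where the gradient vanishes, but a comparison
    argument needs them at minima of a perturbed function, where the gradient of h is not zero. The
    perturbation is therefore a function of psi alone: at an interior minimum d_s h = 0 survives,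
    d_0 h = eps lam exp(lam psi), and d_0^2 h is at least eps lam^2 exp(lam psi). The surplus term
    carries the coefficient F kappa (4 - 2(p + alpha)/(p - 1)), which is bounded on the closure of D
    and so loses against the second derivative. A second obstacle is that kappa is a value chosen
    among all charts around a point, and 0 where there is none. Independence of the chart comes from
    p-harmonicity: kappa = (p - 1) d_0 F, and d_0 = F^-2 grad psi . grad involves no chart.
    Existence of charts requires an inverse function theorem with a smooth inverse and a potential
    for a closed planar field. Smoothness means differentiability of all iterated partials, so it is
    proved for families closed under differentiation rather than for one function at a time. *)

Section partials.
Context {R : realType} {m : nat}.
Implicit Types (f g : 'rV[R]_m -> R) (x v : 'rV[R]_m) (i : 'I_m).

Lemma differentiable_row k (r : 'rV[R]_m -> 'rV[R]_k) x :
  (forall j, differentiable (fun y => r y 0 j) x) -> differentiable r x.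
Proof.
move=> dr.
have -> : r = \sum_(j < k) (fun y => r y 0 j *: (delta_mx 0 j : 'rV[R]_k)).
  by apply/funext => y; rewrite fct_sumE -row_sum_delta.
by apply: differentiable_sum => j; apply: differentiableZl.
Qed.

Lemma differentiable_powR f (a : R) x : differentiable f x -> 0 < f x ->
  differentiable (fun y => f y `^ a) x.
Proof.
move=> df f0; apply: (@differentiable_comp _ _ _ _ f (fun t => t `^ a)) => //.
by apply/derivable1_diffP/derivable_powR; rewrite in_itv /= f0.
Qed.

Lemma differentiable_ln f x : differentiable f x -> 0 < f x ->
  differentiable (fun y => ln (f y)) x.
Proof.
move=> df f0; apply: (@differentiable_comp _ _ _ _ f (@ln R)) => //.
by apply/derivable1_diffP; apply: ex_derive; exact: is_derive1_ln.
Qed.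

Lemma derive_comp1 f (h : R -> R) (x v : 'rV[R]_m) (d : R) :
  differentiable f x -> is_derive (f x) 1 h d ->
  'D_v (fun y => h (f y)) x = d * 'D_v f x.
Proof.
move=> df [dh hd].
have dh' : differentiable h (f x) by apply/derivable1_diffP.
rewrite deriveE; last exact: differentiable_comp.
rewrite (diff_comp df dh') /= -(deriveE _ df) -hd (deriveE _ dh').
by rewrite -[X in 'd h (f x) X]mulr1 [LHS]linearZ /= mulrC.
Qed.

Lemma derive_row_sum (W : normedModType R) (f : 'rV[R]_m -> W) x v :
  differentiable f x -> 'D_v f x = \sum_j v 0 j *: partial j f x.
Proof.
move=> df; rewrite deriveE// [in LHS](row_sum_delta v) linear_sum /=.
by apply: eq_bigr => j _; rewrite linearZ /partial deriveE.
Qed.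




End partials.

Lemma partial_comp {R : realType} m k (h : 'rV[R]_k -> R)
    (r : 'rV[R]_m -> 'rV[R]_k) (i : 'I_m) x :
  (forall j, differentiable (fun y => r y 0 j) x) -> differentiable h (r x) ->
  partial i (fun y => h (r y)) x =
  \sum_j partial j h (r x) * partial i (fun y => r y 0 j) x.
Proof.
move=> dr dh; have dr' := differentiable_row dr.
rewrite {1}/partial deriveE; last exact: differentiable_comp.
rewrite (diff_comp dr' dh) /= -deriveE// -deriveE// derive_row_sum//.
apply: eq_bigr => j _; rewrite mulrC; congr (_ * _).
rewrite derive_mx ?mxE//; exact: diff_derivable.
Qed.

(** Differentiability is bundled with the value, so that a derivative is computed by composing the
    rules below with no separate side conditions. *)
Definition has_partial {R : realType} m (i : 'I_m) (f : 'rV[R]_m -> R) x (d : R) :=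
  differentiable f x /\ partial i f x = d.

Section has_partial.
Context {R : realType} {m : nat}.
Implicit Types (f g : 'rV[R]_m -> R) (x : 'rV[R]_m) (i : 'I_m).

Lemma has_partial_eq i f x d d' :
  has_partial i f x d -> d = d' -> has_partial i f x d'.
Proof. by move=> h <-. Qed.

Lemma has_partialE i f x d : has_partial i f x d -> partial i f x = d.
Proof. by case. Qed.

Lemma differentiable_has_partial i f x :
  differentiable f x -> has_partial i f x (partial i f x).
Proof. by []. Qed.

Lemma has_partialC i (c : R) x : has_partial i (fun=> c) x 0.
Proof.
split; first exact: differentiable_cst.
by rewrite /partial -[fun=> c]/(cst c) derive_cst.
Qed.

Lemma has_partialD i f g x a b : has_partial i f x a -> has_partial i g x b ->
  has_partial i (fun y => f y + g y) x (a + b).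
Proof.
move=> [df <-] [dg <-]; split; first exact: differentiableD.
by rewrite /partial -[LHS]/('D_(delta_mx 0 i) (f + g) x) deriveD//;
  exact: diff_derivable.
Qed.

Lemma has_partialN i f x a : has_partial i f x a ->
  has_partial i (fun y => - f y) x (- a).
Proof.
move=> [df <-]; split; first exact: differentiableN.
by rewrite /partial -[LHS]/('D_(delta_mx 0 i) (- f) x) deriveN//;
  exact: diff_derivable.
Qed.

Lemma has_partialB i f g x a b : has_partial i f x a -> has_partial i g x b ->
  has_partial i (fun y => f y - g y) x (a - b).
Proof. by move=> hf hg; apply: has_partialD => //; exact: has_partialN. Qed.

Lemma has_partialM i f g x a b : has_partial i f x a -> has_partial i g x b ->
  has_partial i (fun y => f y * g y) x (a * g x + f x * b).
Proof.
move=> [df <-] [dg <-]; split; first exact: differentiableM.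
rewrite /partial -[LHS]/('D_(delta_mx 0 i) (f * g) x) deriveM;
  try exact: diff_derivable.
by rewrite addrC; congr (_ + _); rewrite [LHS]mulrC.
Qed.

Lemma has_partialV i f x a : f x != 0 -> has_partial i f x a ->
  has_partial i (fun y => (f y)^-1) x (- a / f x ^+ 2).
Proof.
move=> f0 [df <-]; split; first exact: differentiableV.
rewrite /partial deriveV//; last exact: diff_derivable.
by rewrite mulNr -mulrN mulrC.
Qed.

Lemma has_partial_powR i f x a (c : R) : 0 < f x -> has_partial i f x a ->
  has_partial i (fun y => f y `^ c) x (c * f x `^ (c - 1) * a).
Proof.
move=> f0 [df <-]; split; first exact: differentiable_powR.
by rewrite /partial (derive_comp1 _ df (is_derive1_powR c f0)).
Qed.

Lemma has_partial_ln i f x a : 0 < f x -> has_partial i f x a ->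
  has_partial i (fun y => ln (f y)) x ((f x)^-1 * a).
Proof.
move=> f0 [df <-]; split; first exact: differentiable_ln.
by rewrite /partial (derive_comp1 _ df (is_derive1_ln f0)).
Qed.

Lemma has_partial_expR i f x a : has_partial i f x a ->
  has_partial i (fun y => expR (f y)) x (expR (f x) * a).
Proof.
move=> [df <-]; split.
  apply: (@differentiable_comp _ _ _ _ f (@expR R)) => //.
  exact/derivable1_diffP/derivable_expR.
by rewrite /partial (derive_comp1 _ df (is_derive_expR (f x))).
Qed.

Lemma has_partial_sum (I : Type) (s : seq I) (P : pred I)
    (f : I -> 'rV[R]_m -> R) (d : I -> R) i x :
  (forall j, has_partial i (f j) x (d j)) ->
  has_partial i (fun y => \sum_(j <- s | P j) f j y) x (\sum_(j <- s | P j) d j).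
Proof.
move=> h; elim: s => [|j s IH].
  under eq_fun do rewrite big_nil; rewrite big_nil; exact: has_partialC.
under eq_fun do rewrite big_cons; rewrite big_cons.
by case: (P j) => //; exact: has_partialD.
Qed.

Lemma has_partial_coord i j x : has_partial i (fun y : 'rV[R]_m => y 0 j) x (i == j)%:R.
Proof.
split; first exact: differentiable_coord.
rewrite /partial -[RHS](_ : delta_mx (0 : 'I_1) i 0 j = _); last first.
  by rewrite mxE eqxx eq_sym.
have -> : 'D_(delta_mx 0 i) (fun y : 'rV[R]_m => y 0 j) x =
  ('D_(delta_mx 0 i) id x) 0 j.
  by rewrite derive_mx ?mxE//; exact: derivable_id.
by rewrite derive_id.
Qed.

Lemma open_near (A : set 'rV[R]_m) (P : 'rV[R]_m -> Prop) x :
  open A -> A x -> (forall y, A y -> P y) -> \forall y \near x, P y.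
Proof. by move=> oA Ax AP; apply: filterS AP _; exact: open_nbhs_nbhs. Qed.

Lemma eq_partial_open (W : normedModType R) (A : set 'rV[R]_m)
    (f g : 'rV[R]_m -> W) i x :
  open A -> A x -> (forall y, A y -> f y = g y) -> partial i f x = partial i g x.
Proof. by move=> oA Ax fg; apply: near_eq_derive; exact: open_near fg. Qed.

End has_partial.

(** * Differentiability as an epsilon estimate *)

Section differential_estimates.
Context {R : realType} {V W : normedModType R}.
Implicit Types (f g : V -> W) (x : V).

Lemma diff_estimate f x : differentiable f x -> forall e, 0 < e ->
  \forall h \near (0 : V), `|f (h + x) - f x - 'd f x h| <= e * `|h|.
Proof.
move=> /diff_locally /eqaddoP fo e e0; have := fo _ e0.
by apply: filterS => h /=; rewrite /= !fctE /= opprD addrA.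
Qed.

Lemma estimate_diff f x (L : {linear V -> W}) : continuous L ->
  (forall e, 0 < e ->
    \forall h \near (0 : V), `|f (h + x) - f x - L h| <= e * `|h|) ->
  differentiable f x /\ ('d f x = L :> (V -> W)).
Proof.
move=> cL est; have fo : f \o shift x = cst (f x) + L +o_ (0 : V) id.
  apply/eqaddoP => _/posnumP[e]; apply: filterS (est e%:num _) => // h.
  by rewrite /= !fctE /= opprD addrA.
have dE := diff_unique cL fo.
by split=> //; apply/diff_locallyP; rewrite dE.
Qed.

Lemma near_eq_differentiable f g x :
  (\forall y \near x, f y = g y) -> differentiable f x -> differentiable g x.
Proof.
move=> fg df; have [||//] := @estimate_diff g x ('d f x).
  exact: diff_continuous.
move=> e e0; have := diff_estimate df e0; apply: filter_app.
have fgx : f x = g x by exact: nbhs_singleton fg.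
have := fg; rewrite (near_shift 0 x) subr0 => fg0.
by near=> h; rewrite -fgx -(near fg0 h).
Unshelve. all: by end_near. Qed.

End differential_estimates.

(* A family of functions whose partial derivatives are generated by the family
   under these operations consists of smooth functions.  Taking all smooth
   functions as the base gives the closure properties of smoothness; taking the
   components of a local inverse gives the smoothness of that inverse. *)
Section smooth_generation.
Context {R : realType} {m : nat}.
Variables (A : set 'rV[R]_m) (B0 : ('rV[R]_m -> R) -> Prop).
Implicit Types (f g : 'rV[R]_m -> R).

Inductive generated : ('rV[R]_m -> R) -> Prop :=
| gen_base f : B0 f -> generated f
| gen_eq f g : generated f -> (forall x, A x -> f x = g x) -> generated g
| gen_cst c : generated (fun=> c)
| gen_add f g : generated f -> generated g -> generated (fun x => f x + g x)
| gen_mul f g : generated f -> generated g -> generated (fun x => f x * g x)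
| gen_inv f : generated f -> (forall x, A x -> f x != 0) ->
    generated (fun x => (f x)^-1)
| gen_powR f a : generated f -> (forall x, A x -> 0 < f x) ->
    generated (fun x => f x `^ a)
| gen_expR f : generated f -> generated (fun x => expR (f x))
| gen_comp k (B : set 'rV[R]_k) h (r : 'rV[R]_m -> 'rV[R]_k) :
    smooth_on B h -> (forall x, A x -> B (r x)) ->
    (forall j, generated (fun x => r x 0 j)) -> generated (fun x => h (r x)).

Lemma gen_sum (I : Type) (s : seq I) (P : pred I) (f : I -> 'rV[R]_m -> R) :
  (forall j, generated (f j)) -> generated (fun x => \sum_(j <- s | P j) f j x).
Proof.
move=> gf; elim: s => [|j s IH].
  by under eq_fun do rewrite big_nil; exact: gen_cst.
under eq_fun do rewrite big_cons; case: (P j) => //; exact: gen_add.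
Qed.

Hypothesis openA : open A.
Hypothesis base_partial : forall f, B0 f ->
  (forall x, A x -> differentiable f x) /\ forall i, generated (partial i f).

(** Induction on the construction of f: each differentiation rule expresses the partials through the
    same constructors. For [gen_comp] the outer function is replaced by its own partials, which are
    again smooth on B. *)
Lemma generated_partial f : generated f -> (forall x, A x -> differentiable f x)
  /\ forall i, generated (partial i f).
Proof.
have hp g d i : (forall x, A x -> has_partial i g x (d x)) -> generated d ->
    generated (partial i g).
  by move=> gd /gen_eq; apply => x /gd[].
elim => {f}[f /base_partial//|f g _ [df pf] fg|c|f g gf [df pf] gg [dg pg]
  |f g gf [df pf] gg [dg pg]|f gf [df pf] f0|f a gf [df pf] f0
  |f gf [df pf]|k B h r hB AB gr IH].
- split=> [x Ax|i].
    apply: near_eq_differentiable (df x Ax); exact: (open_near openA Ax).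
  apply: gen_eq (pf i) _ => x Ax; exact: (eq_partial_open _ openA Ax).
- split=> [x _|i]; first exact: differentiable_cst.
  by apply: (hp _ (fun=> 0)) => [x _|]; [exact: has_partialC|exact: gen_cst].
- split=> [x Ax|i]; first by apply: differentiableD; [exact: df|exact: dg].
  apply: (hp _ (fun x => partial i f x + partial i g x)) => [x Ax|].
    by apply: has_partialD; apply: differentiable_has_partial; [exact: df|exact: dg].
  exact: gen_add.
- split=> [x Ax|i]; first by apply: differentiableM; [exact: df|exact: dg].
  apply: (hp _ (fun x => partial i f x * g x + f x * partial i g x)) => [x Ax|].
    by apply: has_partialM; apply: differentiable_has_partial; [exact: df|exact: dg].
  by apply: gen_add; exact: gen_mul.
- split=> [x Ax|i]; first by apply: differentiableV; [exact: df|exact: f0].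
  apply: (hp _ (fun x => (-1) * partial i f x * (f x * f x)^-1)) => [x Ax|].
    rewrite mulN1r -expr2; apply: has_partialV (f0 x Ax) _.
    exact: differentiable_has_partial (df x Ax).
  apply: gen_mul; first by apply: gen_mul; [exact: gen_cst|].
  by apply: gen_inv => [|x Ax]; [exact: gen_mul|rewrite mulf_neq0 ?f0].
- split=> [x Ax|i]; first by apply: differentiable_powR; [exact: df|exact: f0].
  apply: (hp _ (fun x => a * f x `^ (a - 1) * partial i f x)) => [x Ax|].
    by apply: has_partial_powR (f0 x Ax) _; exact: differentiable_has_partial (df x Ax).
  apply: gen_mul => //; apply: gen_mul; [exact: gen_cst|exact: gen_powR].
- have he i x : A x -> has_partial i (fun y => expR (f y)) x (expR (f x) * partial i f x).
    by move=> Ax; apply: has_partial_expR; exact: differentiable_has_partial (df x Ax).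
  split=> [x Ax|i].
    apply: (@differentiable_comp _ _ _ _ f (@expR R)); first exact: df.
    exact/derivable1_diffP/derivable_expR.
  apply: (hp _ _ _ (he i)); apply: gen_mul => //; exact: gen_expR.
- have hd x : A x -> differentiable h (r x) by move=> /AB; exact: (hB [::]).
  have hr x : A x -> forall j, differentiable (fun y => r y 0 j) x.
    by move=> Ax j; exact: (IH j).1.
  split=> [x Ax|i].
    exact: (differentiable_comp (differentiable_row (hr x Ax)) (hd x Ax)).
  apply: (@gen_eq (fun x => \sum_j partial j h (r x) * partial i (fun y => r y 0 j) x)).
    apply: gen_sum => j; apply: gen_mul; last exact: (IH j).2.
    apply: (@gen_comp k B (partial j h)) => // s x Bx.
    by have := hB (rcons s j) x Bx; rewrite foldr_rcons.
  by move=> x Ax; rewrite partial_comp//; [exact: hr|exact: hd].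
Qed.

Lemma generated_smooth f : generated f -> smooth_on A f.
Proof.
move=> gf s; suff : generated (foldr (fun i g => partial i g) f s).
  by move=> /generated_partial[].
by elim: s => //= i s /generated_partial[_]; exact.
Qed.

End smooth_generation.

(** * Closure properties of smooth functions *)

Section smooth_on.
Context {R : realType} {m : nat}.
Variable (A : set 'rV[R]_m).
Hypothesis openA : open A.
Implicit Types (f g : 'rV[R]_m -> R).

Lemma smooth_differentiable f x : smooth_on A f -> A x -> differentiable f x.
Proof. by move=> sf; exact: (sf [::]). Qed.

Lemma smooth_partial i f : smooth_on A f -> smooth_on A (partial i f).
Proof. by move=> sf s x Ax; have := sf (rcons s i) x Ax; rewrite foldr_rcons. Qed.

Lemma smooth_has_partial i f x : smooth_on A f -> A x ->
  has_partial i f x (partial i f x).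
Proof. by move=> sf Ax; split => //; exact: smooth_differentiable sf Ax. Qed.

Lemma generated_smooth_on f : generated A (smooth_on A) f -> smooth_on A f.
Proof.
apply: generated_smooth openA _ f => g sg; split=> [x|i].
  exact: smooth_differentiable.
by apply: gen_base; exact: smooth_partial.
Qed.

Lemma smooth_eq f g : smooth_on A f -> (forall x, A x -> f x = g x) -> smooth_on A g.
Proof.
by move=> sf fg; apply: generated_smooth_on; apply: gen_eq fg; exact: gen_base.
Qed.

Lemma smooth_cst c : smooth_on A (fun=> c).
Proof. by apply: generated_smooth_on; exact: gen_cst. Qed.

Lemma smoothD f g : smooth_on A f -> smooth_on A g -> smooth_on A (fun x => f x + g x).
Proof. by move=> *; apply: generated_smooth_on; apply: gen_add; exact: gen_base. Qed.

Lemma smoothM f g : smooth_on A f -> smooth_on A g -> smooth_on A (fun x => f x * g x).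
Proof. by move=> *; apply: generated_smooth_on; apply: gen_mul; exact: gen_base. Qed.

Lemma smoothN f : smooth_on A f -> smooth_on A (fun x => - f x).
Proof.
move=> sf; apply: smooth_eq (smoothM (smooth_cst (-1)) sf) _ => x _.
by rewrite mulN1r.
Qed.

Lemma smoothB f g : smooth_on A f -> smooth_on A g -> smooth_on A (fun x => f x - g x).
Proof. by move=> sf sg; apply: smoothD => //; exact: smoothN. Qed.

Lemma smoothV f : smooth_on A f -> (forall x, A x -> f x != 0) ->
  smooth_on A (fun x => (f x)^-1).
Proof. by move=> *; apply: generated_smooth_on; apply: gen_inv => //; exact: gen_base. Qed.

Lemma smooth_powR f a : smooth_on A f -> (forall x, A x -> 0 < f x) ->
  smooth_on A (fun x => f x `^ a).
Proof. by move=> *; apply: generated_smooth_on; apply: gen_powR => //; exact: gen_base. Qed.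

Lemma smooth_sqrt f : smooth_on A f -> (forall x, A x -> 0 < f x) ->
  smooth_on A (fun x => Num.sqrt (f x)).
Proof.
move=> sf f0; apply: smooth_eq (smooth_powR 2^-1 sf f0) _ => x Ax.
by rewrite powR12_sqrt// ltW ?f0.
Qed.

Lemma smooth_expR f : smooth_on A f -> smooth_on A (fun x => expR (f x)).
Proof. by move=> *; apply: generated_smooth_on; apply: gen_expR; exact: gen_base. Qed.

Lemma smooth_sum (I : Type) (s : seq I) (P : pred I) (f : I -> 'rV[R]_m -> R) :
  (forall j, smooth_on A (f j)) -> smooth_on A (fun x => \sum_(j <- s | P j) f j x).
Proof. by move=> *; apply: generated_smooth_on; apply: gen_sum => j; exact: gen_base. Qed.

Lemma smooth_comp k (B : set 'rV[R]_k) h (r : 'rV[R]_m -> 'rV[R]_k) :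
  smooth_on B h -> (forall x, A x -> B (r x)) -> smooth_map_on A r ->
  smooth_on A (fun x => h (r x)).
Proof.
move=> sh AB sr; apply: generated_smooth_on; apply: gen_comp sh AB _ => j.
by apply: gen_base; exact: sr.
Qed.

Lemma smooth_coord i : smooth_on A (fun x => x 0 i).
Proof.
apply: (@generated_smooth _ _ A (fun f => exists i, f = fun x => x 0 i) openA).
  move=> _ [j ->]; split=> [x _|k]; first exact: differentiable_coord.
  apply: gen_eq (gen_cst _ _ (k == j)%:R) _ => x _.
  by rewrite (has_partialE (has_partial_coord k j x)).
by apply: gen_base; exists i.
Qed.

Lemma smooth_onS (B : set 'rV[R]_m) f : B `<=` A -> smooth_on A f -> smooth_on B f.
Proof. by move=> BA sf s x /BA; exact: sf. Qed.

Lemma smooth_continuous f x : smooth_on A f -> A x -> {for x, continuous f}.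
Proof. by move=> sf Ax; apply/differentiable_continuous/(smooth_differentiable sf). Qed.

End smooth_on.

(** * The mean value theorem along a segment *)

Section mean_value.
Context {R : realType} {V : normedModType R}.
Implicit Types (f : V -> R) (x v : V).

Lemma is_derive_line f x v (t : R) : differentiable f (x + t *: v) ->
  is_derive t 1 (fun s => f (x + s *: v)) ('D_v f (x + t *: v)).
Proof.
move=> df; have [dfl dflE] : is_diff t (cst x + ( *:%R^~ v : R -> V)) (0 + *:%R^~ v).
  exact: is_diffD.
have dl : 'd (fun s : R => x + s *: v) t 1 = v.
  rewrite -[RHS](scale1r v) -[RHS]add0r; exact: (congr1 (@^~ (1 : R)) dflE).
apply: DeriveDef; first by apply/derivable1_diffP; exact: differentiable_comp.
rewrite deriveE; last exact: differentiable_comp.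
by rewrite (diff_comp dfl df) /= dl deriveE.
Qed.

Lemma line_MVT f x v :
  (forall t : R, 0 <= t <= 1 -> differentiable f (x + t *: v)) ->
  exists2 t : R, 0 < t < 1 & f (x + v) - f x = 'D_v f (x + t *: v).
Proof.
move=> df; have dg (t : R) : 0 <= t <= 1 ->
    is_derive t (1 : R) (fun s => f (x + s *: v)) ('D_v f (x + t *: v)).
  by move=> /df; exact: is_derive_line.
have [|||t] := @MVT R (fun s => f (x + s *: v)) (fun s => 'D_v f (x + s *: v)) 0 1.
- exact: ltr01.
- by move=> t; rewrite in_itv /= => /andP[/ltW t0 /ltW t1]; apply: dg; rewrite t0.
- apply: derivable_within_continuous => t; rewrite in_itv /= => t01.
  by case: (dg t t01).
by rewrite in_itv /= => t01; rewrite scale1r scale0r addr0 subr0 mulr1; exists t.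
Qed.

End mean_value.

Lemma is_diff_addr {R : realType} {V : normedModType R} (v x : V) :
  is_diff x (fun y => y + v) id.
Proof.
apply: DiffDef; last first.
  rewrite -[fun y => y + v]/((id : V -> V) + cst v).
  rewrite diffD//; rewrite !diff_val; apply/funext => h /=.
  exact: addr0.
by rewrite -[fun y => y + v]/((id : V -> V) + cst v); exact: differentiableD.
Qed.

(** * Symmetry of second derivatives *)

Section schwarz.
Context {R : realType} {m : nat}.
Implicit Types (f : 'rV[R]_m -> R) (x u v : 'rV[R]_m).

(** The mean value theorem is used twice: along u for y |-> f (y + v) - f y, then along v for
    [partial i f]. *)
Lemma second_difference f (A : set 'rV[R]_m) x (i j : 'I_m) (t : R) :
  let u := t *: delta_mx 0 i : 'rV[R]_m in
  let v := t *: delta_mx 0 j : 'rV[R]_m in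
  smooth_on A f ->
  (forall a b : R, 0 <= a <= 1 -> 0 <= b <= 1 -> A (x + a *: u + b *: v)) ->
  exists a b : R, [/\ 0 <= a <= 1, 0 <= b <= 1 &
    f (x + u + v) - f (x + u) - (f (x + v) - f x) =
    t ^+ 2 * partial j (partial i f) (x + a *: u + b *: v)].
Proof.
move=> u v sf Asub.
have Dw (k : 'I_m) g y : differentiable g y ->
    'D_(t *: delta_mx 0 k) g y = t * partial k g y.
  by move=> dg; rewrite deriveE// linearZ /= /partial deriveE.
have df y : A y -> differentiable f y by move=> Ay; exact: (sf [::]).
have i01 : 0 <= (1 : R) <= 1 by rewrite ler01 lexx.
have i00 : 0 <= (0 : R) <= 1 by rewrite ler01 lexx.
pose g y := f (y + v) - f y.
have Av y : A (y + v) -> A y -> differentiable g y.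
  move=> Ayv Ay; apply: differentiableB; last exact: df.
  apply: (@differentiable_comp _ _ _ _ (fun y => y + v) f); last exact: df.
  by case: (is_diff_addr v y).
have A0 a : 0 <= a <= 1 -> A (x + a *: u).
  by move=> /Asub/(_ i00); rewrite scale0r addr0.
have A1 a : 0 <= a <= 1 -> A (x + a *: u + v).
  by move=> /Asub/(_ i01); rewrite scale1r.
have [a /andP[/ltW a0 /ltW a1] ga] := @line_MVT _ _ g x u (fun a Ha => Av _ (A1 a Ha) (A0 a Ha)).
have a01 : 0 <= a <= 1 by rewrite a0.
have dif y : A y -> differentiable (partial i f) y by move=> Ay; exact: (sf [:: i]).
have [b /andP[/ltW b0 /ltW b1] gb] :=
  @line_MVT _ _ (partial i f) (x + a *: u) v (fun b Hb => dif _ (Asub a b a01 Hb)).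
have b01 : 0 <= b <= 1 by rewrite b0.
exists a, b; split=> //.
have -> : f (x + u + v) - f (x + u) - (f (x + v) - f x) = g (x + u) - g x by [].
rewrite ga /u (Dw _ _ _ (Av _ (A1 a a01) (A0 a a01))) -/u expr2 -mulrA.
rewrite -(Dw _ _ _ (dif _ (Asub a b a01 b01))) -/v -gb; congr (_ * _).
have dfs : differentiable (fun y => f (y + v)) (x + a *: u).
  apply: (@differentiable_comp _ _ _ _ (fun y => y + v) f); last exact/df/A1.
  by case: (is_diff_addr v (x + a *: u)).
rewrite /partial -[g]/((fun y => f (y + v)) - f) deriveB; try exact: diff_derivable.
  congr (_ - _); rewrite (deriveE _ dfs).
  have [ds dsE] := is_diff_addr v (x + a *: u).
  have dfa := df _ (A1 a a01).
  rewrite (@diff_comp _ _ _ _ (fun y => y + v) f _ ds dfa) /=.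
  by rewrite dsE (deriveE _ dfa).
exact/diff_derivable/df/A0.
Qed.

Lemma norm_delta_row (i : 'I_m) : `|delta_mx 0 i : 'rV[R]_m| <= 1.
Proof.
rewrite [leLHS]/Num.Def.normr/= mx_normrE (bigmax_le _ ler01)//= => -[a b] _.
by rewrite mxE; case: (_ && _); rewrite ?normr1 ?normr0 ?ler01.
Qed.

(** The second difference is symmetric in the two directions, so the two mixed partials take a
    common value at points arbitrarily close to x; continuity transfers this to x. *)
Lemma partialC f (A : set 'rV[R]_m) x (i j : 'I_m) : open A -> smooth_on A f ->
  A x -> partial i (partial j f) x = partial j (partial i f) x.
Proof.
move=> oA sf Ax; apply/eqP; rewrite -subr_eq0 -normr_le0.
apply/ler_addgt0Pr => e e0; rewrite add0r.
have e20 : 0 < e / 2 by rewrite divr_gt0.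
have cP (k l : 'I_m) : \forall y \near x,
    `|partial k (partial l f) x - partial k (partial l f) y| < e / 2.
  have /cvgrPdist_lt : {for x, continuous (partial k (partial l f))}.
    by apply: differentiable_continuous; exact: (sf [:: k; l]).
  exact.
have nb : \forall y \near x, [/\ A y,
    `|partial i (partial j f) x - partial i (partial j f) y| < e / 2 &
    `|partial j (partial i f) x - partial j (partial i f) y| < e / 2].
  have nA := open_nbhs_nbhs (conj oA Ax).
  by apply: filterS3 nA (cP i j) (cP j i) => y.
have /nbhs_ballP[d /= d0 dball] := nb.
have dsub y (h : `|x - y| < d) := dball y ltac:(by rewrite -ball_normE).
(* The parallelogram spanned by the two steps of length t must lie in the ball of radius d, whence t
   + t < d. *)
have [t t0 td] : exists2 t, 0 < t & t + t < d.
  by exists (d / 3); [rewrite divr_gt0|lra].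
have ball_t (k l : 'I_m) (a b : R) : 0 <= a <= 1 -> 0 <= b <= 1 ->
    `|x - (x + a *: (t *: delta_mx 0 k) + b *: (t *: delta_mx 0 l))| < d.
  move=> /andP[a0 a1] /andP[b0 b1].
  rewrite -addrA opprD addrA subrr sub0r normrN.
  rewrite (le_lt_trans (ler_normD _ _))// !normrZ (ger0_norm a0) (ger0_norm b0).
  rewrite (gtr0_norm t0).
  have nk := norm_delta_row k; have nl := norm_delta_row l.
  apply: (@le_lt_trans _ _ (t + t)) => //.
  have bound (c z : R) : 0 <= c -> c <= 1 -> 0 <= z -> z <= 1 -> c * (t * z) <= t.
    move=> c0 c1 z0 z1; rewrite mulrCA -[leRHS]mulr1.
    by rewrite ler_pM2l// mulr_ile1.
  by apply: lerD; apply: bound.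
pose Dl (k l : 'I_m) := f (x + t *: delta_mx 0 k + t *: delta_mx 0 l)
  - f (x + t *: delta_mx 0 k) - (f (x + t *: delta_mx 0 l) - f x).
have DlC k l : Dl k l = Dl l k.
  have -> : Dl l k = f (x + t *: delta_mx 0 k + t *: delta_mx 0 l)
      - f (x + t *: delta_mx 0 l) - (f (x + t *: delta_mx 0 k) - f x).
    by rewrite /Dl; congr (f _ - _ - _); exact: addrAC.
  have aux (a b c c' : R) : a - b - (c - c') = a - c - (b - c') by ring.
  exact: aux.
have near_val (k l : 'I_m) : exists y, `|x - y| < d /\
    Dl k l = t ^+ 2 * partial l (partial k f) y.
  have [|a [b [a01 b01 E]]] := @second_difference f A x k l t sf.
    by move=> a b a01 b01; have [] := dsub _ (ball_t k l a b a01 b01).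
  by exists (x + a *: (t *: delta_mx 0 k) + b *: (t *: delta_mx 0 l)); split;
    [exact: ball_t|exact: E].
have [y [dy Ey]] := near_val i j; have [z [dz Ez]] := near_val j i.
have tt : t ^+ 2 != 0 by rewrite expf_neq0// lt0r_neq0.
have yz : partial j (partial i f) y = partial i (partial j f) z.
  apply: (mulfI tt); apply: etrans (esym Ey) _; apply: etrans Ez; exact: DlC.
have [_ _ /ltW hy] := dsub y dy; have [_ /ltW hz _] := dsub z dz.
rewrite (splitr e).
have hyz : `|(partial i (partial j f) x - partial i (partial j f) z)
  - (partial j (partial i f) x - partial j (partial i f) y)| <= e / 2 + e / 2.
  exact: (le_trans (ler_normB _ _) (lerD hz hy)).
apply: le_trans hyz; rewrite yz.
have aux (a b c : R) : a - c - (b - c) = a - b by ring.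
by rewrite aux.
Qed.

End schwarz.
(** * Calculus of matrix-valued functions *)

Definition smooth_mx {R : realType} m a b (A : set 'rV[R]_m)
  (M : 'rV[R]_m -> 'M[R]_(a, b)) := forall k l, smooth_on A (fun x => M x k l).

Definition partial_mx {R : realType} m a b (i : 'I_m)
  (M : 'rV[R]_m -> 'M[R]_(a, b)) x : 'M[R]_(a, b) :=
  \matrix_(k, l) partial i (fun y => M y k l) x.

Definition has_partial_mx {R : realType} m a b (i : 'I_m)
    (M : 'rV[R]_m -> 'M[R]_(a, b)) x (D : 'M[R]_(a, b)) :=
  forall k l, has_partial i (fun y => M y k l) x (D k l).

Section matrix_calculus.
Context {R : realType} {m : nat}.
Implicit Types (f : 'rV[R]_m -> R) (x : 'rV[R]_m) (i : 'I_m).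

Lemma has_partial_prod (I : finType) (f : I -> 'rV[R]_m -> R) (d : I -> R) i x :
  (forall j, has_partial i (f j) x (d j)) ->
  has_partial i (fun y => \prod_j f j y) x (\sum_k d k * \prod_(j | j != k) f j x).
Proof.
move=> h; suff : forall s : seq I, uniq s ->
    has_partial i (fun y => \prod_(j <- s) f j y) x
      (\sum_(k <- s) d k * \prod_(j <- s | j != k) f j x).
  by apply; exact: index_enum_uniq.
elim=> [_|j s IH /= /andP[js us]].
  under eq_fun do rewrite big_nil; rewrite big_nil; exact: has_partialC.
under eq_fun do rewrite big_cons.
apply: has_partial_eq (has_partialM (h j) (IH us)) _.
rewrite big_cons big_cons eqxx /=; congr (_ * _ + _).
  rewrite [RHS]big_seq_cond [LHS]big_seq; apply: eq_bigl => k.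
  by case: (boolP (k \in s)) => //= ks; apply/esym; apply: contraNneq js => <-.
rewrite mulr_sumr; apply: eq_big_seq => k ks.
rewrite big_cons ifT; first by rewrite mulrCA.
by apply: contraNneq js => ->.
Qed.

Lemma has_partial_mx_eq a b i (M : 'rV[R]_m -> 'M[R]_(a, b)) x D D' :
  has_partial_mx i M x D -> D = D' -> has_partial_mx i M x D'.
Proof. by move=> h <-. Qed.

Lemma has_partial_mxE a b i (M : 'rV[R]_m -> 'M[R]_(a, b)) x D :
  has_partial_mx i M x D -> partial_mx i M x = D.
Proof. by move=> h; apply/matrixP => k l; rewrite mxE (has_partialE (h k l)). Qed.

Lemma has_partial_mxC a b i (C : 'M[R]_(a, b)) x : has_partial_mx i (fun=> C) x 0.
Proof. by move=> k l; rewrite mxE; exact: has_partialC. Qed.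

Lemma has_partial_mxD a b i (M N : 'rV[R]_m -> 'M[R]_(a, b)) x D E :
  has_partial_mx i M x D -> has_partial_mx i N x E ->
  has_partial_mx i (fun y => M y + N y) x (D + E).
Proof.
move=> hM hN k l; rewrite mxE; under eq_fun do rewrite mxE.
exact: has_partialD.
Qed.

Lemma has_partial_mxN a b i (M : 'rV[R]_m -> 'M[R]_(a, b)) x D :
  has_partial_mx i M x D -> has_partial_mx i (fun y => - M y) x (- D).
Proof.
by move=> hM k l; rewrite mxE; under eq_fun do rewrite mxE; exact: has_partialN.
Qed.

Lemma has_partial_trmx a b i (M : 'rV[R]_m -> 'M[R]_(a, b)) x D :
  has_partial_mx i M x D -> has_partial_mx i (fun y => (M y)^T) x D^T.
Proof. by move=> hM k l; rewrite mxE; under eq_fun do rewrite mxE. Qed.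

Lemma has_partial_mulmx a b c i (M : 'rV[R]_m -> 'M[R]_(a, b))
    (N : 'rV[R]_m -> 'M[R]_(b, c)) x D E :
  has_partial_mx i M x D -> has_partial_mx i N x E ->
  has_partial_mx i (fun y => M y *m N y) x (D *m N x + M x *m E).
Proof.
move=> hM hN k l; rewrite !mxE -big_split /=.
under eq_fun do rewrite mxE.
by apply: has_partial_sum => j; exact: has_partialM.
Qed.

Lemma has_partial_scalemx a b i f (M : 'rV[R]_m -> 'M[R]_(a, b)) x d D :
  has_partial i f x d -> has_partial_mx i M x D ->
  has_partial_mx i (fun y => f y *: M y) x (d *: M x + f x *: D).
Proof.
move=> hf hM k l; rewrite !mxE; under eq_fun do rewrite mxE.
exact: has_partialM.
Qed.

Lemma has_partial_trace a i (M : 'rV[R]_m -> 'M[R]_a) x D :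
  has_partial_mx i M x D -> has_partial i (fun y => \tr (M y)) x (\tr D).
Proof. by move=> hM; apply: has_partial_sum => j. Qed.

(** Jacobi's formula. Differentiating the k-th factor of each product gives the determinant with row
    k replaced by that of D; expanding along this row yields the adjugate. *)
Lemma has_partial_det a i (M : 'rV[R]_m -> 'M[R]_a) x D :
  has_partial_mx i M x D ->
  has_partial i (fun y => \det (M y)) x (\tr (D *m \adj (M x))).
Proof.
move=> hM; rewrite /determinant.
apply: (@has_partial_eq _ _ _ _ _ (\sum_(s : 'S_a) (-1) ^+ s *
    \sum_k D k (s k) * \prod_(j | j != k) M x j (s j))).
  apply: has_partial_sum => s.
  apply: has_partial_eq (has_partialM (has_partialC i ((-1) ^+ s) x)
    (has_partial_prod (fun j => hM j (s j)))) _.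
  by rewrite mul0r add0r.
under eq_bigr do rewrite mulr_sumr.
rewrite exchange_big /=; apply: eq_bigr => k _; rewrite mxE.
pose Mk : 'M[R]_a := \matrix_(p, q) if p == k then D p q else M x p q.
transitivity (\det Mk).
  apply: eq_bigr => s _; congr (_ * _).
  rewrite [RHS](bigD1 k) //= mxE eqxx; congr (_ * _).
  by apply: eq_bigr => j /negbTE jk; rewrite mxE jk.
rewrite (expand_det_row _ k); apply: eq_bigr => l _; rewrite !mxE eqxx.
congr (_ * (_ * \det _)); apply/matrixP => p q; rewrite !mxE ifN//.
by rewrite eq_sym neq_lift.
Qed.

End matrix_calculus.

Section smooth_matrices.
Context {R : realType} {m : nat}.
Variable A : set 'rV[R]_m.
Hypothesis openA : open A.

Lemma smooth_prod (I : Type) (s : seq I) (P : pred I) (f : I -> 'rV[R]_m -> R) :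
  (forall j, smooth_on A (f j)) -> smooth_on A (fun x => \prod_(j <- s | P j) f j x).
Proof.
move=> sf; elim: s => [|j s IH].
  under eq_fun do rewrite big_nil; exact: smooth_cst.
under eq_fun do rewrite big_cons; case: (P j) => //; exact: smoothM.
Qed.

Lemma smooth_mx_has_partial a b (M : 'rV[R]_m -> 'M[R]_(a, b)) i x :
  smooth_mx A M -> A x -> has_partial_mx i M x (partial_mx i M x).
Proof. by move=> sM Ax k l; rewrite mxE; exact: smooth_has_partial. Qed.

Lemma smooth_mx_partial a b (M : 'rV[R]_m -> 'M[R]_(a, b)) i :
  smooth_mx A M -> smooth_mx A (partial_mx i M).
Proof.
move=> sM k l; under eq_fun do rewrite mxE; exact: smooth_partial.
Qed.

Lemma smooth_mx_eq a b (M N : 'rV[R]_m -> 'M[R]_(a, b)) :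
  smooth_mx A M -> (forall x, A x -> M x = N x) -> smooth_mx A N.
Proof. by move=> sM MN k l; apply: smooth_eq (sM k l) _ => // x Ax; rewrite MN. Qed.

Lemma smooth_mulmx a b c (M : 'rV[R]_m -> 'M[R]_(a, b)) (N : 'rV[R]_m -> 'M[R]_(b, c)) :
  smooth_mx A M -> smooth_mx A N -> smooth_mx A (fun x => M x *m N x).
Proof.
move=> sM sN k l; under eq_fun do rewrite mxE.
by apply: smooth_sum => // j; exact: smoothM.
Qed.

Lemma smooth_trmx a b (M : 'rV[R]_m -> 'M[R]_(a, b)) :
  smooth_mx A M -> smooth_mx A (fun x => (M x)^T).
Proof. by move=> sM k l; under eq_fun do rewrite mxE; exact: sM. Qed.

Lemma smooth_scalemx a b f (M : 'rV[R]_m -> 'M[R]_(a, b)) :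
  smooth_on A f -> smooth_mx A M -> smooth_mx A (fun x => f x *: M x).
Proof. by move=> sf sM k l; under eq_fun do rewrite mxE; exact: smoothM. Qed.

Lemma smooth_trace a (M : 'rV[R]_m -> 'M[R]_a) :
  smooth_mx A M -> smooth_on A (fun x => \tr (M x)).
Proof. by move=> sM; apply: smooth_sum. Qed.

Lemma smooth_det a (M : 'rV[R]_m -> 'M[R]_a) :
  smooth_mx A M -> smooth_on A (fun x => \det (M x)).
Proof.
move=> sM; apply: smooth_sum => // s; apply: smoothM => //; first exact: smooth_cst.
exact: smooth_prod.
Qed.

(** Cramer's formula: the entries of the adjugate are polynomials in those of M. *)
Lemma smooth_invmx a (M : 'rV[R]_m -> 'M[R]_a) :
  smooth_mx A M -> (forall x, A x -> M x \in unitmx) ->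
  smooth_mx A (fun x => invmx (M x)).
Proof.
move=> sM uM; apply: (@smooth_mx_eq _ _ (fun x => (\det (M x))^-1 *: \adj (M x))).
  apply: smooth_scalemx.
    apply: smoothV => //; first exact: smooth_det.
    by move=> x /uM; rewrite unitmxE unitfE.
  move=> k l; under eq_fun do rewrite mxE.
  apply: smoothM => //; first exact: smooth_cst.
  by apply: smooth_det => p q; under eq_fun do rewrite !mxE; exact: sM.
by move=> x Ax; rewrite /invmx uM.
Qed.

(** Once smoothness of the inverse is known, its derivative follows by differentiating M^-1 M =
    1. *)
Lemma has_partial_invmx a i (M : 'rV[R]_m -> 'M[R]_a) x D :
  smooth_mx A M -> (forall x, A x -> M x \in unitmx) -> A x ->
  has_partial_mx i M x D ->
  has_partial_mx i (fun y => invmx (M y)) x (- (invmx (M x) *m D *m invmx (M x))).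
Proof.
move=> sM uM Ax hM; have hI := smooth_mx_has_partial i (smooth_invmx sM uM) Ax.
apply: (has_partial_mx_eq hI); move: hI; set J := partial_mx _ _ _ => hI.
have /has_partial_mxE := has_partial_mulmx hI hM.
have -> : partial_mx i (fun y => invmx (M y) *m M y) x = 0.
  apply/matrixP => k l; rewrite !mxE.
  rewrite (@eq_partial_open _ _ _ A _ (fun=> (1%:M : 'M[R]_a) k l))//.
    exact: (has_partialE (has_partialC _ _ _)).
  by move=> y Ay; rewrite mulVmx// uM.
move=> /esym/eqP; rewrite addr_eq0 => /eqP/(congr1 (mulmx^~ (invmx (M x)))) /=.
by rewrite mulmxK ?uM// => ->; rewrite mulNmx.
Qed.

End smooth_matrices.
(** * Geometry of the level sets *)

Definition frame {R : realType} {n} (r : 'rV[R]_n.+1 -> 'rV[R]_n.+1) u : 'M[R]_(n, n.+1) :=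
  \matrix_(i, j) partial (lift ord0 i) (fun v => r v 0 j) u.

(* The data of a curvilinear chart, with the unit normal N and phi = - 1 / F. *)
Record framed_chart {R : realType} {n} (U : set 'rV[R]_n.+1)
    (r N : 'rV[R]_n.+1 -> 'rV[R]_n.+1) (phi : 'rV[R]_n.+1 -> R) : Prop := FramedChart {
  fc_open : open U;
  fc_smooth : smooth_mx U r;
  fc_smoothN : smooth_mx U N;
  fc_smooth_phi : smooth_on U phi;
  fc_flow : forall u, U u -> partial_mx ord0 r u = phi u *: N u;
  fc_normal : forall u, U u -> frame r u *m (N u)^T = 0;
  fc_unit : forall u, U u -> N u *m (N u)^T = 1%:M;
  fc_gunit : forall u, U u -> frame r u *m (frame r u)^T \in unitmx;
  fc_det : forall u, U u -> 0 < \det (frame r u *m (frame r u)^T);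
  fc_complete : forall u, U u ->
    (frame r u)^T *m invmx (frame r u *m (frame r u)^T) *m frame r u
    + (N u)^T *m N u = 1%:M }.

Section framed_chart_geometry.
Context {R : realType} {n : nat}.
Variables (U : set 'rV[R]_n.+1) (r N : 'rV[R]_n.+1 -> 'rV[R]_n.+1).
Variable phi : 'rV[R]_n.+1 -> R.
Hypothesis FC : framed_chart U r N phi.
Implicit Types (i j k l : 'I_n) (u : 'rV[R]_n.+1).

Let oU : open U := fc_open FC.
Let sr : smooth_mx U r := fc_smooth FC.
Let sN : smooth_mx U N := fc_smoothN FC.
Let sphi : smooth_on U phi := fc_smooth_phi FC.
Local Notation E := (frame r).
Local Notation T i := (partial_mx (lift ord0 i)).
Local Notation t i := (partial (lift ord0 i)).

Definition first_form u : 'M[R]_n := E u *m (E u)^T.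
Local Notation g := first_form.
Definition inv_form u := invmx (g u).
Local Notation gi := inv_form.
(** The (j, k) entry is the Christoffel symbol with lower indices i, j and upper index k, obtained
    by projecting d_i d_j r onto the frame; [christoffel_conn] identifies it with the expression in
    the metric. *)
Definition conn i u : 'M[R]_n := T i E u *m (E u)^T *m gi u.
Definition sff i u : 'cV[R]_n := T i E u *m (N u)^T.
Definition sform u : 'M[R]_n := \matrix_(i, j) sff i u j 0.
Local Notation b := sform.

Lemma smooth_frame : smooth_mx U E.
Proof. by move=> i j; under eq_fun do rewrite mxE; apply: smooth_partial; exact: sr. Qed.
Let sE := smooth_frame.

Lemma smooth_first_form : smooth_mx U g.
Proof. by apply: smooth_mulmx => //; apply: smooth_trmx. Qed.
Let sg := smooth_first_form.

Lemma first_form_unit u : U u -> g u \in unitmx.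
Proof. exact: (fc_gunit FC). Qed.

Lemma smooth_inv_form : smooth_mx U gi.
Proof. apply: smooth_invmx => //; exact: first_form_unit. Qed.
Let sgi := smooth_inv_form.

Lemma smooth_conn i : smooth_mx U (conn i).
Proof.
apply: smooth_mulmx => //; apply: smooth_mulmx => //; last exact: smooth_trmx.
exact: smooth_mx_partial.
Qed.

Lemma smooth_sff i : smooth_mx U (sff i).
Proof.
by apply: smooth_mulmx => //; [exact: smooth_mx_partial|exact: smooth_trmx].
Qed.

Lemma smooth_sform : smooth_mx U b.
Proof. by move=> i j; under eq_fun do rewrite mxE; exact: smooth_sff. Qed.

Lemma eq_partial_mx a c (M M' : 'rV[R]_n.+1 -> 'M[R]_(a, c)) (k : 'I_n.+1) u : U u ->
  (forall v, U v -> M v = M' v) -> partial_mx k M u = partial_mx k M' u.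
Proof.
move=> Uu MM'; apply/matrixP => i j; rewrite !mxE.
by apply: (eq_partial_open _ oU Uu) => v Uv; rewrite MM'.
Qed.

Lemma partial_mxC a c (M : 'rV[R]_n.+1 -> 'M[R]_(a, c)) (k l : 'I_n.+1) u :
  smooth_mx U M -> U u ->
  partial_mx k (partial_mx l M) u = partial_mx l (partial_mx k M) u.
Proof.
move=> sM Uu; apply/matrixP => i j; rewrite [LHS]mxE [RHS]mxE.
have pE (k' l' : 'I_n.+1) : partial k' (fun y => partial_mx l' M y i j) u =
    partial k' (partial l' (fun v => M v i j)) u.
  by apply: (eq_partial_open _ oU Uu) => v Uv; rewrite mxE.
by rewrite (pE k l) (pE l k); exact: partialC oU (sM i j) Uu.
Qed.

Lemma row_frame i u : row i (E u) = T i r u.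
Proof. by apply/rowP => j; rewrite !mxE. Qed.

Lemma row_partial_frame (k : 'I_n.+1) i u : U u ->
  row i (partial_mx k E u) = T i (partial_mx k r) u.
Proof.
move=> Uu; rewrite (partial_mxC _ _ sr Uu); apply/rowP => j; rewrite !mxE.
by apply: (eq_partial_open _ oU Uu) => v Uv; rewrite !mxE.
Qed.

Lemma dtan_mx a c (M : 'rV[R]_n.+1 -> 'M[R]_(a, c)) (k : 'I_n.+1) u :
  smooth_mx U M -> U u -> partial k M u = partial_mx k M u.
Proof.
move=> sM Uu; rewrite /partial derive_mx//.
apply/derivable_mxP => i j; apply: diff_derivable.
exact: smooth_differentiable (sM i j) Uu.
Qed.

Lemma dtan_frame i u : U u -> dtan i r u = row i (E u).
Proof. by move=> Uu; rewrite row_frame /dtan dtan_mx. Qed.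

Lemma dtan_dtan_frame i j u : U u -> dtan i (dtan j r) u = row j (T i E u).
Proof.
move=> Uu; rewrite (row_partial_frame _ _ Uu) (partial_mxC _ _ sr Uu).
rewrite -dtan_mx//; last exact: smooth_mx_partial.
apply: (eq_partial_open _ oU Uu) => v Uv; exact: dtan_mx.
Qed.

Lemma dot_mulmx m (v w : 'rV[R]_m) : dot v w = (v *m w^T) 0 0.
Proof. by rewrite mxE; apply: eq_bigr => k _; rewrite mxE. Qed.

Lemma metric_first_form u : U u -> metric r u = g u.
Proof.
move=> Uu; apply/matrixP => i j; rewrite !mxE !dtan_frame//.
by apply: eq_bigr => k _; rewrite !mxE.
Qed.

Lemma inv_metric_inv_form u : U u -> inv_metric r u = gi u.
Proof. by move=> Uu; rewrite /inv_metric metric_first_form. Qed.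

Lemma sff_sym i j u : U u -> sff i u j 0 = sff j u i 0.
Proof.
move=> Uu; have rw p q : sff p u q 0 = (row q (T p E u) *m (N u)^T) 0 0.
  by rewrite -row_mul [RHS]mxE.
have e : row j (T i E u) = row i (T j E u) := etrans (row_partial_frame (lift ord0 i) j Uu)
  (etrans (partial_mxC (lift ord0 j) (lift ord0 i) sr Uu)
    (esym (row_partial_frame (lift ord0 j) i Uu))).
by apply: etrans (rw i j) (etrans _ (esym (rw j i))); rewrite e.
Qed.

Lemma sform_tr u : U u -> (b u)^T = b u.
Proof. by move=> Uu; apply/matrixP => i j; rewrite [LHS]mxE [LHS]mxE [RHS]mxE; exact: sff_sym. Qed.

Lemma first_form_tr u : (g u)^T = g u.
Proof. by rewrite trmx_mul trmxK. Qed.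

Lemma inv_form_tr u : (gi u)^T = gi u.
Proof. by rewrite trmx_inv first_form_tr. Qed.

(** [fc_complete] writes the identity as the sum of the tangential and the normal projection; for
    tangential k this is Gauss' formula. *)
Lemma partial_frame_decomp (k : 'I_n.+1) u : U u ->
  partial_mx k E u = partial_mx k E u *m (E u)^T *m gi u *m E u
    + partial_mx k E u *m (N u)^T *m N u.
Proof.
by move=> Uu; rewrite -[LHS]mulmx1 -(fc_complete FC Uu) mulmxDr !mulmxA.
Qed.

Lemma partial_tangent i u : U u -> T i E u = conn i u *m E u + sff i u *m N u.
Proof. by move=> Uu; rewrite {1}(partial_frame_decomp _ Uu). Qed.

Lemma partial_normal_unit (k : 'I_n.+1) u : U u -> partial_mx k N u *m (N u)^T = 0.
Proof.
move=> Uu; have hN := smooth_mx_has_partial k sN Uu.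
have /has_partial_mxE := has_partial_mulmx hN (has_partial_trmx hN).
rewrite (@eq_partial_mx _ _ _ (fun=> 1%:M) _ _ Uu (fc_unit FC)).
rewrite (has_partial_mxE (has_partial_mxC _ _ _)) -[X in _ = _ + X]trmxK.
rewrite trmx_mul trmxK => /matrixP/(_ 0 0); rewrite !mxE.
set s := \sum__ _ => s2; apply/matrixP => i j; rewrite !ord1 !mxE -/s.
by move/esym/eqP: s2; rewrite -mulr2n mulrn_eq0 /= => /eqP.
Qed.

(** Weingarten's equation. The derivative of N is tangential because N has unit length, and its
    tangential components come from differentiating E N^T = 0. *)
Lemma partial_normal (k : 'I_n.+1) u : U u ->
  partial_mx k N u = - ((partial_mx k E u *m (N u)^T)^T *m gi u *m E u).
Proof.
move=> Uu; have hN := smooth_mx_has_partial k sN Uu.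
have hE := smooth_mx_has_partial k sE Uu.
have /has_partial_mxE := has_partial_mulmx hE (has_partial_trmx hN).
rewrite (@eq_partial_mx _ _ _ (fun=> 0) _ _ Uu (fc_normal FC)).
rewrite (has_partial_mxE (has_partial_mxC _ _ _)) => /esym/eqP.
rewrite addrC addr_eq0 => /eqP/(congr1 trmx); rewrite trmx_mul trmxK linearN /= => NE.
rewrite -[LHS]mulmx1 -(fc_complete FC Uu) mulmxDr (mulmxA _ (N u)^T).
by rewrite partial_normal_unit// mul0mx addr0 !mulmxA NE !mulNmx.
Qed.

End framed_chart_geometry.

(** * Evolution of the frame, the metric and the mean curvature along u^0 *)

Section framed_chart_evolution.
Context {R : realType} {n : nat}.
Variables (U : set 'rV[R]_n.+1) (r N : 'rV[R]_n.+1 -> 'rV[R]_n.+1).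
Variable phi : 'rV[R]_n.+1 -> R.
Hypothesis FC : framed_chart U r N phi.
Implicit Types (i j k l : 'I_n) (u : 'rV[R]_n.+1).

Let oU : open U := fc_open FC.
Let sr : smooth_mx U r := fc_smooth FC.
Let sN : smooth_mx U N := fc_smoothN FC.
Let sphi : smooth_on U phi := fc_smooth_phi FC.
Let sE := smooth_frame FC.
Let sgi := smooth_inv_form FC.
Let sb := smooth_sform FC.
Local Notation E := (frame r).
Local Notation T i := (partial_mx (lift ord0 i)).
Local Notation t i := (partial (lift ord0 i)).
Local Notation T0 := (partial_mx ord0).
Local Notation g := (first_form r).
Local Notation gi := (inv_form r).
Local Notation b := (sform r N).

Definition tgrad (f : 'rV[R]_n.+1 -> R) u : 'rV[R]_n := (\row_i t i f u) *m gi u.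
Local Notation V := (tgrad phi).
Definition shape u : 'M[R]_n := gi u *m b u.
Local Notation W := shape.
Definition sqrt_det u : R := Num.sqrt (\det (g u)).
Definition normal_frame u : 'M[R]_(n, n.+1) := \matrix_(i, j) T i N u 0 j.
Local Notation DN := normal_frame.

Lemma smooth_tgrad f : smooth_on U f -> smooth_mx U (tgrad f).
Proof.
move=> sf; apply: smooth_mulmx => // i j; under eq_fun do rewrite mxE.
exact: smooth_partial.
Qed.

Lemma smooth_shape : smooth_mx U W.
Proof. exact: smooth_mulmx. Qed.

Lemma smooth_normal_frame : smooth_mx U DN.
Proof. move=> i j; under eq_fun do rewrite mxE; exact: smooth_mx_partial. Qed.

Lemma smooth_sqrt_det : smooth_on U sqrt_det.
Proof.
apply: smooth_sqrt => //; last exact: (fc_det FC).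
by apply: smooth_det => //; exact: (smooth_first_form FC).
Qed.

Lemma sqrt_det_gt0 u : U u -> 0 < sqrt_det u.
Proof. by move=> Uu; rewrite sqrtr_gt0; exact: (fc_det FC). Qed.

Lemma gi_g u : U u -> gi u *m g u = 1%:M.
Proof. by move=> Uu; rewrite mulVmx//; exact: (first_form_unit FC). Qed.

Lemma g_gi u : U u -> g u *m gi u = 1%:M.
Proof. by move=> Uu; rewrite mulmxV//; exact: (first_form_unit FC). Qed.

Let gi_EE u : U u -> gi u *m (E u *m (E u)^T) = 1%:M.
Proof. exact: gi_g. Qed.

Let EE_gi u w (M : 'M[R]_(n, w)) : U u -> E u *m ((E u)^T *m (gi u *m M)) = M.
Proof. by move=> Uu; rewrite !mulmxA -[E u *m _]/(g u) (g_gi Uu)// mul1mx. Qed.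

Lemma row_sform i u : row i (b u) = (sff r N i u)^T.
Proof. by apply/rowP => j; rewrite !mxE. Qed.

Lemma normal_frameE u : U u -> DN u = - (b u *m gi u *m E u).
Proof.
move=> Uu; apply/row_matrixP => i; rewrite linearN /= !row_mul row_sform.
by apply/rowP => j; rewrite 2!mxE (partial_normal FC) // !mxE.
Qed.

Lemma frame_normal_tr u : U u -> N u *m (E u)^T = 0.
Proof.
by move=> Uu; apply: trmx_inj; rewrite trmx_mul trmxK (fc_normal FC Uu) trmx0.
Qed.

Lemma normal_frame_sform u : U u -> b u = - (DN u *m (E u)^T).
Proof.
move=> Uu; rewrite normal_frameE// mulNmx opprK -!mulmxA.
by rewrite gi_EE// mulmx1.
Qed.

(** Since d_0 E_i = d_i (d_0 r) = d_i (phi N), the normal part is d_i phi and the tangential part is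
    phi times Weingarten's equation. *)
Lemma dpsi_frame u : U u ->
  T0 E u = (\col_i t i phi u) *m N u - phi u *: (b u *m gi u *m E u).
Proof.
move=> Uu; apply/row_matrixP => i.
rewrite (row_partial_frame FC _ _ Uu).
rewrite (eq_partial_mx FC _ Uu (fc_flow FC)).
have /has_partial_mxE -> := has_partial_scalemx
  (smooth_has_partial (lift ord0 i) sphi Uu) (smooth_mx_has_partial (lift ord0 i) sN Uu).
rewrite (partial_normal FC) // linearB /= linearZ /= !row_mul row_sform scalerN.
congr (_ - _); apply/rowP => j; rewrite !mxE big_ord1 !mxE.
by rewrite mulrC.
Qed.

Lemma dpsi_normal u : U u -> T0 N u = - (V u *m E u).
Proof.
move=> Uu; rewrite (partial_normal FC)// dpsi_frame// mulmxBl.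
rewrite -!mulmxA (fc_unit FC Uu) mulmx1 -scalemxAl -!mulmxA (fc_normal FC Uu).
rewrite !mulmx0 scaler0 subr0 /tgrad !mulmxA; congr (- (_ *m _ *m _)).
by apply/rowP => j; rewrite !mxE.
Qed.

Lemma dpsi_first_form u : U u -> has_partial_mx ord0 g u (- (2 * phi u) *: b u).
Proof.
move=> Uu; have hE := smooth_mx_has_partial ord0 sE Uu.
apply: has_partial_mx_eq (has_partial_mulmx hE (has_partial_trmx hE)) _.
have EE : T0 E u *m (E u)^T = - (phi u *: b u).
  rewrite dpsi_frame// mulmxBl -(mulmxA _ (N u)) (frame_normal_tr Uu) mulmx0 sub0r.
  by rewrite -scalemxAl -!mulmxA gi_EE// mulmx1.
have -> : E u *m (T0 E u)^T = (T0 E u *m (E u)^T)^T by rewrite trmx_mul trmxK.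
have bT : (- (phi u *: b u))^T = - (phi u *: b u).
  by apply/matrixP => i j; rewrite -[in RHS](sform_tr FC Uu) !mxE.
by rewrite EE bT mulrDl mul1r opprD scalerDl !scaleNr.
Qed.

Lemma dpsi_inv_form u : U u ->
  has_partial_mx ord0 gi u ((2 * phi u) *: (gi u *m b u *m gi u)).
Proof.
move=> Uu; have := has_partial_invmx oU (smooth_first_form FC)
  (first_form_unit FC) Uu (dpsi_first_form Uu).
move=> /has_partial_mx_eq; apply.
by rewrite -scalemxAr -scalemxAl scaleNr opprK.
Qed.

(** Exchange d_0 and d_i on N, then differentiate [dpsi_normal]. *)
Lemma row_dpsi_normal_frame i u : U u ->
  row i (T0 DN u) = - (T i V u *m E u + V u *m T i E u).
Proof.
move=> Uu; transitivity (T i (T0 N) u).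
  rewrite -(partial_mxC FC _ _ sN Uu); apply/rowP => j; rewrite !mxE.
  by apply: (eq_partial_open _ oU Uu) => v Uv; rewrite [LHS]mxE.
rewrite (eq_partial_mx FC _ Uu dpsi_normal).
have hV := smooth_mx_has_partial (lift ord0 i) (smooth_tgrad sphi) Uu.
have hE := smooth_mx_has_partial (lift ord0 i) sE Uu.
exact: (has_partial_mxE (has_partial_mxN (has_partial_mulmx hV hE))).
Qed.

Lemma dpsi_mean_curvature_frame u : U u -> partial ord0 (fun v => \tr (W v)) u =
  phi u * \tr (W u *m W u)
  + \sum_i (t i (fun v => V v 0 i) u + (V u *m conn r i u) 0 i).
Proof.
move=> Uu.
have hD := smooth_mx_has_partial ord0 smooth_normal_frame Uu.
have hE := smooth_mx_has_partial ord0 sE Uu.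
(* Writing b = - DN E^T leaves only first derivatives of r and N under d_0. The derivative of g^-1
   gives 2 phi Tr W^2, that of E gives - phi Tr W^2, and that of DN the covariant divergence of the
   tangential gradient of phi. *)
transitivity (partial ord0 (fun v => \tr (gi v *m - (DN v *m (E v)^T))) u).
  by apply: (eq_partial_open _ oU Uu) => v Uv; rewrite -normal_frame_sform.
rewrite (has_partialE (has_partial_trace (has_partial_mulmx (dpsi_inv_form Uu)
  (has_partial_mxN (has_partial_mulmx hD (has_partial_trmx hE)))))).
rewrite -(normal_frame_sform Uu) opprD mulmxDr !mxtraceD.
have -> : \tr (2 * phi u *: (gi u *m b u *m gi u) *m b u) = 2 * phi u * \tr (W u *m W u).
  by rewrite -scalemxAl mxtraceZ -!mulmxA.
have -> : \tr (gi u *m - (DN u *m (T0 E u)^T)) = - phi u * \tr (W u *m W u).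
  have -> : DN u *m (T0 E u)^T = phi u *: (b u *m gi u *m b u).
    rewrite normal_frameE// dpsi_frame// linearB /= linearZ /= !trmx_mul.
    rewrite (sform_tr FC Uu) inv_form_tr mulmxBr !mulNmx -!mulmxA.
    rewrite (mulmxA (E u)) (fc_normal FC Uu) mul0mx !mulmx0 oppr0 sub0r.
    rewrite -!scalemxAr opprK; congr (_ *: (_ *m (_ *m _))).
    by rewrite EE_gi.
  by rewrite mulmxN linearN /= -scalemxAr mxtraceZ mulNr !mulmxA.
have -> : \tr (gi u *m - (T0 DN u *m (E u)^T)) =
    \sum_i (t i (fun v => V v 0 i) u + (V u *m conn r i u) 0 i).
  rewrite mulmxN linearN /= mxtrace_mulC /mxtrace -sumrN; apply: eq_bigr => i _.
  have EEg : E u *m ((E u)^T *m gi u) = 1%:M by rewrite mulmxA; exact: g_gi.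
  have rowE : row i (T0 DN u) *m (E u)^T *m gi u = - (T i V u + V u *m conn r i u).
    rewrite row_dpsi_normal_frame// !mulNmx !mulmxDl /conn -!mulmxA.
    by rewrite EEg mulmx1.
  have -> : (T0 DN u *m (E u)^T *m gi u) i i =
      (row i (T0 DN u) *m (E u)^T *m gi u) 0 i by rewrite -!row_mul [RHS]mxE.
  by rewrite rowE mxE opprK mxE; congr (_ + _); rewrite mxE.
rewrite addrA addrAC -mulrDl; congr (_ * _ + _); ring.
Qed.

End framed_chart_evolution.

(** * The area element, the divergence and Gauss' equation *)

Section framed_chart_curvature.
Context {R : realType} {n : nat}.
Variables (U : set 'rV[R]_n.+1) (r N : 'rV[R]_n.+1 -> 'rV[R]_n.+1).
Variable phi : 'rV[R]_n.+1 -> R.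
Hypothesis FC : framed_chart U r N phi.
Implicit Types (i j k l : 'I_n) (u : 'rV[R]_n.+1).

Let oU : open U := fc_open FC.
Let sr : smooth_mx U r := fc_smooth FC.
Let sN : smooth_mx U N := fc_smoothN FC.
Let sphi : smooth_on U phi := fc_smooth_phi FC.
Let sE := smooth_frame FC.
Local Notation E := (frame r).
Local Notation T i := (partial_mx (lift ord0 i)).
Local Notation t i := (partial (lift ord0 i)).
Local Notation T0 := (partial_mx ord0).
Local Notation g := (first_form r).
Local Notation gi := (inv_form r).
Local Notation b := (sform r N).
Local Notation A := (conn r).
Local Notation s := (sff r N).
Local Notation W := (shape r N).
Local Notation S := (sqrt_det r).

Lemma has_partial_sqrt m (i : 'I_m) (f : 'rV[R]_m -> R) x d : 0 < f x -> has_partial i f x d ->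
  has_partial i (fun y => Num.sqrt (f y)) x ((2 * Num.sqrt (f x))^-1 * d).
Proof.
move=> f0 [df <-]; split; last exact: (derive_comp1 _ df (is_derive1_sqrt f0)).
apply: (@differentiable_comp _ _ _ _ f Num.sqrt) => //.
by apply/derivable1_diffP; case: (is_derive1_sqrt f0).
Qed.

Lemma has_partial_sqrt_det (k : 'I_n.+1) u D : U u -> has_partial_mx k g u D ->
  has_partial k S u (S u * (\tr (D *m gi u) / 2)).
Proof.
move=> Uu hD; have dg := fc_det FC Uu.
apply: has_partial_eq (has_partial_sqrt dg (has_partial_det hD)) _.
have -> : \adj (g u) = \det (g u) *: gi u.
  rewrite /inv_form /invmx (first_form_unit FC Uu) scalerA divff ?scale1r//.
  by rewrite gt_eqF.
rewrite -scalemxAr mxtraceZ -[X in _ * (X * _) = _](sqr_sqrtr (ltW dg)).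
have aux (x y : R) : x != 0 -> (2 * x)^-1 * (x ^+ 2 * y) = x * (y / 2) by move=> ?; field.
by apply: aux; rewrite gt_eqF// (sqrt_det_gt0 FC Uu).
Qed.

Lemma dpsi_sqrt_det u : U u -> has_partial ord0 S u (- phi u * \tr (W u) * S u).
Proof.
move=> Uu; apply: has_partial_eq (has_partial_sqrt_det Uu (dpsi_first_form FC Uu)) _.
rewrite -scalemxAl mxtraceZ mxtrace_mulC.
have aux (x y z : R) : z * (- (2 * x) * y / 2) = - x * y * z by field.
exact: aux.
Qed.

(** Both sides are components of the same vector d_i d_j r = d_j d_i r. *)
Lemma conn_sym i j k u : U u -> A i u j k = A j u i k.
Proof.
move=> Uu; have rE (p q : 'I_n) : A p u q k = (row q (T p E u) *m (E u)^T *m gi u) 0 k.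
  by rewrite -!row_mul [RHS]mxE.
have e : row j (T i E u) = row i (T j E u) := etrans (row_partial_frame FC (lift ord0 i) j Uu)
  (etrans (partial_mxC FC (lift ord0 j) (lift ord0 i) sr Uu)
    (esym (row_partial_frame FC (lift ord0 j) i Uu))).
by apply: etrans (rE i j) (etrans _ (esym (rE j i))); rewrite e.
Qed.

Lemma conn_first_form i u : U u -> A i u *m g u = T i E u *m (E u)^T.
Proof. by move=> Uu; rewrite -mulmxA (gi_g FC Uu) mulmx1. Qed.

Lemma dtan_first_form i u : U u ->
  has_partial_mx (lift ord0 i) g u (A i u *m g u + (A i u *m g u)^T).
Proof.
move=> Uu; have hE := smooth_mx_has_partial (lift ord0 i) sE Uu.
apply: has_partial_mx_eq (has_partial_mulmx hE (has_partial_trmx hE)) _.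
by rewrite (conn_first_form i Uu) trmx_mul trmxK.
Qed.

Lemma dtan_sqrt_det i u : U u -> has_partial (lift ord0 i) S u (S u * \tr (A i u)).
Proof.
move=> Uu; apply: has_partial_eq (has_partial_sqrt_det Uu (dtan_first_form i Uu)) _.
congr (_ * _); rewrite mulmxDl mxtraceD.
have -> : A i u *m g u *m gi u = A i u by rewrite -mulmxA (g_gi FC Uu) mulmx1.
have -> : \tr ((A i u *m g u)^T *m gi u) = \tr (A i u).
  by rewrite trmx_mul first_form_tr mxtrace_mulC mulmxA (gi_g FC Uu) mul1mx mxtrace_tr.
by move: (\tr _) => a; field.
Qed.

(** By symmetry of the connection the Christoffel term is the sum over k of X^k Tr A_k, and Tr A_k
    is the logarithmic derivative of sqrt g in direction k. *)
Lemma divergence_form (X : 'rV[R]_n.+1 -> 'rV[R]_n) u : U u -> smooth_mx U X ->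
  \sum_i (t i (fun v => X v 0 i) u + (X u *m A i u) 0 i) =
  (S u)^-1 * \sum_i t i (fun v => S v * X v 0 i) u.
Proof.
move=> Uu sX; have S0 : S u != 0 by rewrite gt_eqF// (sqrt_det_gt0 FC Uu).
have -> : \sum_i t i (fun v => S v * X v 0 i) u =
    \sum_i (S u * \tr (A i u) * X u 0 i + S u * t i (fun v => X v 0 i) u).
  apply: eq_bigr => i _; apply: (has_partialE (has_partialM (dtan_sqrt_det i Uu) _)).
  exact: smooth_has_partial (sX 0 i) Uu.
rewrite !big_split /= mulrDr addrC; congr (_ + _); last first.
  by rewrite -mulr_sumr mulKf.
under [in RHS]eq_bigr do rewrite -mulrA; rewrite -mulr_sumr mulKf//.
under eq_bigr do rewrite mxE; rewrite exchange_big /=.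
apply: eq_bigr => k _; rewrite mulrC /mxtrace mulr_sumr; apply: eq_bigr => i _.
by congr (_ * _); exact: conn_sym.
Qed.

Lemma dpsi_mean_curvature u : U u -> partial ord0 (fun v => \tr (W v)) u =
  phi u * \tr (W u *m W u)
  + (S u)^-1 * \sum_i t i (fun v => S v * tgrad r phi v 0 i) u.
Proof.
move=> Uu; rewrite (dpsi_mean_curvature_frame FC Uu) divergence_form//.
exact: (smooth_tgrad FC).
Qed.

(** With c p q l = d_p d_q r . d_l r, each derivative of the metric is a sum of two such terms.
    Since c is symmetric in p and q, the alternating sum of the definition leaves twice a single
    term. *)
Lemma christoffel_conn k i j u : U u -> christoffel r k i j u = A j u i k.
Proof.
move=> Uu; pose c (p q l : 'I_n) := (T p E u *m (E u)^T) q l.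
have cE p q l : c p q l = (A p u *m g u) q l.
  exact: esym (congr1 (fun M : 'M[R]_n => M q l) (conn_first_form p Uu)).
have cs p q l : c p q l = c q p l.
  rewrite (cE p) (cE q) [LHS]mxE [RHS]mxE.
  by apply: eq_bigr => m _; congr (_ * _); exact: conn_sym.
have tg p q l : dtan p (fun v => metric r v q l) u = c p q l + c p l q.
  transitivity (t p (fun v => g v q l) u).
    by apply: (eq_partial_open _ oU Uu) => v Uv; rewrite (metric_first_form FC Uv).
  rewrite (has_partialE (dtan_first_form p Uu q l)) [LHS]mxE [X in _ + X]mxE.
  exact: esym (congr2 +%R (cE p q l) (cE p l q)).
rewrite /christoffel mulr_sumr [RHS]mxE; apply: eq_bigr => l _.
rewrite !tg (inv_metric_inv_form FC Uu) .
rewrite (cs i j l) (cs i l j) (cs j l i).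
have -> : gi u k l = gi u l k by rewrite -[in LHS]inv_form_tr mxE.
rewrite -[T j E u *m _]/(T j E u *m (E u)^T) -/(c j i l).
move: (c j i l) (c l i j) (c l j i) (gi u l k) => x y z w.
have aux : 2^-1 * (w * (x + y + (x + z) - (y + z))) = x * w by field.
exact: aux.
Qed.

(** Tangential part of a derivative of Gauss' formula, as pure matrix algebra: the multiple of the
    normal M disappears, and F Ft G = 1 strips the frame. *)
Lemma gauss_projection m (dA B G : 'M[R]_n) (F dF : 'M[R]_(n, m)) (Ft : 'M[R]_(m, n))
    (dc c : 'cV[R]_n) (M : 'rV[R]_m) (w : 'rV[R]_n) :
  F *m Ft *m G = 1%:M -> M *m Ft = 0 ->
  (dA *m F + B *m dF + (dc *m M + c *m - (w *m G *m F))) *m Ft *m G =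
  dA + B *m (dF *m Ft *m G) - c *m w *m G.
Proof.
move=> FFG MF; rewrite !mulmxDl -!mulmxA (mulmxA M) MF mul0mx mulmx0 add0r.
by rewrite (mulmxA F) FFG mulmx1 !mulNmx !mulmxN -!mulmxA (mulmxA F) FFG mulmx1.
Qed.

(** Compare the tangential parts of T k (T j E) and T j (T k E), which are equal. *)
Lemma gauss_curvature_equation j k u : U u ->
  T k (A j) u + A j u *m A k u - (T j (A k) u + A k u *m A j u) =
  s j u *m (s k u)^T *m gi u - s k u *m (s j u)^T *m gi u.
Proof.
move=> Uu; have gauss p q : T q (T p E) u *m (E u)^T *m gi u =
    T q (A p) u + A p u *m A q u - s p u *m (s q u)^T *m gi u.
  rewrite (eq_partial_mx FC _ Uu (partial_tangent FC p)).
  have hA := smooth_mx_has_partial (lift ord0 q) (smooth_conn FC p) Uu.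
  have hs := smooth_mx_has_partial (lift ord0 q) (smooth_sff FC p) Uu.
  have hE := smooth_mx_has_partial (lift ord0 q) sE Uu.
  have hN := smooth_mx_has_partial (lift ord0 q) sN Uu.
  rewrite (has_partial_mxE (has_partial_mxD (has_partial_mulmx hA hE)
    (has_partial_mulmx hs hN))).
  rewrite (partial_normal FC)// -/(s q u).
  exact: gauss_projection (g_gi FC Uu) (frame_normal_tr FC Uu).
have swap (x y z w : 'M[R]_n) : x - z = y - w -> x - y = z - w.
  move=> h; apply/eqP; rewrite -subr_eq0 opprB (addrC w) addrACA h (addrC (- y)).
  by rewrite -opprB addNr.
have e : T k (T j E) u *m (E u)^T *m gi u = T j (T k E) u *m (E u)^T *m gi u.
  by rewrite (partial_mxC FC (lift ord0 k) (lift ord0 j) sE Uu).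
exact: swap (etrans (esym (gauss j k)) (etrans e (gauss k j))).
Qed.

(** Gauss' equation traced over k. In the convention of [conn] the products of Christoffel symbols
    are entries of matrix products, so that the definition of [ricci] is a sum of entries of the
    left side of that equation. *)
Lemma ricci_shape i j u : U u ->
  ricci r i j u = \tr (W u) * b u i j - (b u *m gi u *m b u) i j.
Proof.
move=> Uu; have tc k p q : dtan k (christoffel r p i q) u = T k (A q) u i p.
  rewrite mxE; apply: (eq_partial_open _ oU Uu) => v Uv; exact: christoffel_conn.
have -> : ricci r i j u =
    \sum_k (T k (A j) u + A j u *m A k u - (T j (A k) u + A k u *m A j u)) i k.
  apply: eq_bigr => k _; rewrite !tc big_split /= sumrN.
  have -> : \sum_l christoffel r k k l u * christoffel r l i j u = (A j u *m A k u) i k.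
    rewrite [RHS]mxE; apply: eq_bigr => l _; rewrite !christoffel_conn// mulrC.
    by congr (_ * _); exact: conn_sym.
  have -> : \sum_l christoffel r k j l u * christoffel r l i k u = (A k u *m A j u) i k.
    rewrite [RHS]mxE; apply: eq_bigr => l _; rewrite !christoffel_conn// mulrC.
    by congr (_ * _); exact: conn_sym.
  have entry (a1 a2 a3 a4 : 'M[R]_n) p q :
    a1 p q - a2 p q + (a3 p q - a4 p q) = (a1 + a3 - (a2 + a4)) p q.
    by rewrite !mxE; ring.
  exact: entry.
under eq_bigr do rewrite (gauss_curvature_equation _ _ Uu).
have -> : \tr (W u) = \sum_k \sum_l s k u l 0 * gi u l k.
  rewrite mxtrace_mulC; apply: eq_bigr => k _; rewrite mxE.
  by apply: eq_bigr => l _; rewrite mxE.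
rewrite mulr_suml.
have -> : (b u *m gi u *m b u) i j = \sum_k s k u i 0 * \sum_l s j u l 0 * gi u l k.
  have giC k l : gi u k l = gi u l k by rewrite -[in LHS]inv_form_tr mxE.
  have bE p q : b u p q = s p u q 0 by rewrite [LHS]mxE.
  rewrite -mulmxA [LHS]mxE; apply: eq_bigr => k _.
  congr (_ * _); first exact: etrans (bE i k) (sff_sym FC i k Uu).
  rewrite [LHS]mxE; apply: eq_bigr => l _; rewrite mulrC.
  by congr (_ * _); [exact: etrans (bE l j) (sff_sym FC l j Uu)|exact: giC].
rewrite -sumrB; apply: eq_bigr => k _; rewrite mxE [X in _ + X]mxE.
have sE' (p q : 'I_n) : (s p u *m (s q u)^T *m gi u) i k =
    s p u i 0 * \sum_l s q u l 0 * gi u l k.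
  rewrite -mulmxA [LHS]mxE big_ord1; congr (_ * _); rewrite mxE.
  by apply: eq_bigr => l _; rewrite [X in X * _]mxE.
have bE' : b u i j = s i u j 0 by rewrite [LHS]mxE.
have bij : b u i j = s j u i 0 := etrans bE' (sff_sym FC i j Uu).
congr (_ - _); last exact: sE'.
by apply: etrans (sE' j k) _; rewrite mulrC bij.
Qed.

Lemma scalar_curvature_shape u : U u ->
  scalar_curvature r u = \tr (W u) ^+ 2 - \tr (W u *m W u).
Proof.
move=> Uu; rewrite /scalar_curvature.
under eq_bigr do under eq_bigr do
  rewrite (inv_metric_inv_form FC Uu) (ricci_shape _ _ Uu) mulrBr.
have trE (M : 'M[R]_n) : \sum_i \sum_j gi u i j * M i j = \tr (gi u *m M^T).
  apply: eq_bigr => i _; rewrite mxE; apply: eq_bigr => j _; by rewrite [in RHS]mxE.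
under eq_bigr do rewrite sumrB; rewrite sumrB; congr (_ - _).
  under eq_bigr do under eq_bigr do rewrite mulrCA.
  under eq_bigr do rewrite -mulr_sumr; rewrite -mulr_sumr trE (sform_tr FC Uu).
  by rewrite expr2.
by rewrite trE 2!trmx_mul inv_form_tr (sform_tr FC Uu) !mulmxA.
Qed.

End framed_chart_curvature.

(** * Curvilinear coordinates of psi form a framed chart *)

Section chart_of_function.
Context {R : realType} {n : nat}.
Variables (Omega : set 'rV[R]_n.+1) (psi : 'rV[R]_n.+1 -> R).
Hypothesis openO : open Omega.
Hypothesis spsi : smooth_on Omega psi.
Hypothesis gpsi : forall x, Omega x -> grad psi x <> 0.
Implicit Types (x y u v : 'rV[R]_n.+1).

Local Notation F := (fun x => enorm (grad psi x)).

Lemma smooth_grad : smooth_mx Omega (grad psi).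
Proof.
move=> i j; rewrite (_ : (fun x => _) = partial j psi); first exact: smooth_partial.
by apply/funext => x; rewrite mxE.
Qed.

Lemma dot_gt0 m (v : 'rV[R]_m) : v <> 0 -> 0 < dot v v.
Proof.
move=> v0; have [i vi] : exists i, v 0 i != 0.
  apply/existsP; apply: contra_notT v0 => /existsPn v0.
  by apply/rowP => i; rewrite mxE; apply/eqP; have := v0 i; rewrite negbK.
rewrite /dot (bigD1 i) //= ltr_pwDl//; first by rewrite -expr2 exprn_even_gt0.
by apply: sumr_ge0 => j _; rewrite -expr2 sqr_ge0.
Qed.

Lemma enorm_grad_gt0 x : Omega x -> 0 < F x.
Proof. by move=> Ox; rewrite sqrtr_gt0; exact: dot_gt0 (gpsi Ox). Qed.

Lemma enorm_grad_neq0 x : Omega x -> F x != 0.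
Proof. by move=> Ox; rewrite gt_eqF// enorm_grad_gt0. Qed.

Lemma sqr_enorm m (v : 'rV[R]_m) : enorm v ^+ 2 = dot v v.
Proof.
by rewrite sqr_sqrtr//; apply: sumr_ge0 => j _; rewrite -expr2 sqr_ge0.
Qed.

Lemma smooth_enorm_grad : smooth_on Omega F.
Proof.
apply: smooth_sqrt => // [|x Ox]; last exact: dot_gt0 (gpsi Ox).
by apply: smooth_sum => // j; apply: smoothM => //; exact: smooth_grad.
Qed.

Lemma smooth_unit_normal : smooth_mx Omega (unit_normal psi).
Proof.
apply: smooth_scalemx => //; last exact: smooth_grad.
apply: smoothN => //; apply: smoothV => //; first exact: smooth_enorm_grad.
exact: enorm_grad_neq0.
Qed.

Variables (U : set 'rV[R]_n.+1) (r : 'rV[R]_n.+1 -> 'rV[R]_n.+1).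
Hypothesis CU : curvilinear Omega psi U r.

Let oU : open U. Proof. by case: CU. Qed.
Let smr : smooth_map_on U r. Proof. by case: CU. Qed.
Let sr : smooth_mx U r.
Proof. by move=> i j; rewrite (ord1 i); exact: smr. Qed.
Let rU x : U x -> Omega (r x).
Proof. by case: CU => _ _ rO _ _ Ux; apply: rO; exists x. Qed.

Lemma smooth_on_chart f : smooth_on Omega f -> smooth_on U (fun u => f (r u)).
Proof. by move=> sf; exact: smooth_comp sf rU smr. Qed.

Lemma smooth_mx_chart a c (M : 'rV[R]_n.+1 -> 'M[R]_(a, c)) :
  smooth_mx Omega M -> smooth_mx U (fun u => M (r u)).
Proof. by move=> sM i j; exact: (smooth_on_chart (sM i j)). Qed.

Lemma partial_mx_chart m (Y : 'rV[R]_n.+1 -> 'rV[R]_m) (a : 'I_n.+1) u :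
  smooth_mx Omega Y -> U u ->
  partial_mx a (fun v => Y (r v)) u =
  partial_mx a r u *m \matrix_(j, k) partial j (fun y => Y y 0 k) (r u).
Proof.
move=> sY Uu; apply/matrixP => i k; rewrite (ord1 i) [LHS]mxE [RHS]mxE.
transitivity (\sum_j partial j (fun y => Y y 0 k) (r u) * partial a (fun v => r v 0 j) u).
  apply: (partial_comp a (h := fun y => Y y 0 k)).
    by move=> j; exact: smooth_differentiable (smr j) Uu.
  exact: smooth_differentiable (sY 0 k) (rU Uu).
by apply: eq_bigr => j _; rewrite mulrC; congr (_ * _); rewrite mxE.
Qed.

Lemma grad_unit_normal x : Omega x -> grad psi x = - F x *: unit_normal psi x.
Proof.
by move=> Ox; rewrite scalerA mulrNN mulfV ?scale1r// enorm_grad_neq0.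
Qed.

(** The chain rule makes the Jacobians of r and of its inverse q mutually inverse. The first column
    of the latter is grad psi, and grad psi is orthogonal to the others because u^1, ..., u^n are
    constant along its flow. Hence grad psi = grad psi Q J = F^2 d_0 r. The witness consists of the
    other columns. *)
Lemma dual_frame u : U u -> exists Q : 'M[R]_(n.+1, n),
  let gp := grad psi (r u) in let X0 := partial_mx ord0 r u in
  [/\ frame r u *m Q = 1%:M, gp *m Q = 0, Q *m frame r u = 1%:M - gp^T *m X0,
      frame r u *m gp^T = 0 & X0 = F (r u) ^- 2 *: gp].
Proof.
move=> Uu; case: CU => _ oI IO _ [q [sq qr q0 qi]].
have Iu : (r @` U) (r u) by exists u.
pose J : 'M[R]_n.+1 := \matrix_(a, j) partial a (fun v => r v 0 j) u.
pose Q : 'M[R]_n.+1 := \matrix_(j, c) partial j (fun y => q y 0 c) (r u).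
have dq c y : (r @` U) y -> differentiable (fun y => q y 0 c) y.
  by move=> Iy; exact: smooth_differentiable (sq c) Iy.
have JQ : J *m Q = 1%:M.
  apply/matrixP => a c; rewrite [LHS]mxE [RHS]mxE.
  transitivity (partial a (fun v => q (r v) 0 c) u).
    rewrite (partial_comp a (h := fun y => q y 0 c)); last exact: dq.
      by apply: eq_bigr => j _; rewrite !mxE mulrC.
    by move=> j; exact: smooth_differentiable (smr j) Uu.
  rewrite -(has_partialE (has_partial_coord a c u)).
  by apply: (eq_partial_open _ oU Uu) => v Uv; rewrite qr.
have JQe a c : (J *m Q) a c = (a == c)%:R by rewrite JQ mxE.
have QJ : Q *m J = 1%:M by apply: mulmx1C.
pose gp := grad psi (r u); pose X0 := partial_mx ord0 r u.
have Q0 j : Q j ord0 = gp 0 j.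
  by rewrite !mxE; apply: (eq_partial_open _ oI Iu) => y Iy; exact: q0.
have Jlift i j : J (lift ord0 i) j = frame r u i j by rewrite !mxE.
have J0 j : J ord0 j = X0 0 j by rewrite !mxE.
have gpQ i : (gp *m Q) 0 (lift ord0 i) = 0.
  rewrite -(qi (r u) i Iu) derive_row_sum; last exact: dq.
  by rewrite mxE; apply: eq_bigr => j _; rewrite !mxE.
have gpQ0 : (gp *m Q) 0 ord0 = F (r u) ^+ 2.
  by rewrite sqr_enorm mxE; apply: eq_bigr => j _; rewrite Q0.
exists (\matrix_(j, i) Q j (lift ord0 i)); split.
- apply/matrixP => i k; rewrite [RHS]mxE.
  rewrite -(inj_eq (@lift_inj _ ord0)) -JQe [LHS]mxE [RHS]mxE.
  by apply: eq_bigr => j _; rewrite Jlift [X in _ * X]mxE.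
- apply/rowP => i; rewrite [RHS]mxE -[RHS](gpQ i) [LHS]mxE [RHS]mxE.
  by apply: eq_bigr => j _; rewrite [X in _ * X]mxE.
- apply/matrixP => j k; rewrite [RHS]mxE -[in RHS]QJ [X in X + _]mxE big_ord_recl.
  rewrite Q0 J0 [X in _ + _ + X]mxE [X in _ - X]mxE big_ord1.
  rewrite [X in _ - X * _]mxE addrAC subrr add0r mxE.
  by apply: eq_bigr => i _; rewrite Jlift mxE.
- apply/colP => i; rewrite [RHS]mxE.
  transitivity ((J *m Q) (lift ord0 i) ord0); last by rewrite JQe.
  by rewrite [LHS]mxE [RHS]mxE; apply: eq_bigr => j _; rewrite Jlift Q0; congr (_ * _); rewrite mxE.
- have gpJ : gp = F (r u) ^+ 2 *: X0.
    rewrite -[LHS]mulmx1 -QJ mulmxA; apply/rowP => k.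
    rewrite [LHS]mxE [RHS]mxE big_ord_recl gpQ0 J0.
    by rewrite big1 ?addr0// => i _; rewrite gpQ mul0r.
  rewrite [X in _ = _ *: X]gpJ scalerA mulVf ?scale1r// expf_neq0//.
  exact/enorm_grad_neq0/rU.
Qed.

Let trZ a c k (M : 'M[R]_(a, c)) : (k *: M)^T = k *: M^T.
Proof. by apply/matrixP => i j; rewrite !mxE. Qed.

Lemma chart_framed :
  framed_chart U r (fun u => unit_normal psi (r u)) (fun u => - (F (r u))^-1).
Proof.
have NE u : unit_normal psi (r u) = - (F (r u))^-1 *: grad psi (r u) by [].
have c2 (c : R) : - c^-1 * - c^-1 = c ^- 2 by rewrite mulrNN -invfM -expr2.
have NN u : (unit_normal psi (r u))^T *m unit_normal psi (r u) =
    F (r u) ^- 2 *: ((grad psi (r u))^T *m grad psi (r u)).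
  by rewrite NE trZ -scalemxAl -scalemxAr scalerA c2.
have gg u : grad psi (r u) *m (grad psi (r u))^T = (F (r u) ^+ 2)%:M.
  by apply/matrixP => i j; rewrite !ord1 -dot_mulmx sqr_enorm [RHS]mxE mulr1n.
have Fr u : U u -> F (r u) != 0 by move=> /rU; exact: enorm_grad_neq0.
have gunit u Q : frame r u *m Q = 1%:M -> grad psi (r u) *m Q = 0 ->
    Q *m frame r u = 1%:M - (grad psi (r u))^T *m partial_mx ord0 r u ->
    first_form r u *m (Q^T *m Q) = 1%:M.
  move=> EQ gQ QE; rewrite mulmxA -(mulmxA (frame r u)) -trmx_mul QE.
  rewrite [(_ - _)^T]linearB /= trmx1 trmx_mul trmxK mulmxBr mulmx1 mulmxBl EQ.
  by rewrite -!mulmxA gQ !mulmx0 subr0.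
split.
- exact: oU.
- exact: sr.
- exact: (smooth_mx_chart smooth_unit_normal).
- apply: smoothN => //; apply: smoothV Fr => //.
  exact: (smooth_on_chart smooth_enorm_grad).
- move=> u Uu; have [Q [_ _ _ _ ->]] := dual_frame Uu.
  by rewrite NE scalerA c2.
- move=> u Uu; have [Q [_ _ _ h _]] := dual_frame Uu.
  by rewrite NE trZ -scalemxAr h scaler0.
- move=> u Uu; rewrite NE trZ -scalemxAl -scalemxAr scalerA c2 gg.
  rewrite -[X in _ *: X]scalemx1 scalerA mulVf ?scale1r// expf_neq0//; exact: Fr.
- move=> u Uu; have [Q [EQ gQ QE _ _]] := dual_frame Uu.
  by have [] := mulmx1_unit (gunit u Q EQ gQ QE).
- move=> u Uu; have [Q [EQ gQ QE Eg X0E]] := dual_frame Uu.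
  have [gu _] := mulmx1_unit (gunit u Q EQ gQ QE).
  (* The Gram matrix of the full Jacobian is block diagonal with blocks F^-2 and g, and its
     determinant is a square; thus det g is nonnegative, and nonzero since g is invertible. *)
  pose Jb : 'M[R]_(1 + n, n.+1) := col_mx (partial_mx ord0 r u) (frame r u).
  have : 0 <= \det (Jb *m Jb^T) by rewrite det_mulmx det_tr -expr2 sqr_ge0.
  have E0 : grad psi (r u) *m (frame r u)^T = 0.
    by apply: trmx_inj; rewrite trmx_mul trmxK Eg trmx0.
  rewrite tr_col_mx mul_col_row X0E trZ -!scalemxAr Eg -!scalemxAl E0 gg !scaler0.
  rewrite -[(_)%:M]scalemx1 !scalerA det_ublock -/(first_form r u).
  rewrite divfK; last by rewrite expf_neq0// Fr.
  rewrite detZ det1 expr1 mulr1 pmulr_rge0; last by rewrite invr_gt0 exprn_gt0// enorm_grad_gt0//; exact: rU.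
  by rewrite le_eqVlt eq_sym -[_ == 0]negbK -unitfE -unitmxE gu.
- move=> u Uu; have [Q [EQ gQ QE Eg X0E]] := dual_frame Uu.
  have G1 := gunit u Q EQ gQ QE; have [gu _] := mulmx1_unit G1.
  rewrite -/(first_form r u).
  have -> : invmx (first_form r u) = Q^T *m Q.
    by rewrite -[RHS](mulKmx gu) G1 mulmx1.
  rewrite NN mulmxA -trmx_mul -mulmxA QE X0E.
  set G := _^T *m _; have GE : (grad psi (r u))^T *m (F (r u) ^- 2 *: grad psi (r u)) =
    F (r u) ^- 2 *: ((grad psi (r u))^T *m grad psi (r u)) by rewrite scalemxAr.
  (* K is the orthogonal projection onto the line of grad psi, so (1 - K)^T (1 - K) = 1 - K. *)
  rewrite {}/G GE; set K := _ *: _.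
  have KT : K^T = K by rewrite /K trZ trmx_mul trmxK.
  have KK : K *m K = K.
    rewrite /K -scalemxAl -scalemxAr mulmxA -(mulmxA (grad psi (r u))^T) gg.
    rewrite mul_mx_scalar -scalemxAl scalerA mulVf ?scale1r// expf_neq0//; exact: Fr.
  rewrite [(_ - _)^T]linearB /= trmx1 KT mulmxBl mul1mx mulmxBr mulmx1 KK subrr subr0.
  by rewrite subrK.
Qed.

End chart_of_function.
Section powR_shifts.
Context {R : realType}.
Implicit Types a c : R.

(** These shifts reduce all powers of F in an identity to a single one, which [field] then treats as
    an atom. *)
Lemma powRB1 a c : 0 < a -> a `^ (c - 1) = a `^ c / a.
Proof. by move=> a0; rewrite powRB ?powRr1 ?(ltW a0) ?(gt_eqF a0) ?implybT. Qed.

Lemma powRB2 a c : 0 < a -> a `^ (c - 2) = a `^ c / a ^+ 2.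
Proof.
move=> a0; have -> : c - 2 = c - 1 - 1 by ring.
by rewrite !powRB1// expr2 invfM mulrA.
Qed.

Lemma powRD1 a c : 0 < a -> a `^ (c + 1) = a `^ c * a.
Proof. by move=> a0; rewrite powRD ?powRr1 ?(ltW a0) ?(gt_eqF a0) ?implybT. Qed.

End powR_shifts.

(** * p-harmonicity as a relation between mean curvature and speed *)

Section p_harmonic_chart.
Context {R : realType} {n : nat}.
Variables (p : R) (Omega : set 'rV[R]_n.+1) (psi : 'rV[R]_n.+1 -> R).
Hypothesis p1 : 1 < p.
Hypothesis openO : open Omega.
Hypothesis spsi : smooth_on Omega psi.
Hypothesis gpsi : forall x, Omega x -> grad psi x <> 0.
Hypothesis hpsi : p_harmonic p Omega psi.
Variables (U : set 'rV[R]_n.+1) (r : 'rV[R]_n.+1 -> 'rV[R]_n.+1).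
Hypothesis CU : curvilinear Omega psi U r.
Implicit Types (x u v : 'rV[R]_n.+1) (i j k : 'I_n).

Let N u := unit_normal psi (r u).
Let f u := enorm (grad psi (r u)).
Let phi u := - (f u)^-1.
Let FC : framed_chart U r N phi := chart_framed openO spsi gpsi CU.
Let oU : open U := fc_open FC.
Let rU u : U u -> Omega (r u).
Proof. by case: CU => _ _ rO _ _ Uu; apply: rO; exists u. Qed.
Local Notation E := (frame r).
Local Notation T i := (partial_mx (lift ord0 i)).
Local Notation t i := (partial (lift ord0 i)).
Local Notation T0 := (partial_mx ord0).
Local Notation gi := (inv_form r).
Local Notation W := (shape r N).
Local Notation S := (sqrt_det r).
Local Notation H := (fun u => \tr (W u)).

Lemma speed_gt0 u : U u -> 0 < f u.
Proof. by move=> /rU; exact: enorm_grad_gt0. Qed.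

Lemma smooth_speed : smooth_on U f.
Proof. exact: (smooth_on_chart CU (smooth_enorm_grad openO spsi gpsi)). Qed.

(** The divergence is the trace of the Jacobian of Y, split by the completeness relation: the normal
    direction gives d_0 y / phi, the tangential ones y times the divergence of N, which is - H. *)
Lemma trace_divergence (Y : 'rV[R]_n.+1 -> 'rV[R]_n.+1)
    (y : 'rV[R]_n.+1 -> R) u :
  smooth_mx Omega Y -> smooth_on U y -> U u ->
  (forall v, U v -> Y (r v) = y v *: N v) ->
  divergence Y (r u) = partial ord0 y u / phi u - y u * H u.
Proof.
move=> sY sy Uu YN; pose D := \matrix_(j, k) partial j (fun x => Y x 0 k) (r u).
have phi0 : phi u != 0 by rewrite oppr_eq0 invr_eq0 gt_eqF// speed_gt0.
have dY a : partial_mx a r u *m D =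
    partial a y u *: N u + y u *: partial_mx a N u.
  rewrite -(partial_mx_chart CU _ sY Uu) (eq_partial_mx FC _ Uu YN).
  exact: (has_partial_mxE (has_partial_scalemx (smooth_has_partial a sy Uu)
    (smooth_mx_has_partial a (fc_smoothN FC) Uu))).
have -> : divergence Y (r u) = \tr D by apply: eq_bigr => j _; rewrite [RHS]mxE.
have ED : E u *m D = (\col_i t i y u) *m N u + y u *: normal_frame N u.
  apply/row_matrixP => i; rewrite row_mul row_frame dY linearD /= row_mul.
  congr (_ + _); apply/rowP => j; rewrite !mxE ?big_ord1 ?mxE//.
have ND : N u *m D *m (N u)^T = (partial ord0 y u / phi u)%:M.
  have -> : N u *m D = (phi u)^-1 *: (T0 r u *m D).
    by rewrite (fc_flow FC Uu) -scalemxAl scalerA mulVf ?scale1r.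
  rewrite dY -scalemxAl mulmxDl.
  rewrite -(scalemxAl (partial ord0 y u)) -(scalemxAl (y u)) (fc_unit FC Uu).
  rewrite (partial_normal_unit FC)//.
  by rewrite scaler0 addr0 scalerA scalemx1 mulrC.
have EDE : E u *m D *m (E u)^T = - (y u *: sform r N u).
  rewrite ED mulmxDl -mulmxA (frame_normal_tr FC Uu) mulmx0 add0r -scalemxAl.
  by rewrite (normal_frame_sform FC Uu) scalerN opprK.
rewrite -[D]mulmx1 -(fc_complete FC Uu) mulmxDr mxtraceD addrC; congr (_ + _).
  by rewrite mulmxA mxtrace_mulC mulmxA ND mxtrace_scalar mulr1n.
rewrite mulmxA mxtrace_mulC !mulmxA EDE mulNmx -scalemxAl.
by rewrite linearN /= mxtraceZ mxtrace_mulC.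
Qed.

Lemma mean_curvature_speed u : U u -> H u = - (p - 1) * partial ord0 f u.
Proof.
(* As grad psi = - F N, the p-harmonic flux F^(p-2) grad psi is - F^(p-1) N. *)
move=> Uu; pose y v := - f v `^ (p - 1).
have sy : smooth_on U y.
  by apply: smoothN => //; apply: smooth_powR => //; [exact: smooth_speed|exact: speed_gt0].
have sY : smooth_mx Omega (fun x => enorm (grad psi x) `^ (p - 2) *: grad psi x).
  apply: smooth_scalemx => //; last exact: smooth_grad.
  apply: smooth_powR => //; first exact: smooth_enorm_grad.
  by move=> x; exact: enorm_grad_gt0.
have YN v : U v -> enorm (grad psi (r v)) `^ (p - 2) *: grad psi (r v) = y v *: N v.
  move=> Uv; rewrite {2}(grad_unit_normal gpsi (rU Uv)) scalerA; congr (_ *: _).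
  rewrite /y -/(f v) (_ : p - 2 = p - 1 - 1); last by ring.
  by rewrite (powRB1 _ (speed_gt0 Uv)) mulrN divfK// gt_eqF// speed_gt0.
have := trace_divergence sY sy Uu YN; rewrite hpsi; last exact: rU.
have hf := smooth_has_partial ord0 smooth_speed Uu.
have f0 := speed_gt0 Uu.
rewrite (has_partialE (has_partialN (has_partial_powR (p - 1) f0 hf))).
rewrite /y /phi (powRB1 _ f0); move: (f u `^ (p - 1)) (powR_gt0 (p - 1) f0) => P P0.
rewrite invrN invrK => e; apply: (mulfI (lt0r_neq0 P0)); apply/eqP.
rewrite -subr_eq0; apply/eqP; rewrite [RHS]e; field.
by rewrite gt_eqF.
Qed.

End p_harmonic_chart.

(** * Evolution of the scalar curvature: the identity (i) *)

Section level_set_identity.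
Context {R : realType} {n : nat}.
Variables (p : R) (Omega : set 'rV[R]_n.+1) (psi : 'rV[R]_n.+1 -> R).
Hypothesis p1 : 1 < p.
Hypothesis openO : open Omega.
Hypothesis spsi : smooth_on Omega psi.
Hypothesis gpsi : forall x, Omega x -> grad psi x <> 0.
Hypothesis hpsi : p_harmonic p Omega psi.
Variables (U : set 'rV[R]_n.+1) (r : 'rV[R]_n.+1 -> 'rV[R]_n.+1).
Hypothesis CU : curvilinear Omega psi U r.
Implicit Types (x u v : 'rV[R]_n.+1) (i j k : 'I_n).

Let N u := unit_normal psi (r u).
Let f u := enorm (grad psi (r u)).
Let phi u := - (f u)^-1.
Let w u := (f u)^-1.
Let FC : framed_chart U r N phi := chart_framed openO spsi gpsi CU.
Let oU : open U := fc_open FC.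
Let sf : smooth_on U f := smooth_speed openO spsi gpsi CU.
Let f_gt0 u : U u -> 0 < f u := @speed_gt0 _ _ _ _ gpsi _ _ CU u.
Let f_neq0 u : U u -> f u != 0.
Proof. by move=> /f_gt0 /lt0r_neq0. Qed.
Let sw : smooth_on U w. Proof. exact: smoothV. Qed.
Local Notation E := (frame r).
Local Notation t i := (partial (lift ord0 i)).
Local Notation G := (inv_form r).
Local Notation W := (shape r N).
Local Notation S := (sqrt_det r).
Local Notation H := (fun u => \tr (W u)).
Let sH : smooth_on U H. Proof. exact: smooth_trace (smooth_shape FC). Qed.
Let pB1 : p - 1 != 0. Proof. by rewrite subr_eq0 gt_eqF. Qed.
Let p0 : p != 0. Proof. by rewrite gt_eqF// (lt_trans ltr01). Qed.

Lemma weingarten_shape u : U u -> weingarten psi r u = W u.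
Proof.
move=> Uu; rewrite /weingarten (inv_metric_inv_form FC Uu); congr (_ *m _).
apply/matrixP => i j; rewrite [LHS]mxE [RHS]mxE (dtan_dtan_frame FC i j Uu).
by rewrite dot_mulmx -row_mul [LHS]mxE.
Qed.

Lemma sqrt_g_sqrt_det u : U u -> sqrt_g r u = S u.
Proof. by move=> Uu; rewrite /sqrt_g (metric_first_form FC Uu). Qed.

Lemma dpsi_speed u : U u -> has_partial ord0 f u (- H u / (p - 1)).
Proof.
move=> Uu; apply: has_partial_eq (smooth_has_partial ord0 sf Uu) _.
rewrite (mean_curvature_speed openO spsi gpsi hpsi CU Uu).
by rewrite -/f !mulNr opprK mulrAC mulfV// mul1r.
Qed.

Lemma dpsi_slowness u : U u -> has_partial ord0 w u (H u / ((p - 1) * f u ^+ 2)).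
Proof.
move=> Uu; apply: has_partial_eq (has_partialV (f_neq0 Uu) (dpsi_speed Uu)) _.
have aux (h y : R) : y != 0 -> - (- h / (p - 1)) / y ^+ 2 = h / ((p - 1) * y ^+ 2).
  by move=> y0; field; rewrite y0.
exact: aux (f_neq0 Uu).
Qed.

Lemma dpsi_area u : U u -> has_partial ord0 S u (w u * H u * S u).
Proof.
move=> Uu; apply: has_partial_eq (dpsi_sqrt_det FC Uu) _.
by congr (_ * _ * _); exact: opprK.
Qed.

Lemma dpsi_curvature u : U u -> partial ord0 H u =
  - (w u * \tr (W u *m W u))
  - (S u)^-1 * \sum_i t i (fun v => S v * tgrad r w v 0 i) u.
Proof.
move=> Uu; rewrite (dpsi_mean_curvature FC Uu) mulNr; congr (_ + _).
rewrite -mulrN -sumrN; congr (_ * _); apply: eq_bigr => i _.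
have sX : smooth_on U (fun v => S v * tgrad r w v 0 i).
  by apply: smoothM => //; [exact: smooth_sqrt_det FC|exact: (smooth_tgrad FC sw)].
rewrite -(has_partialE (has_partialN (smooth_has_partial _ sX Uu))).
apply: (eq_partial_open _ oU Uu) => v Uv; rewrite -mulrN; congr (_ * _).
rewrite [LHS]mxE [X in _ = - X]mxE -sumrN; apply: eq_bigr => j _.
rewrite -mulNr; congr (_ * _); rewrite [LHS]mxE [X in _ = - X]mxE.
exact: (has_partialE (has_partialN (smooth_has_partial _ sw Uv))).
Qed.

(** The bracket of (i) is d_0 of the flux sqrt g g^ij d_j (1/F). The derivative of g^ij gives the
    Weingarten term. Those of sqrt g and of d_j (1/F) combine into the derivative of Tr W / F^(p+1),
    because 1 + 2/(p-1) = (p+1)/(p-1). *)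
Lemma flux_evolution i u : U u ->
  1 / (p - 1) *
    (\sum_j inv_metric r u i j * f u `^ (p - 1) * sqrt_g r u *
       dtan j (fun v => \tr (weingarten psi r v) / f v `^ (p + 1)) u)
  - 2 / p *
    (\sum_j \sum_k inv_metric r u i k * weingarten psi r u j k *
       f u `^ (p - 2) * sqrt_g r u * dtan j (fun v => 1 / f v `^ p) u)
  = partial ord0 (fun v => S v * tgrad r w v 0 i) u.
Proof.
move=> Uu; have fu0 := f_gt0 Uu; have fun0 := f_neq0 Uu.
rewrite (inv_metric_inv_form FC Uu) (weingarten_shape Uu) (sqrt_g_sqrt_det Uu).
pose P := f u `^ p; have P0 : P != 0 by rewrite gt_eqF// powR_gt0.
pose c j := t j f u; pose h j := t j H u.
have hf j : has_partial (lift ord0 j) f u (c j) by exact: smooth_has_partial sf Uu.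
have hH j : has_partial (lift ord0 j) H u (h j) by exact: smooth_has_partial sH Uu.
have D1 j : dtan j (fun v => \tr (weingarten psi r v) / f v `^ (p + 1)) u =
    h j / (P * f u) - (p + 1) * H u * c j / (P * f u ^+ 2).
  transitivity (t j (fun v => H v / f v `^ (p + 1)) u).
    by apply: (eq_partial_open _ oU Uu) => v Uv; rewrite weingarten_shape.
  have Pf0 : f u `^ (p + 1) != 0 by rewrite gt_eqF// powR_gt0.
  rewrite (has_partialE (has_partialM (hH j)
    (has_partialV Pf0 (has_partial_powR (p + 1) fu0 (hf j))))).
  rewrite (powRB1 _ fu0) (powRD1 _ fu0) -/P; move: (H u) => x.
  by field; rewrite ?P0 ?fun0.
have D2 j : dtan j (fun v => 1 / f v `^ p) u = - p * c j / (P * f u).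
  apply: etrans (has_partialE (has_partialM (has_partialC _ 1 u)
    (has_partialV P0 (has_partial_powR p fu0 (hf j))))) _.
  rewrite (powRB1 _ fu0) -/P.
  by field; rewrite ?P0 ?fun0.
have tw j v : U v -> t j w v = - t j f v / f v ^+ 2.
  move=> Uv.
  exact: (has_partialE (has_partialV (f_neq0 Uv) (smooth_has_partial _ sf Uv))).
(* Exchanging the derivatives brings in d_0 (1/F) = H / ((p-1) F^2); this is where p-harmonicity
   enters. *)
have t0 j : has_partial ord0 (t j w) u
    ((h j / f u ^+ 2 - 2 * H u * c j / f u ^+ 3) / (p - 1)).
  apply: has_partial_eq (smooth_has_partial _ (smooth_partial (lift ord0 j) sw) Uu) _.
  rewrite (partialC _ _ oU sw Uu).
  transitivity (t j (fun v => H v * ((p - 1) * (f v * f v))^-1) u).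
    apply: (eq_partial_open _ oU Uu) => v Uv.
    by rewrite (has_partialE (dpsi_slowness Uv)) expr2.
  have d0 : (p - 1) * (f u * f u) != 0 by rewrite !mulf_neq0.
  rewrite (has_partialE (has_partialM (hH j) (has_partialV d0
    (has_partialM (has_partialC _ (p - 1) u) (has_partialM (hf j) (hf j)))))).
  by move: (H u) => x; field; rewrite ?pB1 ?fun0.
pose M j := \sum_k W u j k * G u k i.
have hG j : has_partial ord0 (fun v => G v j i) u (- (2 * w u) * M j).
  have := dpsi_inv_form FC Uu j i => /has_partial_eq; apply.
  by rewrite mxE [X in _ * X]mxE /phi -/(w u) mulrN.
have hX := has_partialM (dpsi_area Uu)
  (has_partial_sum (index_enum 'I_n) predT (fun j => has_partialM (t0 j) (hG j))).
transitivity (partial ord0 (fun v => S v * \sum_j t j w v * G v j i) u); last first.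
  apply: (eq_partial_open _ oU Uu) => v Uv; congr (_ * _); rewrite [RHS]mxE.
  by apply: eq_bigr => j _; congr (_ * _); rewrite [RHS]mxE.
have GC k : G u i k = G u k i by rewrite -[in LHS]inv_form_tr mxE.
rewrite (has_partialE hX) /= [X in X - _]mulr_sumr [X in _ - X = _]mulr_sumr.
rewrite [X in _ = X + _]mulr_sumr [X in _ = _ + X]mulr_sumr -sumrB -big_split /=.
apply: eq_bigr => j _; rewrite D1 tw// -/(c j).
have -> : \sum_k G u i k * W u j k * f u `^ (p - 2) * S u *
    dtan j (fun v => 1 / f v `^ p) u =
    M j * (f u `^ (p - 2) * S u * (- p * c j / (P * f u))).
  rewrite /M mulr_suml; apply: eq_bigr => k _; rewrite D2 GC.
  have aux (a b c1 d e : R) : a * b * c1 * d * e = b * a * (c1 * d * e) by ring.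
  exact: aux.
rewrite (powRB1 _ fu0) (powRB2 _ fu0) -/P.
rewrite (GC j).
rewrite /w; move: (M j) (G u j i) (S u) (H u) (c j) (h j) => m a s x y z.
by field; rewrite P0 fun0 p0 pB1.
Qed.

Lemma smooth_flux i : smooth_on U (fun v => S v * tgrad r w v 0 i).
Proof. by apply: smoothM => //; [exact: smooth_sqrt_det FC|exact: (smooth_tgrad FC sw)]. Qed.

Let smooth_speed_powR c : smooth_on U (fun v => f v `^ c).
Proof. exact: smooth_powR. Qed.

Lemma curvature_flux u : U u -> scalar_curvature r u / f u `^ p =
  partial ord0 (fun v => H v / f v `^ (p - 1)) u +
  (f u `^ (p - 1) * S u)^-1 * \sum_i t i (fun v => S v * tgrad r w v 0 i) u.
Proof.
move=> Uu; have fu0 := f_gt0 Uu; have fun0 := f_neq0 Uu.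
have Q0 : f u `^ (p - 1) != 0 by rewrite gt_eqF// powR_gt0.
have P0 : f u `^ p != 0 by rewrite gt_eqF// powR_gt0.
rewrite (scalar_curvature_shape FC Uu).
rewrite (has_partialE (has_partialM (smooth_has_partial ord0 sH Uu)
  (has_partialV Q0 (has_partial_powR (p - 1) fu0 (dpsi_speed Uu))))).
rewrite (dpsi_curvature Uu) (powRB1 (p - 1) fu0) (powRB1 p fu0) /w.
have S0 : S u != 0 by rewrite gt_eqF// (sqrt_det_gt0 FC Uu).
move: P0 S0; move: (f u `^ p) (S u) (H u) (\tr (W u *m W u)) (\sum_i _) => P s h q d P0 s0.
by field; rewrite fun0 s0 P0 pB1.
Qed.

Lemma dpsi_weight u : U u -> has_partial ord0 (fun v => f v `^ (p - 1) * S v) u 0.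
Proof.
move=> Uu; have fu0 := f_gt0 Uu; have fun0 := f_neq0 Uu.
apply: has_partial_eq
  (has_partialM (has_partial_powR (p - 1) fu0 (dpsi_speed Uu)) (dpsi_area Uu)) _.
rewrite (powRB1 (p - 1) fu0) /w; move: (f u `^ (p - 1)) (S u) (H u) => P s h.
by field; rewrite fun0 pB1.
Qed.

Lemma level_set_curvature u : U u ->
  dpsi (fun v => scalar_curvature r v / f v `^ p) u =
  1 / (f u `^ (p - 1) * sqrt_g r u) *
    (\sum_i dtan i (fun v =>
      1 / (p - 1) *
        (\sum_j inv_metric r v i j * f v `^ (p - 1) * sqrt_g r v *
           dtan j (fun w => \tr (weingarten psi r w) / f w `^ (p + 1)) v)
      - 2 / p *
        (\sum_j \sum_k inv_metric r v i k * weingarten psi r v j k *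
           f v `^ (p - 2) * sqrt_g r v *
           dtan j (fun w => 1 / f w `^ p) v)) u)
  + dpsi (dpsi (fun v => \tr (weingarten psi r v) / f v `^ (p - 1))) u.
Proof.
move=> Uu; pose X i v := S v * tgrad r w v 0 i.
have sX i : smooth_on U (X i) := smooth_flux i.
pose K v := H v / f v `^ (p - 1).
have sK : smooth_on U K.
  apply: smoothM => //; apply: smoothV => //.
  by move=> v Uv; rewrite gt_eqF// powR_gt0// f_gt0.
pose C v := f v `^ (p - 1) * S v.
have C0 v : U v -> C v != 0.
  by move=> Uv; rewrite mulf_neq0// gt_eqF ?powR_gt0 ?f_gt0 ?(sqrt_det_gt0 FC).
have -> : dpsi (fun v => scalar_curvature r v / f v `^ p) u =
    partial ord0 (fun v => partial ord0 K v + (C v)^-1 * \sum_i t i (X i) v) u.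
  by apply: (eq_partial_open _ oU Uu) => v Uv; exact: curvature_flux.
have -> : dpsi (dpsi (fun v => \tr (weingarten psi r v) / f v `^ (p - 1))) u =
    partial ord0 (partial ord0 K) u.
  apply: (eq_partial_open _ oU Uu) => v Uv; apply: (eq_partial_open _ oU Uv) => v' Uv'.
  by congr (\tr _ / _); exact: weingarten_shape.
have hK := smooth_has_partial ord0 (smooth_partial ord0 sK) Uu.
have hX i := smooth_has_partial ord0 (smooth_partial (lift ord0 i) (sX i)) Uu.
rewrite (has_partialE (has_partialD hK (has_partialM
  (has_partialV (C0 u Uu) (dpsi_weight Uu)) (has_partial_sum _ _ hX)))).
rewrite oppr0 !mul0r add0r addrC; congr (_ + _).
rewrite sqrt_g_sqrt_det// -/(C u) div1r; congr (_ * _); apply: eq_bigr => i _.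
rewrite (partialC _ _ oU (sX i) Uu).
by apply: (eq_partial_open _ oU Uu) => v Uv; rewrite -flux_evolution.
Qed.

End level_set_identity.
(** * The planar identity *)

(* For level curves: f, s and k stand for F, the length element sqrt g and kappa. *)
Section level_curve_identity.
Context {R : realType}.
Variables (p : R) (U : set 'rV[R]_2) (f s k : 'rV[R]_2 -> R).
Hypothesis p1 : 1 < p.
Hypothesis oU : open U.
Hypotheses (sf : smooth_on U f) (ss : smooth_on U s) (sk : smooth_on U k).
Hypotheses (f_gt0 : forall u, U u -> 0 < f u) (s_gt0 : forall u, U u -> 0 < s u).
Implicit Types (g : 'rV[R]_2 -> R) (u v : 'rV[R]_2).

Local Notation t1 := (partial (lift ord0 ord0 : 'I_2)).
Local Notation d0 := (partial (ord0 : 'I_2)).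

Definition arc g u := (s u)^-1 * t1 g u.
Local Notation T := arc.

Hypothesis df : forall u, U u -> has_partial ord0 f u (k u / (p - 1)).
Hypothesis ds : forall u, U u -> has_partial ord0 s u (- (k u * s u / f u)).
Hypothesis dk : forall u, U u ->
  d0 k u = k u ^+ 2 / f u + T (T (fun v => (f v)^-1)) u.

Let s_neq0 u : U u -> s u != 0. Proof. by move=> /s_gt0 /lt0r_neq0. Qed.
Let f_neq0 u : U u -> f u != 0. Proof. by move=> /f_gt0 /lt0r_neq0. Qed.
Let pB1 : p - 1 != 0. Proof. by rewrite subr_eq0 gt_eqF. Qed.
Let pB1' : 1 - p != 0. Proof. by rewrite subr_eq0 lt_eqF. Qed.

(** Expressed through the coordinate derivative, so that the rules for [has_partial] carry over to
    d/ds. *)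
Definition has_arc g u d := has_partial (lift ord0 ord0 : 'I_2) g u (s u * d).

Lemma has_arcE g u d : U u -> has_arc g u d -> T g u = d.
Proof. by move=> Uu h; rewrite /arc (has_partialE h) mulKf// s_neq0. Qed.

Lemma smooth_has_arc g u : smooth_on U g -> U u -> has_arc g u (T g u).
Proof.
move=> sg Uu; apply: has_partial_eq (smooth_has_partial _ sg Uu) _.
by rewrite /arc mulVKf// s_neq0.
Qed.

Lemma smooth_arc g : smooth_on U g -> smooth_on U (T g).
Proof. by move=> sg; apply: smoothM => //; [exact: smoothV|exact: smooth_partial]. Qed.

Lemma has_arcM g1 g2 u a b : has_arc g1 u a -> has_arc g2 u b ->
  has_arc (fun v => g1 v * g2 v) u (a * g2 u + g1 u * b).
Proof.
move=> h1 h2; apply: has_partial_eq (has_partialM h1 h2) _.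
by rewrite mulrDr !mulrA (mulrC (g1 u)).
Qed.

Lemma has_arcC c u : has_arc (fun=> c) u 0.
Proof. by apply: has_partial_eq (has_partialC _ c u) _; rewrite mulr0. Qed.

Lemma has_arcV g u a : g u != 0 -> has_arc g u a ->
  has_arc (fun v => (g v)^-1) u (- a / g u ^+ 2).
Proof.
move=> g0 h; apply: has_partial_eq (has_partialV g0 h) _.
by rewrite -mulrN mulrA.
Qed.

Lemma has_arc_powR g u a c : 0 < g u -> has_arc g u a ->
  has_arc (fun v => g v `^ c) u (c * (g u `^ c / g u) * a).
Proof.
move=> g0 h; apply: has_partial_eq (has_partial_powR c g0 h) _.
by rewrite (powRB1 _ g0) mulrCA.
Qed.

Lemma eq_arc g1 g2 u : U u -> (forall v, U v -> g1 v = g2 v) -> T g1 u = T g2 u.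
Proof. by move=> Uu g12; congr (_ * _); exact: eq_partial_open oU Uu g12. Qed.

(** The commutator of d_0 and d/ds is (k / f) d/ds, because the length element s evolves by the rate
    - k / f. *)
Lemma dpsi_arc g u : smooth_on U g -> U u ->
  has_partial ord0 (T g) u (T (d0 g) u + k u / f u * T g u).
Proof.
move=> sg Uu; apply: has_partial_eq (has_partialM (has_partialV (s_neq0 Uu) (ds Uu))
  (smooth_has_partial ord0 (smooth_partial (lift ord0 ord0) sg) Uu)) _.
rewrite (partialC _ _ oU sg Uu) /arc.
have s0 := s_neq0 Uu; have f0 := f_neq0 Uu.
move: (t1 g u) (t1 _ u) => a b; by field; rewrite s0 f0.
Qed.

Let w v := (f v)^-1.
Let sw : smooth_on U w. Proof. exact: smoothV. Qed.

Lemma arc_slowness u : U u -> T w u = - T f u / f u ^+ 2.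
Proof.
by move=> Uu; apply: has_arcE => //; apply: has_arcV (f_neq0 Uu) (smooth_has_arc sf Uu).
Qed.

Lemma arc2_slowness u : U u ->
  T (T w) u = - T (T f) u / f u ^+ 2 + 2 * T f u ^+ 2 / f u ^+ 3.
Proof.
move=> Uu; have f0 := f_neq0 Uu.
transitivity (T (fun v => - 1 * T f v * (f v * f v)^-1) u).
  by apply: eq_arc => // v Uv; rewrite arc_slowness// mulN1r expr2.
have hf := smooth_has_arc sf Uu.
have ff0 : f u * f u != 0 by rewrite mulf_neq0.
rewrite (has_arcE Uu (has_arcM (has_arcM (has_arcC _ _)
  (smooth_has_arc (smooth_arc sf) Uu)) (has_arcV ff0 (has_arcM hf hf)))).
by move: (T f u) (T (T f) u) => a b; field.
Qed.

Lemma dpsi_slowness_curve u : U u -> d0 w u = - k u / ((p - 1) * f u ^+ 2).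
Proof.
move=> Uu; have f0 := f_neq0 Uu; rewrite (has_partialE (has_partialV f0 (df Uu))).
by field; rewrite f0 pB1.
Qed.

Lemma arc_dpsi_slowness u : U u ->
  T (d0 w) u = - (T k u / f u ^+ 2 - 2 * k u * T f u / f u ^+ 3) / (p - 1).
Proof.
move=> Uu; have f0 := f_neq0 Uu.
transitivity (T (fun v => k v * ((1 - p) * (f v * f v))^-1) u).
  apply: eq_arc => // v Uv; rewrite dpsi_slowness_curve//; have fv := f_neq0 Uv.
  by field; rewrite ?fv ?pB1 ?pB1'.
have ff0 : (1 - p) * (f u * f u) != 0.
  by rewrite !mulf_neq0.
have hf := smooth_has_arc sf Uu.
rewrite (has_arcE Uu (has_arcM (smooth_has_arc sk Uu)
  (has_arcV ff0 (has_arcM (has_arcC _ _) (has_arcM hf hf))))).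
move: (T f u) (T k u) => a b; field.
by rewrite ?f0 ?pB1 ?pB1'.
Qed.

Lemma arc2_dpsi_slowness u : U u ->
  T (T (d0 w)) u = - (T (T k) u / f u ^+ 2 - 4 * T k u * T f u / f u ^+ 3
    - 2 * k u * T (T f) u / f u ^+ 3 + 6 * k u * T f u ^+ 2 / f u ^+ 4) / (p - 1).
Proof.
move=> Uu; have f0 := f_neq0 Uu.
transitivity (T (fun v => (1 - p)^-1 * ((f v * f v)^-1 *
    (T k v + (- 2) * k v * T f v * (f v)^-1))) u).
  apply: eq_arc => // v Uv; rewrite arc_dpsi_slowness//; have fv := f_neq0 Uv.
  move: (T f v) (T k v) => a b.
  by field; rewrite ?fv ?pB1 ?pB1'.
have hf := smooth_has_arc sf Uu.
have hTf := smooth_has_arc (smooth_arc sf) Uu.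
have hk := smooth_has_arc sk Uu.
have hTk := smooth_has_arc (smooth_arc sk) Uu.
have ff0 : f u * f u != 0 by rewrite mulf_neq0.
have hsum : has_arc (fun v => T k v + (- 2) * k v * T f v * (f v)^-1) u
    (T (T k) u + ((((0 * k u + - 2 * T k u) * T f u + - 2 * k u * T (T f) u) * (f u)^-1)
      + - 2 * k u * T f u * (- T f u / f u ^+ 2))).
  have := has_partialD hTk (has_arcM (has_arcM (has_arcM (has_arcC (- 2) u) hk) hTf)
    (has_arcV f0 hf)).
  by move=> /has_partial_eq; apply; rewrite [RHS]mulrDr.
rewrite (has_arcE Uu (has_arcM (has_arcC _ _) (has_arcM
  (has_arcV ff0 (has_arcM hf hf)) hsum))).
move: (T f u) (T k u) (T (T f) u) (T (T k) u) => a b a' b'; field.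
by rewrite ?f0 ?pB1 ?pB1'.
Qed.

(** Differentiate [dk] by d_0. Moving d_0 past each of the two arc derivatives of 1/F costs a
    commutator; the inner one is itself differentiated along the arc, so (k / f) T (T w) occurs
    twice. *)
Lemma dpsi2_curvature u : U u -> d0 (d0 k) u =
  2 * k u * d0 k u / f u - k u ^+ 3 / ((p - 1) * f u ^+ 2)
  + (T (T (d0 w)) u + T (fun v => k v / f v) u * T w u + 2 * (k u / f u) * T (T w) u).
Proof.
move=> Uu; have f0 := f_neq0 Uu.
transitivity (d0 (fun v => k v * k v * w v + T (T w) v) u).
  by apply: (eq_partial_open _ oU Uu) => v Uv; rewrite dk// expr2.
have hk := smooth_has_partial ord0 sk Uu.
have hw : has_partial ord0 w u (- k u / ((p - 1) * f u ^+ 2)).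
  by apply: has_partial_eq (smooth_has_partial _ sw Uu) (dpsi_slowness_curve Uu).
rewrite (has_partialE (has_partialD (has_partialM (has_partialM hk hk) hw)
  (dpsi_arc (smooth_arc sw) Uu))).
have skf : smooth_on U (fun v => k v / f v) by exact: smoothM.
have -> : T (d0 (T w)) u = T (T (d0 w)) u + (T (fun v => k v / f v) u * T w u
    + k u / f u * T (T w) u).
  transitivity (T (fun v => T (d0 w) v + k v / f v * T w v) u).
    by apply: eq_arc => // v Uv; rewrite (has_partialE (dpsi_arc sw Uv)).
  apply: has_arcE => //.
  have := has_partialD (smooth_has_arc (smooth_arc (smooth_partial ord0 sw)) Uu)
    (has_arcM (smooth_has_arc skf Uu) (smooth_has_arc (smooth_arc sw) Uu)).
  by move=> /has_partial_eq; apply; rewrite [RHS]mulrDr.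
move: (T (T (d0 w)) u) (T (fun v => k v / f v) u) (T w u) (T (T w) u) (d0 k u).
by move=> a b c d e; rewrite /w; field; rewrite f0 pB1.
Qed.

(** Write k = h Q with Q = f^beta. The second arc derivative of h cancels against the one hidden in
    d_0^2 k, which contains - T (T k) / ((p-1) f^2). The evolution equation [dk] eliminates T (T f).
    What remains is a rational identity in f, h, T f, T (T h), d_0 h and two powers of f. *)
Lemma weighted_curvature_identity (alpha : R) u :
  let h v := k v / f v `^ (p - 1 + alpha) in
  U u -> T h u = 0 ->
  f u `^ alpha * (T (T h) u / (p - 1) + f u ^+ 2 * d0 (d0 h) u) =
  - (k u ^+ 3 / f u `^ (p - 1) * (alpha * (alpha + 2 - p) / (p - 1) ^+ 2))
  - k u / f u `^ (p - 1)
    * ((2 * (p - 2) ^+ 2 + alpha * (alpha + 3 * p - 6)) / (p - 1))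
    * (T f u / f u) ^+ 2
  + f u `^ alpha * f u * k u * (4 - 2 * (p + alpha) / (p - 1)) * d0 h u.
Proof.
move=> h Uu Th; have f0 := f_neq0 Uu.
set beta := p - 1 + alpha in h Th *; pose Q v := f v `^ beta.
have Q0 v : U v -> Q v != 0 by move=> Uv; rewrite gt_eqF// powR_gt0// f_gt0.
have sQ : smooth_on U Q by exact: smooth_powR.
have sh : smooth_on U h by apply: smoothM => //; exact: smoothV.
have kE v : U v -> k v = h v * Q v by move=> Uv; rewrite divfK// Q0.
have hf := smooth_has_arc sf Uu; have hh := smooth_has_arc sh Uu.
have hTf := smooth_has_arc (smooth_arc sf) Uu; have hQ := smooth_has_arc sQ Uu.
have TQ v : U v -> T Q v = beta * (Q v * (f v)^-1) * T f v.
  by move=> Uv; exact: has_arcE (has_arc_powR beta (f_gt0 Uv) (smooth_has_arc sf Uv)).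
have TTQ : T (T Q) u = beta * (T Q u / f u + Q u * (- T f u / f u ^+ 2)) * T f u
    + beta * (Q u / f u) * T (T f) u.
  rewrite (eq_arc Uu TQ) (has_arcE Uu (has_arcM (has_arcM (has_arcC beta u)
    (has_arcM hQ (has_arcV f0 hf))) hTf)).
  by rewrite mul0r add0r.
have Tk v : U v -> T k v = T h v * Q v + h v * T Q v.
  move=> Uv; rewrite (eq_arc Uv kE).
  exact: has_arcE (has_arcM (smooth_has_arc sh Uv) (smooth_has_arc sQ Uv)).
have TTk : T (T k) u = T (T h) u * Q u + T h u * T Q u
    + (T h u * T Q u + h u * T (T Q) u).
  rewrite (eq_arc Uu Tk); apply: has_arcE => //.
  have := has_partialD (has_arcM (smooth_has_arc (smooth_arc sh) Uu) hQ)
    (has_arcM hh (smooth_has_arc (smooth_arc sQ) Uu)).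
  by move=> /has_partial_eq; apply; rewrite [RHS]mulrDr.
have Tkf : T (fun v => k v / f v) u = T k u / f u + k u * (- T f u / f u ^+ 2).
  exact: has_arcE (has_arcM (smooth_has_arc sk Uu) (has_arcV f0 hf)).
have dQ v : U v -> d0 Q v = beta / (p - 1) * (Q v * (f v)^-1 * k v).
  move=> Uv; rewrite (has_partialE (has_partial_powR beta (f_gt0 Uv) (df Uv))).
  rewrite (powRB1 _ (f_gt0 Uv)) -/(Q v); have fv := f_neq0 Uv; by field; rewrite ?fv ?pB1.
have hd0 g : smooth_on U g -> has_partial ord0 g u (d0 g u).
  by move=> sg; exact: smooth_has_partial sg Uu.
have ddQ : d0 (d0 Q) u = beta / (p - 1) * ((d0 Q u / f u
    + Q u * (- (k u / (p - 1)) / f u ^+ 2)) * k u + Q u / f u * d0 k u).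
  rewrite (eq_partial_open _ oU Uu dQ) (has_partialE (has_partialM
    (has_partialC _ (beta / (p - 1)) u) (has_partialM (has_partialM (hd0 _ sQ)
      (has_partialV f0 (df Uu))) (hd0 _ sk)))).
  by rewrite mul0r add0r.
have dk' v : U v -> d0 k v = d0 h v * Q v + h v * d0 Q v.
  move=> Uv; rewrite (eq_partial_open _ oU Uv kE).
  exact: has_partialE (has_partialM (smooth_has_partial _ sh Uv) (smooth_has_partial _ sQ Uv)).
have ddk : d0 (d0 k) u = d0 (d0 h) u * Q u + d0 h u * d0 Q u
    + (d0 h u * d0 Q u + h u * d0 (d0 Q) u).
  rewrite (eq_partial_open _ oU Uu dk').
  exact: has_partialE (has_partialD
    (has_partialM (hd0 _ (smooth_partial _ sh)) (hd0 _ sQ))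
    (has_partialM (hd0 _ sh) (hd0 _ (smooth_partial _ sQ)))).
have TTw : T (T w) u = d0 k u - k u ^+ 2 / f u by rewrite dk// addrAC subrr add0r.
have TTf : T (T f) u = 2 * T f u ^+ 2 / f u - f u ^+ 2 * (d0 k u - k u ^+ 2 / f u).
  rewrite -TTw arc2_slowness//; move: (T f u) (T (T f) u) => a b; by field.
have h00 : d0 (d0 h) u = (d0 (d0 k) u - 2 * d0 h u * d0 Q u - h u * d0 (d0 Q) u) / Q u.
  have aux (a b c q e : R) : q != 0 ->
      a = (a * q + b * c + (b * c + e) - 2 * b * c - e) / q by move=> ?; field.
  by rewrite ddk; exact: aux (Q0 u Uu).
rewrite h00 (dpsi2_curvature Uu) arc2_dpsi_slowness// TTw arc_slowness// Tkf.
rewrite TTk TTf ddQ (Tk u Uu) (dk' u Uu) TTQ TTf (dk' u Uu) Th.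
rewrite (dQ u Uu) (TQ u Uu) (kE u Uu).
have -> : f u `^ alpha = Q u / f u `^ (p - 1).
  have -> : alpha = beta - (p - 1) by rewrite /beta; ring.
  by rewrite powRB// f0 implybT.
have := Q0 u Uu; have : f u `^ (p - 1) != 0 by rewrite gt_eqF// powR_gt0// f_gt0.
move: (f u `^ (p - 1)) (Q u) (h u) (T f u) (T (T h) u) (d0 h u) => P q x a b c P0 q0.
rewrite /beta; field.
by rewrite ?f0 ?pB1 ?P0 ?q0.
Qed.

End level_curve_identity.
(* p-harmonicity turns the mean curvature into a derivative of the speed, which
   is visibly independent of the coordinates. *)
Definition speed_curvature {R : realType} n (p : R) (psi : 'rV[R]_n.+1 -> R) x : R :=
  (p - 1) * (enorm (grad psi x) ^- 2 *
    dot (grad (fun y => enorm (grad psi y)) x) (grad psi x)).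

(** * Independence of the mean curvature from the chart *)

Section curvature_of_level_sets.
Context {R : realType} {n : nat}.
Variables (p : R) (Omega : set 'rV[R]_n.+1) (psi : 'rV[R]_n.+1 -> R).
Hypothesis openO : open Omega.
Hypothesis spsi : smooth_on Omega psi.
Hypothesis gpsi : forall x, Omega x -> grad psi x <> 0.
Hypothesis hpsi : p_harmonic p Omega psi.
Implicit Types (U : set 'rV[R]_n.+1) (r : 'rV[R]_n.+1 -> 'rV[R]_n.+1).
Implicit Types (x u : 'rV[R]_n.+1).

Local Notation F := (fun x => enorm (grad psi x)).

Lemma smooth_speed_curvature : smooth_on Omega (speed_curvature p psi).
Proof.
have sF : smooth_on Omega F := smooth_enorm_grad openO spsi gpsi.
apply: smoothM => //; first exact: smooth_cst.
apply: smoothM => //.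
  apply: smoothV => //; last by move=> x Ox; rewrite expf_neq0// (enorm_grad_neq0 gpsi Ox).
  by under eq_fun do rewrite expr2; exact: smoothM.
apply: smooth_sum => // j; apply: smoothM => //; last exact: smooth_grad.
by under eq_fun do rewrite mxE; exact: smooth_partial.
Qed.

Lemma chart_image U r u : curvilinear Omega psi U r -> U u -> Omega (r u).
Proof. by move=> [_ _ rO _ _] Uu; apply: rO; exists u. Qed.

Lemma chart_level U r u : curvilinear Omega psi U r -> U u -> psi (r u) = u 0 ord0.
Proof.
by move=> [_ _ _ _ [q [_ qr q0 _]]] Uu; rewrite -q0 ?qr//; exists u.
Qed.

Lemma dpsi_chart U r u : curvilinear Omega psi U r -> U u ->
  partial_mx ord0 r u = F (r u) ^- 2 *: grad psi (r u).
Proof. by move=> CU Uu; have [Q []] := dual_frame gpsi CU Uu. Qed.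

(** By p-harmonicity - Tr W = (p-1) d_0 F, and d_0 r = F^-2 grad psi turns d_0 into a derivative
    along grad psi. *)
Lemma weingarten_speed_curvature U r u : curvilinear Omega psi U r -> U u ->
  - \tr (weingarten psi r u) = speed_curvature p psi (r u).
Proof.
move=> CU Uu; rewrite (weingarten_shape openO spsi gpsi CU Uu).
rewrite (mean_curvature_speed openO spsi gpsi hpsi CU Uu) mulNr opprK; congr (_ * _).
have sF : smooth_on Omega F := smooth_enorm_grad openO spsi gpsi.
have [_ _ _ smr _] := CU.
rewrite (partial_comp ord0 (h := F)); first last.
- exact: smooth_differentiable sF (chart_image CU Uu).
- by move=> j; exact: smooth_differentiable (smr j) Uu.
rewrite mulr_sumr; apply: eq_bigr => j _.
have -> : partial ord0 (fun y => r y 0 j) u = F (r u) ^- 2 * grad psi (r u) 0 j.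
  have := congr1 (fun v : 'rV[R]_n.+1 => v 0 j) (dpsi_chart CU Uu).
  by rewrite [X in X = _]mxE [X in _ = X]mxE.
by rewrite [grad F _ 0 j]mxE mulrCA.
Qed.

(** The value selected by [xget] may belong to any chart through the point, but every chart gives
    the same expression in the speed. *)
Lemma kappa_chart U r u : curvilinear Omega psi U r -> U u ->
  kappa Omega psi (r u) = speed_curvature p psi (r u).
Proof.
move=> CU Uu; rewrite /kappa; case: xgetP => [k -> [U' [r' [u' [CU' Uu' ru' ->]]]]|].
  by rewrite (weingarten_speed_curvature CU' Uu') ru'.
move=> /(_ (- \tr (weingarten psi r u))) [].
by exists U, r, u; split.
Qed.

End curvature_of_level_sets.

(** * Level curves satisfy the hypotheses of the planar identity *)

Section level_curves.
Context {R : realType}.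
Variables (p : R) (Omega : set 'rV[R]_2) (psi : 'rV[R]_2 -> R).
Hypothesis p1 : 1 < p.
Hypothesis openO : open Omega.
Hypothesis spsi : smooth_on Omega psi.
Hypothesis gpsi : forall x, Omega x -> grad psi x <> 0.
Hypothesis hpsi : p_harmonic p Omega psi.
Variables (U : set 'rV[R]_2) (r : 'rV[R]_2 -> 'rV[R]_2).
Hypothesis CU : curvilinear Omega psi U r.
Implicit Types (u v : 'rV[R]_2).

Let N u := unit_normal psi (r u).
Let f u := enorm (grad psi (r u)).
Let phi u := - (f u)^-1.
Let FC : framed_chart U r N phi := chart_framed openO spsi gpsi CU.
Let oU : open U := fc_open FC.
Local Notation W := (shape r N).
Local Notation s := (sqrt_det r).
Local Notation t1 := (partial (lift ord0 ord0 : 'I_2)).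
Local Notation d0 := (partial (ord0 : 'I_2)).
Let k u := - \tr (W u).
Local Notation T := (arc s).

Let sf : smooth_on U f := smooth_speed openO spsi gpsi CU.
Let f_gt0 u : U u -> 0 < f u := @speed_gt0 _ _ _ _ gpsi _ _ CU u.
Let ss : smooth_on U s := smooth_sqrt_det FC.
Let s_gt0 u : U u -> 0 < s u := @sqrt_det_gt0 _ _ _ _ _ _ FC u.
Let sk : smooth_on U k.
Proof. apply: smoothN => //; exact: smooth_trace (smooth_shape FC). Qed.

Let df u : U u -> has_partial ord0 f u (k u / (p - 1)).
Proof. exact: (dpsi_speed p1 openO spsi gpsi hpsi CU). Qed.

Let ds u : U u -> has_partial ord0 s u (- (k u * s u / f u)).
Proof.
move=> Uu; apply: has_partial_eq (dpsi_area openO spsi gpsi CU Uu) _.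
by rewrite /k !mulNr opprK -!mulrA mulrC -!mulrA.
Qed.

Lemma sqrt_det_arc u : U u -> enorm (dtan ord0 r u) = s u.
Proof.
move=> Uu; rewrite -(sqrt_g_sqrt_det openO spsi gpsi CU Uu) /sqrt_g det_mx11.
by rewrite mxE.
Qed.

Lemma darc_arc (g : 'rV[R]_2 -> R) u : U u -> darc r g u = T g u.
Proof. by move=> Uu; rewrite /darc (sqrt_det_arc Uu). Qed.

Lemma laplace_beltrami_arc (g : 'rV[R]_2 -> R) u : U u ->
  laplace_beltrami r g u = T (T g) u.
Proof.
move=> Uu; rewrite /laplace_beltrami darc_arc//.
by apply: (eq_arc s oU Uu) => v Uv; exact: darc_arc.
Qed.

(** For n = 1 one has Tr W^2 = (Tr W)^2, and the inverse metric is s^-2, so the Laplacian in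
    divergence form is the second arc derivative. *)
Let dk u : U u -> d0 k u = k u ^+ 2 / f u + T (T (fun v => (f v)^-1)) u.
Proof.
move=> Uu; pose w v := (f v)^-1.
have sH : smooth_on U (fun v => \tr (W v)) := smooth_trace oU (smooth_shape FC).
rewrite (has_partialE (has_partialN (smooth_has_partial ord0 sH Uu))).
rewrite (dpsi_curvature openO spsi gpsi CU Uu) opprB opprK addrC; congr (_ + _).
  have -> : \tr (W u *m W u) = k u ^+ 2.
    have tr2 (M : 'M[R]_1) : \tr (M *m M) = \tr M ^+ 2.
      by rewrite /mxtrace !big_ord1 mxE big_ord1 expr2.
    by rewrite tr2 /k sqrrN.
  by rewrite mulrC.
rewrite big_ord1; congr (_ * _); apply: (eq_partial_open _ oU Uu) => v Uv.
have s0 : s v != 0 by rewrite gt_eqF// s_gt0.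
have gs : inv_form r v ord0 ord0 = (s v ^+ 2)^-1.
  have := congr1 (fun M : 'M[R]_1 => M 0 0) (gi_g FC Uv).
  rewrite [X in X = _]mxE big_ord1 [X in _ = X]mxE eqxx => gg.
  have -> : s v ^+ 2 = first_form r v 0 0.
    by rewrite sqr_sqrtr ?det_mx11// -det_mx11 ltW// (fc_det FC Uv).
  have g0 : first_form r v 0 0 != 0.
    by apply: contra_eq_neq gg => ->; rewrite mulr0 eq_sym oner_neq0.
  by apply: (mulIf g0); rewrite mulVf.
have -> : tgrad r w v 0 ord0 = t1 w v * (s v ^+ 2)^-1.
  by rewrite [LHS]mxE big_ord1 gs; congr (_ * _); rewrite mxE.
rewrite /arc; move: (t1 w v) (s v) s0 => a b b0; by field.
Qed.

Local Notation kap := (kappa Omega psi).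
Local Notation F := (fun x => enorm (grad psi x)).

Lemma kappa_trace u : U u -> kap (r u) = k u.
Proof.
move=> Uu; rewrite (kappa_chart openO spsi gpsi hpsi CU Uu).
rewrite -(weingarten_speed_curvature openO spsi gpsi hpsi CU Uu).
by rewrite (weingarten_shape openO spsi gpsi CU Uu).
Qed.

(** Only the tangential derivative of h is required to vanish: the minimum principle applies this at
    points where d_0 h is positive. *)
Lemma chart_weighted_curvature (alpha : R) u :
  let h v := kap (r v) / F (r v) `^ (p - 1 + alpha) in
  U u -> t1 h u = 0 ->
  F (r u) `^ alpha * level_operator p psi r h u =
  - (kap (r u) ^+ 3 / F (r u) `^ (p - 1) * (alpha * (alpha + 2 - p) / (p - 1) ^+ 2))
  - kap (r u) / F (r u) `^ (p - 1)
    * ((2 * (p - 2) ^+ 2 + alpha * (alpha + 3 * p - 6)) / (p - 1))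
    * darc r (fun v => ln (F (r v))) u ^+ 2
  + F (r u) `^ alpha * F (r u) * kap (r u) * (4 - 2 * (p + alpha) / (p - 1)) * dpsi h u.
Proof.
move=> h Uu h1; pose h' v := k v / f v `^ (p - 1 + alpha).
have hh' v : U v -> h v = h' v by move=> Uv; rewrite /h kappa_trace.
have Th : T h' u = 0 by rewrite -(eq_arc s oU Uu hh') /arc h1 mulr0.
have := weighted_curvature_identity p1 oU sf ss sk f_gt0 s_gt0 df ds dk Uu Th.
rewrite -/h' => id; rewrite /level_operator laplace_beltrami_arc// darc_arc//.
rewrite (eq_arc s oU Uu (fun v Uv => eq_arc s oU Uv hh')).
have -> : dpsi (dpsi h) u = d0 (d0 h') u.
  apply: (eq_partial_open _ oU Uu) => v Uv; exact: eq_partial_open oU Uv hh'.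
have -> : dpsi h u = d0 h' u by exact: eq_partial_open oU Uu hh'.
have -> : T (fun v => ln (F (r v))) u = T f u / f u.
  apply: (has_arcE s_gt0 Uu); apply: has_partial_eq
    (has_partial_ln (f_gt0 Uu) (smooth_has_partial _ sf Uu)) _.
  by rewrite /arc -[X in _ = _ * X]mulrA mulVKf; [exact: mulrC|exact/lt0r_neq0/s_gt0].
by rewrite kappa_trace.
Qed.

End level_curves.
(** * The inverse function theorem *)

Definition derivative_mx {R : realType} m k (q : 'rV[R]_m -> 'rV[R]_k) x : 'M[R]_(m, k) :=
  \matrix_(j, c) partial j (fun y => q y 0 c) x.

Section row_norm.
Context {R : realType}.

Lemma coord_le_norm m (v : 'rV[R]_m) j : `|v 0 j| <= `|v|.
Proof.
rewrite [leRHS]/Num.Def.normr/= mx_normrE.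
exact: (le_bigmax _ (fun i : 'I_1 * 'I_m => `|v i.1 i.2|) (0, j)).
Qed.

Lemma norm_le_coord m (v : 'rV[R]_m) (M : R) :
  0 <= M -> (forall j, `|v 0 j| <= M) -> `|v| <= M.
Proof.
move=> M0 vM; rewrite [leLHS]/Num.Def.normr/= mx_normrE (bigmax_le _ M0)//= => -[a b] _.
by rewrite ord1.
Qed.

Lemma mulmx_bounded m k (B : 'M[R]_(m, k)) :
  exists2 C : R, 0 < C & forall v : 'rV[R]_m, `|v *m B| <= C * `|v|.
Proof.
exists (1 + \sum_i \sum_j `|B i j|).
  by rewrite ltr_pwDl// sumr_ge0// => i _; exact: sumr_ge0.
move=> v; have B0 : 0 <= \sum_i \sum_j `|B i j|.
  by apply: sumr_ge0 => i _; exact: sumr_ge0.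
apply: norm_le_coord => [|j]; first by rewrite mulr_ge0// addr_ge0.
rewrite mulrDl mul1r ler_wpDl// mxE (le_trans (ler_norm_sum _ _ _))// mulr_suml.
apply: ler_sum => i _; rewrite normrM mulrC ler_pM//; last exact: coord_le_norm.
by rewrite (bigD1 j)//= lerDl sumr_ge0.
Qed.

Lemma near_norm_ball m (P : 'rV[R]_m -> Prop) (x : 'rV[R]_m) : (\forall y \near x, P y) ->
  exists2 d : R, 0 < d & forall y, `|x - y| < d -> P y.
Proof.
move=> /nbhs_ballP[d /= d0 dP]; exists d => // y xy; apply: dP.
by rewrite -ball_normE.
Qed.

Lemma norm_ball_near m (P : 'rV[R]_m -> Prop) (x : 'rV[R]_m) (d : R) : 0 < d ->
  (forall y, `|x - y| < d -> P y) -> \forall y \near x, P y.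
Proof.
by move=> d0 dP; apply/nbhs_ballP; exists d => // y; rewrite -ball_normE => /dP.
Qed.

Lemma norm_segment m (x y z : 'rV[R]_m) (d t : R) : `|x - y| < d -> `|x - z| < d ->
  0 <= t <= 1 -> `|x - (y + t *: (z - y))| < d.
Proof.
move=> xy xz /andP[t0 t1].
have -> : x - (y + t *: (z - y)) = (1 - t) *: (x - y) + t *: (x - z).
  by apply/rowP => i; rewrite !mxE; ring.
apply: (le_lt_trans (ler_normD _ _)); rewrite !normrZ !ger0_norm ?subr_ge0//.
have [->|tn] := eqVneq t 0; first by rewrite subr0 mul0r addr0 mul1r.
have tp : 0 < t by rewrite lt0r tn.
have : (1 - t) * `|x - y| <= (1 - t) * d by rewrite ler_wpM2l ?subr_ge0// ltW.
have : t * `|x - z| < t * d by rewrite ltr_pM2l.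
by move: (`|x - y|) (`|x - z|) => a b; lra.
Qed.

Lemma local_min_partial m (A : set 'rV[R]_m) (g : 'rV[R]_m -> R) x i :
  open A -> A x -> (forall y, A y -> differentiable g y) ->
  (forall y, A y -> g x <= g y) -> partial i g x = 0.
Proof.
move=> oA Ax dg gx; have [d d0 dA] := near_norm_ball (open_nbhs_nbhs (conj oA Ax)).
pose e : 'rV[R]_m := delta_mx 0 i.
have Al (t : R) : t \in `]- d, d[%R -> A (x + t *: e).
  rewrite in_itv /= => td; apply: dA; rewrite opprD addrA subrr sub0r normrN normrZ.
  apply: (@le_lt_trans _ _ `|t|); last by rewrite ltr_norml.
  by rewrite -[leRHS]mulr1 ler_wpM2l// norm_delta_row.
have dl (t : R) : t \in `]- d, d[%R ->
    is_derive t (1 : R) (fun s => g (x + s *: e)) ('D_e g (x + t *: e)).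
  by move=> /Al /dg; exact: is_derive_line.
have i0 : 0 \in `]- d, d[%R by rewrite in_itv /= d0 oppr_lt0 d0.
have [_ D0] := dl 0 i0.
have [] := @derive1_at_min _ (fun s => g (x + s *: e)) (- d) d 0 _ _ i0 _.
- by rewrite ge0_cp// ltW.
- by move=> t /dl[].
- by move=> t /Al At; rewrite scale0r addr0; exact: gx.
by move=> _; rewrite D0 scale0r addr0.
Qed.

End row_norm.

(** * Strict differentiability of smooth maps *)

Section almost_linear.
Context {R : realType} {m k : nat}.
Variables (A : set 'rV[R]_m) (q : 'rV[R]_m -> 'rV[R]_k).
Hypotheses (oA : open A) (sq : smooth_map_on A q).

Lemma smooth_map_almost_linear x0 (e : R) : A x0 -> 0 < e ->
  exists2 d : R, 0 < d & (forall x, `|x0 - x| < d -> A x) /\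
    forall x y, `|x0 - x| < d -> `|x0 - y| < d ->
      `|q x - q y - (x - y) *m derivative_mx q x0| <= e * `|x - y|.
Proof.
(* Each of the m partial derivatives may deviate by e'; [m.+1] keeps the quotient meaningful for m =
   0. *)
move=> Ax0 e0; pose e' := e / m.+1%:R; have e'0 : 0 < e' by rewrite divr_gt0.
have nA := open_nbhs_nbhs (conj oA Ax0).
have nD : \forall x \near x0, forall jc : 'I_m * 'I_k,
    `|partial jc.1 (fun y => q y 0 jc.2) x0 - partial jc.1 (fun y => q y 0 jc.2) x| < e'.
  apply: (@filter_forall 'rV[R]_m ('I_m * 'I_k)%type (fun jc x =>
    `|partial jc.1 (fun y => q y 0 jc.2) x0 - partial jc.1 (fun y => q y 0 jc.2) x| < e') (nbhs x0)).
  move=> [j c] /=.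
  have cD : {for x0, continuous (partial j (fun y => q y 0 c))}.
    by apply: (smooth_continuous _ Ax0); apply: smooth_partial; exact: sq.
  by move/cvgrPdist_lt: cD => /(_ e' e'0).
have [d d0 dP] := near_norm_ball (filterI nA nD).
exists d => //; split=> [x /dP[]//|x y dx dy].
have nx0 : 0 <= e * `|x - y| by rewrite mulr_ge0// ltW.
apply: norm_le_coord => // c; rewrite !mxE.
have dif (t : R) : 0 <= t <= 1 ->
    differentiable (fun z => q z 0 c) (y + t *: (x - y)).
  by move=> t01; apply: (sq c [::]); have [] := dP _ (norm_segment dy dx t01).
have [t /andP[t0 t1]] := line_MVT dif.
have t01 : 0 <= t <= 1 by rewrite !ltW.
rewrite [y + (x - y)]addrC subrK => ->; rewrite derive_row_sum; last exact: dif.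
rewrite -sumrB (le_trans (ler_norm_sum _ _ _))//.
have [_ dz] := dP _ (norm_segment dy dx t01).
apply: (@le_trans _ _ (\sum_(j < m) e' * `|x - y|)).
  apply: ler_sum => j _; rewrite !mxE.
  rewrite -mulrBr normrM mulrC ler_pM//; last by have := coord_le_norm (x - y) j; rewrite !mxE.
  by rewrite distrC ltW// (dz (j, c)).
rewrite sumr_const card_ord -[leLHS]mulr_natl mulrA ler_wpM2r// /e' mulrCA.
by rewrite -[leRHS]mulr1 ler_wpM2l ?(ltW e0)// ler_pdivrMr// mul1r ler_nat.
Qed.

End almost_linear.

(** * Local inverses and their smoothness *)

Section inverse_function.
Context {R : realType} {m : nat}.
Variables (Omega : set 'rV[R]_m) (q : 'rV[R]_m -> 'rV[R]_m) (x0 : 'rV[R]_m).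
Hypotheses (oO : open Omega) (sq : smooth_map_on Omega q) (Ox0 : Omega x0).
Hypothesis uD : derivative_mx q x0 \in unitmx.

Local Notation Dq := (derivative_mx q).

Lemma smooth_derivative_mx : smooth_mx Omega Dq.
Proof.
by move=> j c; under eq_fun do rewrite mxE; apply: smooth_partial; exact: sq.
Qed.

(** If C bounds the inverse of the derivative at x0, almost linearity with error 1/(2C) gives |x -
    y| <= C |q x - q y| + |x - y|/2, hence K = 2C. Continuity of the determinant keeps the
    derivative invertible nearby. *)
Lemma local_lipschitz_inverse : exists2 d : R, 0 < d & exists2 K : R, 0 < K &
  (forall x, `|x0 - x| < d -> Omega x /\ Dq x \in unitmx) /\
  forall x y, `|x0 - x| < d -> `|x0 - y| < d -> `|x - y| <= K * `|q x - q y|.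
Proof.
have [C C0 CB] := mulmx_bounded (invmx (Dq x0)).
have e0 : 0 < (2 * C)^-1 by rewrite invr_gt0 mulr_gt0.
have [d1 d10 [dO dq]] := smooth_map_almost_linear oO sq Ox0 e0.
have det0 : \det (Dq x0) != 0 by rewrite -unitfE -unitmxE.
have cdet : {for x0, continuous (fun x => \det (Dq x))}.
  apply: (smooth_continuous _ Ox0); apply: smooth_det => //; exact: smooth_derivative_mx.
have ndet : \forall x \near x0, `|\det (Dq x0) - \det (Dq x)| < `|\det (Dq x0)|.
  by move/cvgrPdist_lt: cdet => /(_ `|\det (Dq x0)|); apply; rewrite normr_gt0.
have [d2 d20 d2u] := near_norm_ball ndet.
exists (Num.min d1 d2); first by rewrite lt_min d10.
exists (2 * C); first by rewrite mulr_gt0.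
split=> [x|x y]; rewrite !lt_min => /andP[x1 x2].
  split; first exact: dO.
  rewrite unitmxE unitfE; apply: contraTneq (d2u x x2) => ->.
  by rewrite subr0 ltxx.
move=> /andP[y1 y2]; have h := dq x y x1 y1.
have le1 : `|x - y| <= C * `|(x - y) *m Dq x0|.
  by rewrite -[X in `|X|  <= _](mulmxK uD); exact: CB.
have le2 : `|(x - y) *m Dq x0| <= `|q x - q y| + (2 * C)^-1 * `|x - y|.
  rewrite -lerBlDl (le_trans _ h)// -[leRHS]normrN opprB.
  exact: lerB_dist.
have := le_trans le1 (ler_wpM2l (ltW C0) le2).
have -> : C * (`|q x - q y| + (2 * C)^-1 * `|x - y|) = C * `|q x - q y| + `|x - y| / 2.
  move: (`|q x - q y|) (`|x - y|) => a b; field; by rewrite gt_eqF.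
rewrite -mulrA; move: (`|x - y|) (C * `|q x - q y|) => a b; lra.
Qed.

(** The gradient of the squared distance is twice Dq (q x - y)^T. *)
Lemma square_distance_zero y x : Omega x -> Dq x \in unitmx ->
  (forall j, partial j (fun z => dot (q z - y) (q z - y)) x = 0) -> q x = y.
Proof.
move=> Ox ux dz; apply/eqP; rewrite -subr_eq0; apply/eqP.
suff : Dq x *m (q x - y)^T = 0.
  by move/(congr1 (mulmx (invmx (Dq x)))); rewrite mulKmx// mulmx0 => /(congr1 trmx);
    rewrite trmxK trmx0.
apply/colP => j; rewrite [RHS]mxE [LHS]mxE; have := dz j.
have hc c : has_partial j (fun z => (q z - y) 0 c) x (Dq x j c).
  under eq_fun do rewrite !mxE.
  apply: has_partial_eq (has_partialB (smooth_has_partial j (sq c) Ox)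
    (has_partialC j (y 0 c) x)) _.
  by rewrite subr0 [RHS]mxE.
rewrite (has_partialE (has_partial_sum _ _ (fun c => has_partialM (hc c) (hc c)))).
under eq_bigr do rewrite [X in _ + X]mulrC -mulr2n.
rewrite sumrMnl => /eqP; rewrite mulrn_eq0 /= => /eqP s0.
by apply: etrans s0; apply: eq_bigr => c _; rewrite [X in _ * X]mxE.
Qed.

(* A minimizer of the distance from q z to y over a small ball cannot lie on the
   sphere, and at an interior critical point q z = y since the derivative is
   invertible. *)
Lemma local_surjectivity (d K : R) x1 : `|x0 - x1| < d -> 0 < K ->
  (forall x, `|x0 - x| < d -> Omega x /\ Dq x \in unitmx) ->
  (forall x y, `|x0 - x| < d -> `|x0 - y| < d -> `|x - y| <= K * `|q x - q y|) ->
  exists2 eta : R, 0 < eta & forall y, `|q x1 - y| < eta ->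
    exists2 x, `|x0 - x| < d & q x = y.
Proof.
move=> dx1 K0 dO dK; pose delta := (d - `|x0 - x1|) / 2.
have delta0 : 0 < delta by rewrite divr_gt0// subr_gt0.
have inB x : `|x1 - x| <= delta -> `|x0 - x| < d.
  move=> xx; rewrite -(subrKA x1) (le_lt_trans (ler_normD _ _))//.
  apply: (@le_lt_trans _ _ (`|x0 - x1| + delta)); first by rewrite lerD2l.
  by rewrite /delta; move: (`|x0 - x1|) dx1 => a ad; lra.
(* At a minimizer on the sphere |q x - y| <= (m+1) eta, so |q x1 - q x| < (m+2) eta. The factor m+3
   makes K times this smaller than delta, against the Lipschitz bound. The multiples of eta absorb
   the passage between Euclidean and sup norm. *)
have [eta eta0 etaE] : exists2 eta : R, 0 < eta & eta = delta / (K * m.+3%:R).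
  by exists (delta / (K * m.+3%:R)) => //; rewrite divr_gt0// mulr_gt0.
exists eta => // y qy.
pose g z := dot (q z - y) (q z - y).
have dg z : Omega z -> differentiable g z.
  move=> Oz.
  have dc c : differentiable (fun z => (q z - y) 0 c) z.
    under eq_fun do rewrite !mxE.
    by apply: differentiableB; [exact: smooth_differentiable (sq c) Oz|exact: differentiable_cst].
  rewrite (_ : g = \sum_(c < m) ((fun z => (q z - y) 0 c) * (fun z => (q z - y) 0 c))).
    by apply: differentiable_sum => c; exact: differentiableM.
  by apply/funext => z'; rewrite fct_sumE.
pose B := closed_ball x1 delta.
have BE x : B x <-> `|x1 - x| <= delta by rewrite /B closed_ballE.
have cB : compact B.
  apply: bounded_closed_compact; last exact: closed_ball_closed.
  exists (`|x1| + delta); split; first by rewrite num_real.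
  move=> M hM x /BE xx; apply: ltW; apply: le_lt_trans hM.
  rewrite -[x](subrK x1) addrC (le_trans (ler_normD _ _))// lerD2l.
  by rewrite distrC.
have B1 : B x1 by apply/BE; rewrite subrr normr0 ltW.
have ctB : {within B, continuous g}.
  apply: continuous_in_subspaceT => z; rewrite inE => /BE/inB/dO[Oz _].
  exact/differentiable_continuous/dg.
have [x /[!inE] Bx xmin] := EVT_min_rV (ex_intro _ _ B1) cB ctB.
have xx : `|x1 - x| <= delta by apply/BE.
have dx := inB x xx; exists x => //; have [Ox ux] := dO x dx.
move: xx; rewrite le_eqVlt => /orP[/eqP xd|xlt]; last first.
  apply: square_distance_zero => // j.
  have oA : open [set z | `|x1 - z| < delta].
    have -> : [set z | `|x1 - z| < delta] = ball x1 delta by rewrite -ball_normE.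
    exact: ball_open.
  apply: (local_min_partial (A := [set z | `|x1 - z| < delta])) => // z /= /ltW zd.
    by apply: dg; have [] := dO z (inB z zd).
  by apply: xmin; rewrite inE; apply/BE.
exfalso.
have g1 : g x <= m%:R * eta ^+ 2.
  apply: le_trans (xmin x1 (mem_set B1)) _.
  apply: (@le_trans _ _ (\sum_(c < m) eta ^+ 2)); last first.
    by rewrite sumr_const card_ord mulr_natl.
  apply: ler_sum => c _; rewrite -expr2 -real_normK ?num_real//.
  apply: lerXn2r; rewrite ?nnegrE ?normr_ge0 ?(ltW eta0)//.
  exact: le_trans (coord_le_norm _ _) (ltW qy).
have nq : `|q x - y| <= m.+1%:R * eta.
  have me0 : 0 <= m.+1%:R * eta by rewrite mulr_ge0 ?(ltW eta0).
  apply: norm_le_coord => [//|c].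
  rewrite -(@ler_pXn2r _ 2) ?nnegrE ?normr_ge0//.
  apply: (@le_trans _ _ (g x)).
    rewrite real_normK ?num_real// /g /dot (bigD1 c)//= -expr2 lerDl.
    by apply: sumr_ge0 => c' _; rewrite -expr2 sqr_ge0.
  apply: (le_trans g1); rewrite exprMn; apply: ler_wpM2r; first exact: sqr_ge0.
  by rewrite -natrX ler_nat (leq_trans (leqnSn m))// leq_pmulr.
have := dK x1 x dx1 dx; rewrite xd leNgt => /negP; apply.
have le3 : `|q x1 - q x| < m.+2%:R * eta.
  rewrite -(subrKA y) (le_lt_trans (ler_normD _ _))//.
  rewrite -[m.+2]addn1 natrD mulrDl mul1r addrC.
  by rewrite ler_ltD// distrC.
apply: (@le_lt_trans _ _ (K * (m.+2%:R * eta))); first by rewrite ler_wpM2l ?ltW.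
rewrite etaE mulrCA mulrA.
rewrite invfM.
have -> : m.+2%:R * K * (delta * (K^-1 * m.+3%:R^-1)) = (m.+2%:R / m.+3%:R) * delta.
  by field; rewrite (gt_eqF K0) andbT -?natrD pnatr_eq0.
by rewrite gtr_pMl// ltr_pdivrMr// mul1r ltr_nat.
Qed.

Theorem inverse_function : exists (V : set 'rV[R]_m) (r : 'rV[R]_m -> 'rV[R]_m),
  [/\ open V, V x0, V `<=` Omega, open (q @` V) &
      (forall x, V x -> r (q x) = x) /\ smooth_map_on (q @` V) r].
Proof.
have [d d0 [K K0 [dO dK]]] := local_lipschitz_inverse.
(* [r] selects a preimage in V, unique by the Lipschitz bound; outside q(V) it takes the default
   value x0. *)
pose V := [set x | `|x0 - x| < d]; pose r y := xget x0 [set x | V x /\ q x = y].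
have oV : open V.
  have -> : V = ball x0 d by rewrite -ball_normE.
  exact: ball_open.
have rq x : V x -> r (q x) = x.
  move=> Vx; rewrite /r; case: xgetP => [x' -> [Vx' qx']|/(_ x)[]//].
  apply/eqP; rewrite -subr_eq0 -normr_le0 (le_trans (dK _ _ Vx' Vx))//.
  by rewrite qx' subrr normr0 mulr0.
have oI : open (q @` V).
  rewrite openE => _ [x Vx <-]; have [eta eta0 etaV] := local_surjectivity Vx K0 dO dK.
  by apply: (norm_ball_near eta0) => y /etaV[x' Vx' <-]; exists x'.
exists V, r; split=> //; first by rewrite /V /= subrr normr0.
  by move=> x /dO[].
split=> //.
have dr y : (q @` V) y -> differentiable r y /\
    ('d r y = mulmxr (invmx (Dq (r y))) :> ('rV[R]_m -> 'rV[R]_m)).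
  move=> [x Vx <-]; rewrite rq//; have [Ox ux] := dO x Vx.
  set B := invmx (Dq x); have [C C0 CB] := mulmx_bounded B.
  apply: estimate_diff.
    move=> v; apply: differentiable_continuous; apply: differentiable_row => j /=.
    under eq_fun do rewrite mxE.
    have hs i : has_partial (i : 'I_m) (fun y : 'rV[R]_m => \sum_j0 y 0 j0 * B j0 j) v
        (\sum_j0 (((i == j0)%:R * B j0 j) + v 0 j0 * 0)).
      apply: has_partial_sum => j0.
      exact: has_partialM (has_partial_coord i j0 v) (has_partialC i (B j0 j) v).
    by case: (hs j).
  (* The error of r is B applied to the linearization error of q: B costs the factor C, and |x' - x|
     <= K |h| the factor K. *)
  move=> e e0; have e'0 : 0 < e / (C * K) by rewrite divr_gt0// mulr_gt0.
  have [d' d'0 [_ dlin]] := smooth_map_almost_linear oO sq Ox e'0.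
  have Iq : (q @` V) (q x) by exists x.
  have [rho rho0 rhoI] := near_norm_ball (open_nbhs_nbhs (conj oI Iq)).
  have m0 : 0 < Num.min rho (d' / K) by rewrite lt_min rho0 divr_gt0.
  apply: (norm_ball_near m0) => h; rewrite sub0r normrN lt_min => /andP[hrho hd].
  have [x' Vx' qx'] : (q @` V) (h + q x).
    by apply: rhoI; rewrite opprD addrCA subrr addr0 normrN.
  rewrite -qx' !rq//= -[X in `|X|]opprB.
  have hE : h = q x' - q x by rewrite qx' addrK.
  have xx' : `|x' - x| <= K * `|h| by rewrite hE; exact: dK.
  have le1 : `|q x' - q x - (x' - x) *m Dq x| <= e / (C * K) * `|x' - x|.
    apply: dlin; last by rewrite subrr normr0.
    rewrite distrC (le_lt_trans xx')// mulrC -ltr_pdivlMr//.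
  have -> : h *m B - (x' - x) = (q x' - q x - (x' - x) *m Dq x) *m B.
    by rewrite mulmxBl mulmxK// -hE.
  rewrite normrN (le_trans (CB _))//.
  apply: (le_trans (ler_wpM2l (ltW C0) le1)).
  apply: (le_trans (ler_wpM2l _ (ler_wpM2l _ xx'))); rewrite ?(ltW C0) ?(ltW e'0)//.
  rewrite le_eqVlt; apply/orP; left; apply/eqP.
  move: (`|h|) => a; by field; rewrite !gt_eqF.
have pr j y i : (q @` V) y ->
    has_partial i (fun y => r y 0 j) y (invmx (Dq (r y)) i j).
  move=> /dr[dry dE]; split.
    apply: (differentiable_comp dry (differentiable_coord _ _ _)).
  have dvr : derivable r y (delta_mx 0 i) := diff_derivable dry.
  have := congr1 (fun M : 'rV[R]_m => M 0 j) (derive_mx dvr).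
  by rewrite /partial [X in _ = X]mxE => <-; rewrite deriveE// dE /= -rowE mxE.
move=> j; apply: (@generated_smooth _ _ _ (fun f => exists j, f = fun y => r y 0 j) oI).
  move=> _ [j' ->]; split=> [y Iy|i]; first by have [] := pr j' y j Iy.
  apply: (@gen_eq _ _ _ _ (fun y => invmx (Dq (r y)) i j')) => [|y Iy].
    apply: (@gen_comp _ _ _ _ _ V (fun x => invmx (Dq x) i j') r).
    - apply: (smooth_invmx oV _ _ i j').
        by move=> a c; apply: smooth_onS (smooth_derivative_mx a c) => x /dO[].
      by move=> x /dO[].
    - by move=> _ [x Vx <-]; rewrite rq.
    - by move=> c; apply: gen_base; exists c.
  by rewrite (has_partialE (pr j' y i Iy)).
by apply: gen_base; exists j.
Qed.

End inverse_function.
(** * Existence of planar curvilinear coordinates *)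

Section real_antiderivative.
Context {R : realType}.
Implicit Types (F f : R -> R).

Lemma real_MVT F f (x v : R) :
  (forall t, 0 <= t <= 1 -> is_derive (x + t * v) (1 : R) F (f (x + t * v))) ->
  exists2 t : R, 0 <= t <= 1 & F (x + v) - F x = v * f (x + t * v).
Proof.
move=> dF; have dif (t : R) : 0 <= t <= 1 -> differentiable F (x + t *: v).
  by move=> /dF[? _]; apply/derivable1_diffP.
have [t /andP[t0 t1] ->] := line_MVT dif.
have t01 : 0 <= t <= 1 by rewrite !ltW.
exists t => //; have [_ <-] := dF t t01.
rewrite !deriveE; try exact: dif.
by rewrite -[X in 'd _ _ X = _]mulr1 [LHS]linearZ.
Qed.

Lemma real_MVT_bound F f (x v C : R) :
  (forall t, 0 <= t <= 1 -> is_derive (x + t * v) (1 : R) F (f (x + t * v))) ->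
  (forall t, 0 <= t <= 1 -> `|f (x + t * v)| <= C) ->
  `|F (x + v) - F x| <= C * `|v|.
Proof.
by move=> /real_MVT[t t01 ->] /(_ t t01) fC; rewrite normrM mulrC ler_wpM2r.
Qed.

Lemma antiderivative f (c d : R) : 0 < d ->
  (forall t, `|c - t| <= d -> {for t, continuous f}) ->
  exists F, F c = 0 /\ forall t, `|c - t| < d -> is_derive t (1 : R) F (f t).
Proof.
move=> d0 cf; pose a := c - d; pose b := c + d.
have fi : (@lebesgue_measure R).-integrable `[a, b] (EFin \o f).
  apply: continuous_compact_integrable; first exact: segment_compact.
  apply: continuous_in_subspaceT => t; rewrite inE /= in_itv /= => /andP[at_ tb].
  by apply: cf; rewrite ler_norml; apply/andP; split; rewrite /a /b in at_ tb *; lra.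
(* Integrating from the left end keeps every t of the open interval interior, on both sides of c. *)
pose G y := \int[@lebesgue_measure R]_(t in [set` `[a, y]]) f t.
exists (fun y => G y - G c); split; first by rewrite subrr.
move=> t; rewrite ltr_norml => /andP[t1 t2].
have tb : t < b by rewrite /b; lra.
have at_ : a < t by rewrite /a; lra.
have [dG G'] := continuous_FTC1_closed tb fi at_ (cf t ltac:(by rewrite ler_norml; lra)).
have dG1 : is_derive t (1 : R) G (f t).
  by apply: (DeriveDef dG); rewrite -derive1E; exact: G'.
by have := is_deriveB dG1 (is_derive_cst (G c) t 1); rewrite subr0.
Qed.

End real_antiderivative.

(** * A potential for a closed field on a square *)

Section planar_potential.
Context {R : realType}.
Variables (A : set 'rV[R]_2) (P Q : 'rV[R]_2 -> R) (x0 : 'rV[R]_2) (d : R).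
Hypotheses (oA : open A) (sP : smooth_on A P) (sQ : smooth_on A Q).
Local Notation i0 := (ord0 : 'I_2).
Local Notation i1 := (lift ord0 ord0 : 'I_2).
Hypothesis closed_form : forall x, A x -> partial i1 P x = partial i0 Q x.
Hypotheses (d0 : 0 < d) (dA : forall y, `|x0 - y| <= d -> A y).

Definition pt (a b : R) : 'rV[R]_2 := \row_j (if j == i0 then a else b).

Lemma pt_coord (x : 'rV[R]_2) : x = pt (x 0 i0) (x 0 i1).
Proof.
apply/rowP => j; rewrite mxE; case: eqP => [->//|/eqP].
by case: (unliftP i0 j) => [k ->|->]; rewrite ?eqxx// (ord1 k).
Qed.

Lemma ptE0 a b : pt a b 0 i0 = a. Proof. by rewrite mxE. Qed.
Lemma ptE1 a b : pt a b 0 i1 = b. Proof. by rewrite mxE. Qed.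

Lemma pt_norm a b (M : R) : 0 <= M -> `|x0 0 i0 - a| <= M -> `|x0 0 i1 - b| <= M ->
  `|x0 - pt a b| <= M.
Proof.
move=> M0 aM bM; apply: norm_le_coord => // j; rewrite !mxE.
by case: (unliftP i0 j) => [k ->|->]; rewrite ?(ord1 k).
Qed.

Lemma is_derive_pt0 g a b : smooth_on A g -> A (pt a b) ->
  is_derive a (1 : R) (fun t => g (pt t b)) (partial i0 g (pt a b)).
Proof.
move=> sg Aab; have ptE t : pt t b = pt 0 b + t *: delta_mx 0 i0.
  apply/rowP => j; rewrite !mxE eqxx /=.
  by case: (unliftP i0 j) => [k ->|->]; rewrite ?mulr1 ?mulr0 ?addr0 ?add0r.
have dif : differentiable g (pt 0 b + a *: (delta_mx 0 i0 : 'rV[R]_2)).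
  by rewrite -ptE; exact: smooth_differentiable sg Aab.
have := is_derive_line dif; rewrite -ptE.
have -> : (fun s => g (pt 0 b + s *: (delta_mx 0 i0 : 'rV[R]_2))) = (fun t => g (pt t b)).
  by apply/funext => t; rewrite -ptE.
by [].
Qed.

Lemma is_derive_pt1 g a b : smooth_on A g -> A (pt a b) ->
  is_derive b (1 : R) (fun t => g (pt a t)) (partial i1 g (pt a b)).
Proof.
move=> sg Aab; have ptE t : pt a t = pt a 0 + t *: delta_mx 0 i1.
  apply/rowP => j; rewrite !mxE eqxx /=.
  by case: (unliftP i0 j) => [k ->|->]; rewrite ?(ord1 k) ?eqxx ?mulr1 ?mulr0 ?addr0 ?add0r.
have dif : differentiable g (pt a 0 + b *: (delta_mx 0 i1 : 'rV[R]_2)).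
  by rewrite -ptE; exact: smooth_differentiable sg Aab.
have := is_derive_line dif; rewrite -ptE.
have -> : (fun s => g (pt a 0 + s *: (delta_mx 0 i1 : 'rV[R]_2))) = (fun t => g (pt a t)).
  by apply/funext => t; rewrite -ptE.
by [].
Qed.

Let c0 := x0 0 i0.
Let c1 := x0 0 i1.

Lemma ptA a b : `|c0 - a| <= d -> `|c1 - b| <= d -> A (pt a b).
Proof. by move=> aM bM; apply: dA; apply: pt_norm => //; exact: ltW. Qed.

Lemma bounded_on_square g : smooth_on A g ->
  exists2 M : R, 0 < M & forall y, `|x0 - y| <= d -> `|g y| <= M.
Proof.
move=> sg; pose B := closed_ball x0 d.
have BE y : B y <-> `|x0 - y| <= d by rewrite /B closed_ballE.
have cB : compact B.
  apply: bounded_closed_compact; last exact: closed_ball_closed.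
  exists (`|x0| + d); split; first by rewrite num_real.
  move=> M hM x /BE xx; apply: ltW; apply: le_lt_trans hM.
  by rewrite -[x](subrK x0) addrC (le_trans (ler_normD _ _))// lerD2l distrC.
have B0 : B !=set0 by exists x0; apply/BE; rewrite subrr normr0 ltW.
have cg : {within B, continuous g}.
  apply: continuous_in_subspaceT => z; rewrite inE => /BE/dA.
  exact: smooth_continuous.
have [z1 _ z1M] := EVT_max_rV B0 cB cg.
have [z2 _ z2M] := EVT_min_rV B0 cB cg.
exists (1 + `|g z1| + `|g z2|); first by rewrite -addrA ltr_pwDl// addr_ge0.
move=> y /BE/mem_set yB; have := z1M y yB; have := z2M y yB.
have := ler_norm (g z1); have := lerNnormlW (lexx `|g z2|).
have := normr_ge0 (g z1); have := normr_ge0 (g z2).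
rewrite ler_norml; move: (`|g z1|) (`|g z2|) => u v *; apply/andP; split; lra.
Qed.

Lemma planar_antiderivatives : exists (Fa : R -> R) (Fb : R -> R -> R),
  [/\ forall t, `|c0 - t| < d -> is_derive t (1 : R) Fa (P (pt t c1)),
      forall a, `|c0 - a| <= d -> Fb a c1 = 0 &
      forall a t, `|c0 - a| <= d -> `|c1 - t| < d ->
        is_derive t (1 : R) (Fb a) (Q (pt a t))].
Proof.
have c1d : `|c1 - c1| <= d by rewrite subrr normr0 ltW.
have cont (f : R -> R) (l : R) t : is_derive t (1 : R) f l -> {for t, continuous f}.
  by move=> [df _]; apply: differentiable_continuous; exact/derivable1_diffP.
have [Fa [_ dFa]] : exists Fa, Fa c0 = 0 /\
    forall t, `|c0 - t| < d -> is_derive t (1 : R) Fa (P (pt t c1)).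
  apply: antiderivative => // t ct.
  exact: cont (is_derive_pt0 sP (ptA ct c1d)).
(* [choice] needs a function for every a; off the square the constant 0 serves. *)
have eFb a : exists F : R -> R, `|c0 - a| <= d ->
    F c1 = 0 /\ forall t, `|c1 - t| < d -> is_derive t (1 : R) F (Q (pt a t)).
  have [ad|ad] := boolP (`|c0 - a| <= d); last by exists (fun=> 0).
  have [F [F0 dF]] : exists F, F c1 = 0 /\
      forall t, `|c1 - t| < d -> is_derive t (1 : R) F (Q (pt a t)).
    apply: antiderivative => // t ct.
    exact: cont (is_derive_pt1 sQ (ptA ad ct)).
  by exists F.
have [Fb FbP] := choice eFb.
exists Fa, Fb; split=> // [a /FbP[]//|a t /FbP[_ h]]; exact: h.
Qed.

Lemma is_deriveBl (F : R -> R) (l c t : R) : is_derive t (1 : R) F l ->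
  is_derive t (1 : R) (fun s => F s - s * c) (l - c).
Proof.
move=> dF; have dc : is_derive t (1 : R) (fun s => s * c) c.
  have := is_deriveM (is_derive_id t (1 : R)) (is_derive_cst c t (1 : R)).
  by rewrite scaler0 add0r [X in is_derive _ _ _ X](mulr1 c).
exact: is_deriveB dF dc.
Qed.

(** A second order Taylor estimate, uniform in t. It replaces differentiation of the vertical
    integral under the integral sign. *)
Lemma difference_quotient_bound a t h0 M :
  (forall y, `|x0 - y| <= d -> `|partial i0 (partial i0 Q) y| <= M) ->
  `|c1 - t| <= d -> (forall s, 0 <= s <= 1 -> `|c0 - (a + s * h0)| <= d) ->
  `|Q (pt (a + h0) t) - Q (pt a t) - h0 * partial i0 Q (pt a t)| <= M * `|h0| * `|h0|.
Proof.
move=> HM ct ca; have ad : `|c0 - a| <= d.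
  by have := ca 0; rewrite mul0r addr0; apply; rewrite lexx ler01.
pose F s := Q (pt s t) - s * partial i0 Q (pt a t).
have -> : Q (pt (a + h0) t) - Q (pt a t) - h0 * partial i0 Q (pt a t) =
    F (a + h0) - F a.
  have aux (u v w : R) : u - v - h0 * w = u - (a + h0) * w - (v - a * w) by ring.
  exact: aux.
apply: (@real_MVT_bound _ F (fun s => partial i0 Q (pt s t) - partial i0 Q (pt a t))
  a h0 (M * `|h0|)) => s s01.
  exact: is_deriveBl (is_derive_pt0 sQ (ptA (ca s s01) ct)).
have /andP[s0 s1] := s01.
apply: (@le_trans _ _ (M * `|s * h0|)); last first.
  have M0 : 0 <= M.
    by have := HM x0; rewrite subrr normr0 => /(_ (ltW d0)); exact: le_trans (normr_ge0 _).
  by rewrite ler_wpM2l// normrM (ger0_norm s0) ler_piMl.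
apply: (@real_MVT_bound _ (fun s => partial i0 Q (pt s t))
    (fun s => partial i0 (partial i0 Q) (pt s t)) a (s * h0) M) => s' /andP[s'0 s'1];
  rewrite mulrA.
  apply: (is_derive_pt0 (smooth_partial i0 sQ)); apply: ptA => //.
  by apply: ca; rewrite mulr_ge0// mulr_ile1.
by apply/HM/pt_norm; rewrite ?(ltW d0)//; apply: ca; rewrite mulr_ge0// mulr_ile1.
Qed.

(* chi (a, b) = int_{c0}^a P (t, c1) dt + int_{c1}^b Q (a, t) dt *)
Lemma planar_potential : exists chi : 'rV[R]_2 -> R, forall x, `|x0 - x| < d ->
  has_partial i0 chi x (P x) /\ has_partial i1 chi x (Q x).
Proof.
have [Fa [Fb [dFa Fb0 dFb]]] := planar_antiderivatives.
have [M M0 HM] := bounded_on_square (smooth_partial i0 (smooth_partial i0 sQ)).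
exists (fun x => Fa (x 0 i0) + Fb (x 0 i0) (x 0 i1)) => x dx.
set chi := fun _ => _; pose a := x 0 i0; pose b := x 0 i1.
have xE : x = pt a b := pt_coord x.
have Ax : A x by apply/dA/ltW.
pose lin (y : 'rV[R]_2) := y 0 i0 * P x + y 0 i1 * Q x.
have hlin i y : has_partial i lin y ((i == i0)%:R * P x + (i == i1)%:R * Q x).
  apply: has_partial_eq (has_partialD
    (has_partialM (has_partial_coord i i0 y) (has_partialC i (P x) y))
    (has_partialM (has_partial_coord i i1 y) (has_partialC i (Q x) y))) _.
  by rewrite !mulr0 !addr0.
have dlin : differentiable lin 0 by case: (hlin i0 0).
have linE h : 'd lin 0 h = h 0 i0 * P x + h 0 i1 * Q x.
  rewrite -deriveE// derive_row_sum//.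
  rewrite big_ord_recl big_ord1 (has_partialE (hlin _ _)) (has_partialE (hlin i1 _)).
  by rewrite !eqxx eq_liftF eq_sym eq_liftF /= !mul1r !mul0r addr0 add0r.
suff [dchi chiE] : differentiable chi x /\ ('d chi x = 'd lin 0 :> ('rV[R]_2 -> R)).
  have pE i : partial i chi x = (i == i0)%:R * P x + (i == i1)%:R * Q x.
    by rewrite /partial (deriveE _ dchi) chiE linE !mxE !(eq_sym i).
  split; (split; [exact: dchi|rewrite pE]).
    by rewrite eqxx eq_liftF mul1r mul0r addr0.
  by rewrite eqxx eq_sym eq_liftF mul1r mul0r add0r.
apply: estimate_diff => [|e e0]; first exact: diff_continuous.
have e30 : 0 < e / 3 by rewrite divr_gt0.
have cx0 (y : 'rV[R]_2) j : `|x0 0 j - y 0 j| <= `|x0 - y|.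
  by have := coord_le_norm (x0 - y) j; rewrite !mxE.
have c1d : `|c1 - c1| <= d by rewrite subrr normr0 ltW.
have ad : `|c0 - a| < d by exact: le_lt_trans (cx0 x i0) dx.
have bd : `|c1 - b| < d by exact: le_lt_trans (cx0 x i1) dx.
have [r1 r10 P1] : exists2 r1 : R, 0 < r1 & forall y, `|pt a c1 - y| < r1 ->
    `|P (pt a c1) - P y| < e / 3.
  apply: near_norm_ball; have := smooth_continuous sP (ptA (ltW ad) c1d).
  by move/cvgrPdist_lt => /(_ _ e30).
have [r2 r20 Q2] : exists2 r2 : R, 0 < r2 & forall y, `|x - y| < r2 ->
    `|Q x - Q y| < e / 3.
  apply: near_norm_ball; have := smooth_continuous sQ Ax.
  by move/cvgrPdist_lt => /(_ _ e30).
(* The four bounds serve, in order, continuity of P at (a, c1), continuity of Q at x, staying in the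
   square, and making the quadratic error M |h0|^2 |b - c1| at most e/3 |h|. *)
pose eta := Num.min (Num.min r1 r2) (Num.min (d - `|x0 - x|) (e / 3 / (M * d))).
have eta0 : 0 < eta by rewrite !lt_min r10 r20 subr_gt0 dx divr_gt0// mulr_gt0.
apply: (norm_ball_near eta0) => h; rewrite sub0r normrN !lt_min.
move=> /andP[/andP[hr1 hr2] /andP[hd hM]]; rewrite linE.
pose h0 := h 0 i0; pose h1 := h 0 i1.
have h0h : `|h0| <= `|h| := coord_le_norm h i0.
have h1h : `|h1| <= `|h| := coord_le_norm h i1.
have near_c j (s : R) : 0 <= s <= 1 -> `|x0 0 j - (x 0 j + s * h 0 j)| < d.
  move=> /andP[s0 s1]; rewrite opprD addrA (le_lt_trans (ler_normB _ _))//.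
  rewrite normrM (ger0_norm s0).
  have : s * `|h 0 j| <= `|h| by rewrite (le_trans _ (coord_le_norm h j))// ler_piMl.
  have := cx0 x j; move: (`|x0 0 j - x 0 j|) (s * `|h 0 j|) => u v; lra.
have a1d : `|c0 - (a + h0)| < d by have := near_c i0 1; rewrite mul1r; apply; rewrite ler01 lexx.
(* The increment of chi minus its linear part is split into three: F1 moves along the horizontal
   segment at height c1, F2 shifts the vertical segment from a to a + h0, F3 prolongs it from b to b
   + h1. The terms h0 P (a, c1) of F1 and F2 cancel. *)
pose F1 s := Fa s - s * P (pt a c1).
have T1 : `|F1 (a + h0) - F1 a| <= e / 3 * `|h0|.
  apply: (@real_MVT_bound _ F1 (fun s => P (pt s c1) - P (pt a c1)) a h0 (e / 3)) => s s01.
    by apply: is_deriveBl; apply: dFa; exact: near_c.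
  rewrite distrC ltW//; apply: P1; apply: le_lt_trans hr1.
  have /andP[s0 s1] := s01.
  apply: norm_le_coord => // j; rewrite !mxE; case: ifP => _; last by rewrite subrr normr0.
  rewrite opprD addrA subrr sub0r normrN normrM (ger0_norm s0).
  by rewrite (le_trans _ h0h)// ler_piMl.
pose F3 s := Fb (a + h0) s - s * Q x.
have T3 : `|F3 (b + h1) - F3 b| <= e / 3 * `|h1|.
  apply: (@real_MVT_bound _ F3 (fun s => Q (pt (a + h0) s) - Q x) b h1 (e / 3)) => s s01.
    by apply: is_deriveBl; apply: dFb; [exact: ltW|exact: near_c].
  rewrite distrC ltW//; apply: Q2; apply: le_lt_trans hr2.
  have /andP[s0 s1] := s01.
  apply: norm_le_coord => // j; rewrite {1}xE !mxE; case: ifP => _;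
    rewrite opprD addrA subrr sub0r normrN// normrM (ger0_norm s0).
  by rewrite (le_trans _ h1h)// ler_piMl.
(* As d_1 P = d_0 Q, the derivative of F2 in s is a Taylor remainder of Q in the first variable. *)
pose F2 s := (Fb (a + h0) s - Fb a s) - h0 * P (pt a s).
have T2 : `|F2 (c1 + (b - c1)) - F2 c1| <= M * `|h0| * `|h0| * `|b - c1|.
  have segd s : 0 <= s <= 1 -> `|c1 - (c1 + s * (b - c1))| < d.
    move=> /andP[s0 s1]; rewrite opprD addrA subrr sub0r normrN normrM (ger0_norm s0).
    by rewrite distrC (le_lt_trans _ bd)// ler_piMl.
  apply: (@real_MVT_bound _ F2 (fun s => Q (pt (a + h0) s) - Q (pt a s)
    - h0 * partial i0 Q (pt a s)) c1 (b - c1) (M * `|h0| * `|h0|)) => s s01.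
    have cs := segd s s01.
    have dP1 := is_derive_pt1 sP (ptA (ltW ad) (ltW cs)).
    rewrite -closed_form; last exact: ptA (ltW ad) (ltW cs).
    exact: is_deriveB (is_deriveB (dFb _ _ (ltW a1d) cs) (dFb _ _ (ltW ad) cs))
      (is_deriveZ h0 dP1).
  apply: difference_quotient_bound => // [|s' s'01]; first exact/ltW/segd.
  by apply: ltW; exact: near_c.
have hh : M * `|h0| * `|h0| * `|b - c1| <= e / 3 * `|h|.
  have M1 : M * `|b - c1| * `|h0| <= e / 3.
    apply: (@le_trans _ _ (M * d * `|h|)).
      by rewrite ler_pM ?mulr_ge0// ?(ltW M0)// ler_wpM2l ?(ltW M0)// distrC ltW.
    by rewrite ltW// mulrC -ltr_pdivlMr// mulr_gt0.
  have -> : M * `|h0| * `|h0| * `|b - c1| = M * `|b - c1| * `|h0| * `|h0| by ring.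
  by rewrite ler_pM// !mulr_ge0// ltW.
have hx0 : (h + x) 0 i0 = a + h0 by rewrite mxE addrC.
have hx1 : (h + x) 0 i1 = b + h1 by rewrite mxE addrC.
rewrite /chi hx0 hx1 -/a -/b -/h0 -/h1.
rewrite (subrKC c1 b) in T2.
have -> : Fa (a + h0) + Fb (a + h0) (b + h1) - (Fa a + Fb a b) - (h0 * P x + h1 * Q x) =
    (F1 (a + h0) - F1 a) + (F2 b - F2 c1) + (F3 (b + h1) - F3 b).
  rewrite /F1 /F2 /F3 -xE (Fb0 a (ltW ad)) (Fb0 _ (ltW a1d)).
  move: (P x) (Q x) (P (pt a c1)) (Fa _) (Fa a) (Fb _ _) (Fb _ b) (Fb a b).
  by move=> u1 u2 u3 u4 u5 u6 u7 u8; ring.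
apply: (le_trans (ler_normD _ _)).
have T12 := le_trans (ler_normD (F1 (a + h0) - F1 a) (F2 b - F2 c1)) (lerD T1 (le_trans T2 hh)).
apply: (le_trans (lerD T12 T3)).
have l1 : e / 3 * `|h0| <= e / 3 * `|h| by rewrite ler_wpM2l// ltW.
have l3 : e / 3 * `|h1| <= e / 3 * `|h| by rewrite ler_wpM2l// ltW.
by apply: (le_trans (lerD (lerD l1 (lexx _)) l3)); move: (`|h|) => u; lra.
Qed.

End planar_potential.

(** * Charts from psi and its conjugate *)

Section planar_charts.
Context {R : realType}.
Variables (p : R) (Omega : set 'rV[R]_2) (psi : 'rV[R]_2 -> R).
Hypothesis openO : open Omega.
Hypothesis spsi : smooth_on Omega psi.
Hypothesis gpsi : forall x, Omega x -> grad psi x <> 0.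
Hypothesis hpsi : p_harmonic p Omega psi.
Local Notation i0 := (ord0 : 'I_2).
Local Notation i1 := (lift ord0 ord0 : 'I_2).

Let G x := enorm (grad psi x) `^ (p - 2).

Let G_gt0 x : Omega x -> 0 < G x.
Proof. by move=> Ox; rewrite powR_gt0// (enorm_grad_gt0 gpsi Ox). Qed.

Let sG : smooth_on Omega G.
Proof.
apply: smooth_powR => //; first exact: smooth_enorm_grad.
by move=> x; exact: enorm_grad_gt0.
Qed.

(* The second coordinate is the p-harmonic conjugate of psi, a potential of the
   rotated field |grad psi|^(p-2) (- d_1 psi, d_0 psi), which is closed because
   psi is p-harmonic. *)
Lemma harmonic_conjugate x0 : Omega x0 ->
  exists (d : R) (chi : 'rV[R]_2 -> R), [/\ 0 < d, ball x0 d `<=` Omega,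
    smooth_on (ball x0 d) chi & forall x, ball x0 d x ->
      partial i0 chi x = - G x * partial i1 psi x /\
      partial i1 chi x = G x * partial i0 psi x].
Proof.
move=> Ox0; pose P x := - G x * partial i1 psi x; pose Q x := G x * partial i0 psi x.
have sP : smooth_on Omega P.
  by apply: smoothM => //; [exact: smoothN|exact: smooth_partial].
have sQ : smooth_on Omega Q by apply: smoothM => //; exact: smooth_partial.
have clf x : Omega x -> partial i1 P x = partial i0 Q x.
  move=> Ox; have := hpsi Ox; rewrite /divergence big_ord_recl big_ord1.
  have -> : partial i0 (fun y => (G y *: grad psi y) 0 i0) x = partial i0 Q x.
    by apply: (eq_partial_open _ openO Ox) => y _; rewrite !mxE.
  have -> : partial i1 (fun y => (G y *: grad psi y) 0 i1) x = - partial i1 P x.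
    rewrite -(has_partialE (has_partialN (smooth_has_partial i1 sP Ox))).
    by apply: (eq_partial_open _ openO Ox) => y _; rewrite !mxE /P mulNr opprK.
  have aux (a b : R) : a + - b = 0 -> b = a by move=> /subr0_eq.
  exact: aux.
have [d' d'0 d'O] := near_norm_ball (open_nbhs_nbhs (conj openO Ox0)).
have [d d0 dd'] : exists2 d : R, 0 < d & d < d' by exists (d' / 2); lra.
have dO y : `|x0 - y| <= d -> Omega y by move=> xy; apply: d'O; exact: le_lt_trans dd'.
have [chi chiE] := planar_potential sP sQ clf d0 dO.
have bE x : ball x0 d x -> `|x0 - x| < d by rewrite -ball_normE.
have bO : ball x0 d `<=` Omega by move=> x /bE/ltW/dO.
exists d, chi; split=> //; last first.
  by move=> x /bE/chiE[h0 h1]; split; [exact: has_partialE h0|exact: has_partialE h1].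
have hc i x : ball x0 d x -> has_partial i chi x (if i == i0 then P x else Q x).
  move=> /bE/chiE[h0 h1]; case: (unliftP i0 i) => [k ->|->]; last by rewrite eqxx.
  by rewrite (ord1 k) eq_sym (negbTE (neq_lift _ _)).
apply: (@generated_smooth _ _ _ (fun f => smooth_on (ball x0 d) f \/ f = chi)).
- exact: ball_open.
- move=> f [sf|->]; split=> [x bx|i].
  + exact: smooth_differentiable sf bx.
  + by apply: gen_base; left; exact: smooth_partial.
  + by case: (hc i0 x bx).
  + apply: (@gen_eq _ _ _ _ (fun x => if i == i0 then P x else Q x)).
      by case: (i == i0); apply: gen_base; left; [exact: smooth_onS bO sP|exact: smooth_onS bO sQ].
    by move=> x bx; rewrite (has_partialE (hc i x bx)).
- by apply: gen_base; right.
Qed.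

Lemma unitmx2 (M : 'M[R]_2) :
  M i0 i0 * M i1 i1 - M i0 i1 * M i1 i0 != 0 -> M \in unitmx.
Proof.
set e := _ - _ => e0.
pose B : 'M[R]_2 := \matrix_(i, j) (if i == i0 then (if j == i0 then M i1 i1 else - M i0 i1)
  else (if j == i0 then - M i1 i0 else M i0 i0)).
suff MB : M *m (e^-1 *: B) = 1%:M by have [] := mulmx1_unit MB.
rewrite -scalemxAr; apply/matrixP => i j; rewrite [LHS]mxE [X in _ * X]mxE [RHS]mxE.
have i10 : (i1 == i0) = false by [].
have B0 l : B i0 l = if l == i0 then M i1 i1 else - M i0 i1 by rewrite mxE.
have B1 l : B i1 l = if l == i0 then - M i1 i0 else M i0 i0 by rewrite mxE.
rewrite big_ord_recl big_ord1 B0 B1.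
have one (u : R) : u = e -> e^-1 * u = 1 by move=> ->; rewrite mulVf.
have zero (u : R) : u = 0 -> e^-1 * u = 0 by move=> ->; rewrite mulr0.
case: (unliftP i0 i) => [k ->|->]; case: (unliftP i0 j) => [l ->|->];
  rewrite ?(ord1 k) ?(ord1 l) ?eqxx ?i10 ?(eq_sym i0) ?i10.
- by apply: one; rewrite /e; move: (M i0 i0) (M i0 i1) (M i1 i0) (M i1 i1) => *; ring.
- by apply: zero; move: (M i1 i0) (M i1 i1) => *; ring.
- by apply: zero; move: (M i0 i0) (M i0 i1) => *; ring.
- by apply: one; rewrite /e; move: (M i0 i0) (M i0 i1) (M i1 i0) (M i1 i1) => *; ring.
Qed.

(** The Jacobian determinant of q = (psi, chi) is F^(p-2) |grad psi|^2, which is positive, and grad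
    chi is orthogonal to grad psi, so chi is constant along the integral curves. *)
Lemma curvilinear_exists x0 : Omega x0 -> exists U r u,
  [/\ curvilinear Omega psi U r, U u & r u = x0].
Proof.
move=> Ox0; have [d [chi [d0 bO schi chiE]]] := harmonic_conjugate Ox0.
pose q x := pt (psi x) (chi x).
have b0 : ball x0 d x0 by exact: ballxx.
have sq : smooth_map_on (ball x0 d) q.
  move=> j; case: (unliftP i0 j) => [k ->|->].
    rewrite (ord1 k); rewrite (_ : (fun x => _) = chi)//.
    by apply/funext => x; rewrite ptE1.
  rewrite (_ : (fun x => _) = psi); first exact: smooth_onS bO spsi.
  by apply/funext => x; rewrite ptE0.
have q0 x : q x 0 i0 = psi x by rewrite ptE0.
have q1 : (fun x => q x 0 i1) = chi by apply/funext => x; rewrite ptE1.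
have uD : derivative_mx q x0 \in unitmx.
  have [c0 c1] := chiE x0 b0.
  have n0 : dot (grad psi x0) (grad psi x0) != 0.
    by rewrite gt_eqF// dot_gt0//; exact: gpsi.
  have D0 i : derivative_mx q x0 i i0 = partial i psi x0.
    by rewrite mxE (_ : (fun y => _) = psi)//; apply/funext => y; rewrite q0.
  have D1 i : derivative_mx q x0 i i1 = partial i chi x0 by rewrite mxE q1.
  apply: unitmx2; rewrite !D0 !D1 c0 c1.
  have dotE : dot (grad psi x0) (grad psi x0) = partial i0 psi x0 * partial i0 psi x0
      + partial i1 psi x0 * partial i1 psi x0.
    by rewrite /dot big_ord_recl big_ord1 !mxE.
  have aux (a c g : R) : a * (g * a) - - g * c * c = g * (a * a + c * c) by ring.
  by rewrite aux -dotE mulf_neq0// gt_eqF// G_gt0.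
have [V [r [oV Vx0 Vb oI [rq sr]]]] := inverse_function (ball_open x0 d) sq b0 uD.
have rI : r @` (q @` V) = V.
  rewrite eqEsubset; split=> [_ [_ [x Vx <-] <-]|x Vx]; first by rewrite rq.
  by exists (q x); [exists x|exact: rq].
exists (q @` V), r, (q x0); split; [|by exists x0|exact: rq].
split; rewrite ?rI//; first by move=> x /Vb/bO.
exists q; split=> [j|_ [x Vx <-]|x _|x i Vx]; first exact: smooth_onS Vb (sq j).
- by rewrite rq.
- exact: q0.
rewrite (ord1 i) q1; have [c0 c1] := chiE x (Vb x Vx).
rewrite derive_row_sum; last exact: smooth_differentiable schi (Vb x Vx).
rewrite big_ord_recl big_ord1 c0 c1 !mxE.
have aux (u v w : R) : u *: (- w * v) + v *: (w * u) = 0.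
  by rewrite /GRing.scale /=; ring.
exact: aux.
Qed.

End planar_charts.
(** * Minimum principles *)

Section second_derivative_test.
Context {R : realType} {m : nat}.

(** A negative second derivative stays negative on a ball. As the first derivative vanishes at x,
    two mean value theorems then give a smaller value of g at x + v. *)
Lemma local_min_partial2 (A : set 'rV[R]_m) (g : 'rV[R]_m -> R) x i :
  open A -> A x -> smooth_on A g -> (forall y, A y -> g x <= g y) ->
  0 <= partial i (partial i g) x.
Proof.
move=> oA Ax sg gx; rewrite leNgt; apply/negP => neg.
have dg y : A y -> differentiable g y by exact: smooth_differentiable.
have sg1 := smooth_partial i sg; have dg1 y : A y -> differentiable (partial i g) y.
  exact: smooth_differentiable.
have g10 := local_min_partial i oA Ax dg gx.
have ng : \forall y \near x, A y /\ partial i (partial i g) y < 0.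
  apply: filterI; first exact: open_nbhs_nbhs.
  have := smooth_continuous (smooth_partial i sg1) Ax.
  by move=> /cvgr_lt; apply.
have [d d0 dP] := near_norm_ball ng.
have [t t0 td] : exists2 t : R, 0 < t & t < d by exists (d / 2); lra.
pose v : 'rV[R]_m := t *: delta_mx 0 i.
have vd : `|v| < d.
  rewrite normrZ gtr0_norm// (le_lt_trans _ td)//.
  by rewrite -[leRHS]mulr1 ler_wpM2l ?norm_delta_row// ltW.
have inA (s : R) : 0 <= s <= 1 -> `|x - (x + s *: v)| < d.
  move=> /andP[s0 s1]; rewrite opprD addrA subrr sub0r normrN normrZ ger0_norm//.
  by rewrite (le_lt_trans _ vd)// ler_piMl.
have Dv (f : 'rV[R]_m -> R) y : differentiable f y -> 'D_v f y = t * partial i f y.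
  by move=> df; rewrite (deriveE _ df) linearZ /= /partial (deriveE _ df).
have [|s /andP[s0 s1] ge] := @line_MVT _ _ g x v.
  by move=> s /inA /dP[As _]; exact: dg.
have s01 : 0 <= s <= 1 by rewrite !ltW.
have prod01 (a b : R) : 0 <= a <= 1 -> 0 <= b <= 1 -> 0 <= a * b <= 1.
  by move=> /andP[a0 a1] /andP[b0 b1]; rewrite mulr_ge0//= mulr_ile1.
have [Axs _] := dP _ (inA s s01).
have [|s' /andP[s'0 s'1] ge'] := @line_MVT _ _ (partial i g) x (s *: v).
  move=> s' s'01; apply: dg1; rewrite scalerA.
  by have [] := dP _ (inA _ (prod01 s' s s'01 s01)).
have s's : 0 <= s' * s <= 1 by apply: prod01 => //; rewrite !ltW.
have [As's neg'] := dP _ (inA _ s's).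
have lt1 : partial i g (x + s *: v) < 0.
  have : partial i g (x + s *: v) - partial i g x = s * (t * partial i (partial i g) (x + (s' * s) *: v)).
    rewrite ge' scalerA -(Dv _ _ (dg1 _ As's)).
    by rewrite !(deriveE _ (dg1 _ As's)) linearZ.
  by rewrite g10 subr0 => ->; rewrite !pmulr_rlt0.
have Axv : A (x + v).
  have i11 : 0 <= (1 : R) <= 1 by rewrite ler01 lexx.
  by have [] := dP _ (inA 1 i11); rewrite scale1r.
have := gx _ Axv; rewrite -subr_ge0 ge (Dv _ _ (dg _ Axs)) pmulr_rge0// leNgt.
by rewrite lt1.
Qed.

End second_derivative_test.

(** * Comparison with exponentials of psi *)

Section minimum_principle.
Context {R : realType}.
Variables (p alpha : R) (Omega : set 'rV[R]_2) (psi : 'rV[R]_2 -> R).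
Hypothesis p1 : 1 < p.
Hypothesis openO : open Omega.
Hypothesis spsi : smooth_on Omega psi.
Hypothesis gpsi : forall x, Omega x -> grad psi x <> 0.
Hypothesis hpsi : p_harmonic p Omega psi.
Hypothesis alpha1 : 0 <= alpha * (alpha + 2 - p).
Hypothesis alpha2 : 0 <= 2 * (p - 2) ^+ 2 + alpha * (alpha + 3 * p - 6).
Local Notation i0 := (ord0 : 'I_2).
Local Notation i1 := (lift ord0 ord0 : 'I_2).
Local Notation F := (fun x => enorm (grad psi x)).
Local Notation kap := (kappa Omega psi).
Local Notation sc := (speed_curvature p psi).

Let F_gt0 x : Omega x -> 0 < F x := enorm_grad_gt0 gpsi (x := x).

(** Existence of charts excludes the default value 0 of [kappa]. *)
Lemma kappaE x : Omega x -> kap x = sc x.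
Proof.
move=> Ox; have [U [r [u [CU Uu <-]]]] := curvilinear_exists openO spsi gpsi hpsi Ox.
by rewrite (kappa_chart openO spsi gpsi hpsi CU Uu).
Qed.

(** Formed with [speed_curvature] in place of [kappa]: the two agree on Omega, and the former is
    visibly smooth. *)
Definition weighted_curvature x := F x `^ (1 - p - alpha) * sc x.
Local Notation h := weighted_curvature.

Lemma smooth_weighted_curvature : smooth_on Omega h.
Proof.
apply: smoothM => //; last exact: smooth_speed_curvature.
by apply: smooth_powR => //; exact: smooth_enorm_grad.
Qed.

(** In a chart the perturbation is eps exp(lam u^0). The sign conditions on alpha and kappa >= 0
    allow the two curvature terms of the planar identity to be dropped, and what remains is F^2 eps
    lam^2 e <= F kappa B eps lam e, where e is the exponential and B = 4 - 2(p + alpha)/(p - 1). A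
    positive factor is cancelled. *)
Lemma interior_critical_bound (D : set 'rV[R]_2) x0 (eps lam : R) :
  open D -> D `<=` Omega -> D x0 -> 0 < eps -> 0 < lam -> 0 <= sc x0 ->
  (forall y, D y -> h x0 - eps * expR (lam * psi x0) <= h y - eps * expR (lam * psi y)) ->
  F x0 * lam <= sc x0 * (4 - 2 * (p + alpha) / (p - 1)).
Proof.
move=> oD DO Dx eps0 lam0 k0 wmin; have Ox := DO _ Dx.
have [U [r [u [CU Uu ru]]]] := curvilinear_exists openO spsi gpsi hpsi Ox.
have FC := chart_framed openO spsi gpsi CU; have oU := fc_open FC.
have [_ _ _ smr _] := CU.
pose g v := kap (r v) / F (r v) `^ (p - 1 + alpha).
have gE v : U v -> g v = h (r v).
  move=> Uv; rewrite /g /h mulrC (kappaE (chart_image CU Uv)) -powRN.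
  by congr (_ `^ _ * _); ring.
have sg : smooth_on U g.
  apply: smooth_eq (smooth_on_chart CU smooth_weighted_curvature) _ => // v Uv.
  by rewrite gE.
pose W v := g v - eps * expR (lam * v 0 i0).
have sexp : smooth_on U (fun v => expR (lam * v 0 i0)).
  apply: smooth_expR => //; apply: smoothM => //; first exact: smooth_cst.
  exact: smooth_coord.
have sW : smooth_on U W.
  by apply: smoothB => //; apply: smoothM => //; exact: smooth_cst.
pose A := [set v | U v /\ D (r v)].
have oA : open A.
  rewrite openE => v [Uv Dv]; apply: filterI; first exact: open_nbhs_nbhs.
  have cr : {for v, continuous r}.
    apply: differentiable_continuous; apply: differentiable_row => j.
    exact: smooth_differentiable (smr j) Uv.
  by apply: cr; exact: open_nbhs_nbhs.
have Au : A u by split; rewrite ?ru.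
have AU : A `<=` U by move=> v [].
have Wmin v : A v -> W u <= W v.
  move=> [Uv Dv]; have := wmin _ Dv; rewrite -ru -!gE//.
  by rewrite (chart_level CU Uu) (chart_level CU Uv).
have sWA : smooth_on A W := smooth_onS AU sW.
have W1 i : partial i W u = 0.
  apply: (local_min_partial i oA Au) => // v Av; exact: smooth_differentiable sWA Av.
have W2 i : 0 <= partial i (partial i W) u by exact: local_min_partial2 oA Au sWA Wmin.
pose e (v : 'rV[R]_2) := expR (lam * v 0 i0).
have de i v : has_partial i e v (lam * (i == i0)%:R * e v).
  apply: has_partial_eq (has_partial_expR (has_partialM (has_partialC i lam v)
    (has_partial_coord i i0 v))) _.
  by rewrite mul0r add0r mulrC.
have dW i v : U v -> partial i W v = partial i g v - eps * (lam * (i == i0)%:R * e v).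
  move=> Uv; rewrite (has_partialE (has_partialB (smooth_has_partial i sg Uv)
    (has_partialM (has_partialC i eps v) (de i v)))).
  by rewrite mul0r add0r.
have ddW i : partial i (partial i W) u = partial i (partial i g) u
    - eps * (lam * (i == i0)%:R * (lam * (i == i0)%:R * e u)).
  rewrite (eq_partial_open _ oU Uu (dW i)).
  rewrite (has_partialE (has_partialB (smooth_has_partial i (smooth_partial i sg) Uu)
    (has_partialM (has_partialC i eps u)
      (has_partialM (has_partialC i (lam * (i == i0)%:R) u) (de i u))))).
  by rewrite !mul0r !add0r.
have e0 : 0 < e u by exact: expR_gt0.
have g0 : dpsi g u = eps * lam * e u.
  by apply/eqP; rewrite -subr_eq0 -(W1 i0) dW// eqxx mulr1 mulrA.
have g1 : partial i1 g u = 0.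
  by have := W1 i1; rewrite dW// eq_sym eq_liftF mulr0 mul0r mulr0 subr0.
have g00 : eps * lam ^+ 2 * e u <= dpsi (dpsi g) u.
  have := W2 i0; rewrite ddW eqxx mulr1 subr_ge0; congr (_ <= _); ring.
have g11 : 0 <= partial i1 (partial i1 g) u.
  by have := W2 i1; rewrite ddW eq_sym eq_liftF mulr0 mul0r mulr0 subr0.
(* The derivative of 1/s is multiplied by d_1 g = 0, so only s^-2 d_1^2 g is left. *)
have lap : 0 <= laplace_beltrami r g u.
  rewrite (laplace_beltrami_arc openO spsi gpsi CU)//.
  have ss := smooth_sqrt_det FC; have s0 := sqrt_det_gt0 FC Uu.
  have sn0 : sqrt_det r u != 0 by rewrite gt_eqF.
  rewrite {1}/arc (has_partialE (has_partialM
    (has_partialV sn0 (smooth_has_partial i1 ss Uu))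
    (smooth_has_partial i1 (smooth_partial i1 sg) Uu))).
  by rewrite g1 mulr0 add0r !mulr_ge0// invr_ge0 ltW.
have := chart_weighted_curvature p1 openO spsi gpsi hpsi CU (alpha := alpha) Uu g1.
rewrite -/g ru (kappaE Ox) g0.
set T1 := sc x0 ^+ 3 / _ * _; set T2 := _ * _ * darc _ _ _ ^+ 2; set B := 4 - _ => id.
have F0 := F_gt0 Ox; have Fa : 0 < F x0 `^ alpha by exact: powR_gt0.
have pm : 0 < p - 1 by rewrite subr_gt0.
have T10 : 0 <= T1.
  by rewrite mulr_ge0// divr_ge0 ?exprn_ge0 ?powR_ge0// ltW.
have T20 : 0 <= T2.
  by rewrite mulr_ge0 ?sqr_ge0// mulr_ge0 ?divr_ge0 ?powR_ge0// ltW.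
have le1 : level_operator p psi r g u <= F x0 * sc x0 * B * (eps * lam * e u).
  rewrite -(ler_pM2l Fa) id.
  have -> : F x0 `^ alpha * F x0 * sc x0 * B * (eps * lam * e u) =
    F x0 `^ alpha * (F x0 * sc x0 * B * (eps * lam * e u)) by rewrite !mulrA.
  by move: (F x0 `^ alpha * (_ * _)) => z; lra.
have le2 : F x0 ^+ 2 * (eps * lam ^+ 2 * e u) <= level_operator p psi r g u.
  rewrite /level_operator ru; apply: (@le_trans _ _ (F x0 ^+ 2 * dpsi (dpsi g) u)).
    by rewrite (ler_pM2l (exprn_gt0 2 F0)); exact: g00.
  by rewrite lerDr; exact: divr_ge0 lap (ltW pm).
have := le_trans le2 le1.
have c0 : 0 < F x0 * (eps * lam * e u) by rewrite !mulr_gt0.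
have -> : F x0 ^+ 2 * (eps * lam ^+ 2 * e u) = F x0 * (eps * lam * e u) * (F x0 * lam).
  by move: (F x0) (e u) => y z; ring.
have -> : F x0 * sc x0 * B * (eps * lam * e u) = F x0 * (eps * lam * e u) * (sc x0 * B).
  by move: (F x0) (e u) (sc x0) => y z t; ring.
by rewrite ler_pM2l.
Qed.

Lemma bounded_closure_compact (D : set 'rV[R]_2) : bounded_set D -> compact (closure D).
Proof.
move=> [M [Mr DM]]; apply: bounded_closed_compact; last exact: closed_closure.
have M1 : M < `|M| + 1 by rewrite (le_lt_trans (ler_norm M))// ltrDl.
have M0 : 0 < `|M| + 1 by rewrite ltr_wpDl.
have cl : closed (closed_ball (0 : 'rV[R]_2) (`|M| + 1)) by exact: closed_ball_closed.
have sub : closure D `<=` closed_ball (0 : 'rV[R]_2) (`|M| + 1).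
  rewrite closureE => x; apply; split=> // y Dy; rewrite closed_ballE//.
  by rewrite /closed_ball_ /= sub0r normrN; exact: DM.
exists (`|M| + 1); split; first by rewrite num_real.
move=> K MK x /sub; rewrite closed_ballE// /closed_ball_ /= sub0r normrN => xM.
exact: le_trans xM (ltW MK).
Qed.

(** For large lam every minimizer of h - eps exp(lam psi) over the closure lies on the boundary, for
    all eps > 0 with the same lam. The minimum of h over the compact boundary is then compared with
    these as eps tends to 0. *)
Lemma weighted_curvature_min_principle (D : set 'rV[R]_2) :
  domain D -> bounded_set D -> closure D `<=` Omega ->
  (forall x, closure D x -> 0 <= sc x) -> attains_min_on_boundary D h.
Proof.
move=> [[xD DxD] oD _] bD cDO sc0.
have DO : D `<=` Omega by move=> x /subset_closure/cDO.
pose K := closure D; have cK : compact K := bounded_closure_compact bD.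
have K0 : K !=set0 by exists xD; exact: subset_closure.
have cont g (B : set 'rV[R]_2) : B `<=` K -> smooth_on Omega g -> {within B, continuous g}.
  move=> BK sg; apply: continuous_in_subspaceT => z; rewrite inE => /BK/cDO.
  exact: smooth_continuous sg.
have sh := smooth_weighted_curvature.
pose cst0 := 4 - 2 * (p + alpha) / (p - 1).
pose ratio x := sc x * cst0 / F x.
have sr : smooth_on Omega ratio.
  apply: smoothM => //.
    apply: smoothM => //; last exact: smooth_cst.
    exact: smooth_speed_curvature.
  apply: smoothV => //; first exact: smooth_enorm_grad.
  by move=> x Ox; rewrite gt_eqF// F_gt0.
have [z1 _ z1max] := EVT_max_rV K0 cK (cont _ _ (@subset_refl _ K) sr).
(* [lam] exceeds the maximum of [ratio] over the closure, which contradicts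
   [interior_critical_bound] at any minimizer inside D. *)
pose lam := `|ratio z1| + 1.
have lam0 : 0 < lam by rewrite ltr_wpDl.
pose E x := expR (lam * psi x).
have sE : smooth_on Omega E.
  by apply: smooth_expR => //; apply: smoothM => //; exact: smooth_cst.
have on_boundary eps : 0 < eps -> exists2 y, boundary D y &
    forall x, K x -> h y - eps * E y <= h x - eps * E x.
  move=> eps0; have sw : smooth_on Omega (fun x => h x - eps * E x).
    by apply: smoothB => //; apply: smoothM => //; exact: smooth_cst.
  have [y /[!inE] Ky ymin] := EVT_min_rV K0 cK (cont _ _ (@subset_refl _ K) sw).
  have ymin' x : K x -> h y - eps * E y <= h x - eps * E x.
    by move=> Kx; apply: ymin; rewrite inE.
  exists y => //; split=> //; rewrite (interior_id D).1// => Dy.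
  have Oy := DO _ Dy.
  have := interior_critical_bound oD DO Dy eps0 lam0 (sc0 _ Ky)
    (fun x Dx => ymin' x (subset_closure Dx)).
  apply/negP; rewrite -ltNge -ltr_pdivrMl ?F_gt0// mulrC.
  apply: (@le_lt_trans _ _ (ratio z1)); first by apply: z1max; rewrite inE.
  by rewrite (le_lt_trans (ler_norm _))// ltrDl.
have bK : boundary D `<=` K by move=> x [].
have cB : compact (boundary D).
  apply: (subclosed_compact _ cK bK); rewrite /boundary setDE.
  apply: closedI; first exact: closed_closure.
  by apply: open_closedC; exact: open_interior.
have B0 : boundary D !=set0 by have [y By _] := on_boundary 1 ltr01; exists y.
have [y /[!inE] By ymin] := EVT_min_rV B0 cB (cont _ _ bK sh).
exists y => // x Kx; apply/ler_addgt0Pr => e e0.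
have [z2 _ z2max] := EVT_max_rV K0 cK (cont _ _ (@subset_refl _ K) sE).
have Epos z : 0 < E z by exact: expR_gt0.
(* Dividing by the maximum of E makes the perturbation at most e on the whole closure. *)
have eps0 : 0 < e / E z2 by rewrite divr_gt0.
have [z Bz zmin] := on_boundary _ eps0.
have hz : h y <= h z by apply: ymin; rewrite inE.
have Ez : e / E z2 * E z <= e.
  by rewrite mulrAC ler_pdivrMr// ler_pM2l// z2max// inE; exact: bK.
have Ex : 0 <= e / E z2 * E x by rewrite mulr_ge0// ltW.
have := zmin x Kx; move: hz Ez Ex.
by move: (h y) (h z) (h x) (e / E z2 * E z) (e / E z2 * E x) => a b c u v; lra.
Qed.

End minimum_principle.
(** The first product has the roots 0 and p - 2, the second 2 - p and 2(2 - p). Their order changes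
    at p = 2, and the listed ranges are those where both are nonnegative. *)
Lemma admissible_exponents {R : realType} (p alpha : R) :
  (p <= 2 /\ [\/ alpha <= p - 2, 0 <= alpha <= 2 - p | 2 * (2 - p) <= alpha])
  \/ (2 < p /\ [\/ alpha <= 2 * (2 - p), 2 - p <= alpha <= 0 | p - 2 <= alpha]) ->
  0 <= alpha * (alpha + 2 - p) /\
  0 <= 2 * (p - 2) ^+ 2 + alpha * (alpha + 3 * p - 6).
Proof.
have -> : 2 * (p - 2) ^+ 2 + alpha * (alpha + 3 * p - 6) =
  (alpha + 2 * (p - 2)) * (alpha + (p - 2)) by ring.
move=> [[p2 [a|/andP[a b]|a]]|[p2 [a|/andP[a b]|a]]]; split;
  solve [by rewrite mulr_ge0//; lra|by rewrite mulr_le0//; lra].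
Qed.

(** * The planar statements in terms of kappa *)

Section planar_results.
Context {R : realType}.
Variables (p : R) (Omega : set 'rV[R]_2) (psi : 'rV[R]_2 -> R).
Hypothesis p1 : 1 < p.
Hypothesis openO : open Omega.
Hypothesis spsi : smooth_on Omega psi.
Hypothesis gpsi : forall x, Omega x -> grad psi x <> 0.
Hypothesis hpsi : p_harmonic p Omega psi.
Local Notation F := (fun x => enorm (grad psi x)).
Local Notation kap := (kappa Omega psi).

Lemma kappa_weighted (alpha : R) x : Omega x ->
  F x `^ (1 - p - alpha) * kap x = weighted_curvature p alpha psi x.
Proof. by move=> Ox; rewrite (kappaE openO spsi gpsi hpsi Ox). Qed.

(** By the chain rule a vanishing gradient kills both chart derivatives of h: the tangential one, as
    the planar identity requires, and d_0 h, hence the surplus term. *)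
Lemma critical_weighted_curvature (alpha : R) U r u :
  curvilinear Omega psi U r -> U u ->
  grad (fun x => F x `^ (1 - p - alpha) * kap x) (r u) = 0 ->
  F (r u) `^ alpha *
  level_operator p psi r (fun v => kap (r v) / F (r v) `^ (p - 1 + alpha)) u =
  - (kap (r u) ^+ 3 / F (r u) `^ (p - 1)
     * (alpha * (alpha + 2 - p) / (p - 1) ^+ 2))
  - kap (r u) / F (r u) `^ (p - 1)
    * ((2 * (p - 2) ^+ 2 + alpha * (alpha + 3 * p - 6)) / (p - 1))
    * darc r (fun v => ln (F (r v))) u ^+ 2.
Proof.
move=> CU Uu g0; have [oU _ _ smr _] := CU.
have Or := chart_image CU Uu.
pose g v := kap (r v) / F (r v) `^ (p - 1 + alpha).
have sh : smooth_on Omega (weighted_curvature p alpha psi).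
  exact: smooth_weighted_curvature.
have gz a : partial a g u = 0.
  transitivity (partial a (fun v => weighted_curvature p alpha psi (r v)) u).
    apply: (eq_partial_open _ oU Uu) => v Uv.
    rewrite -(kappa_weighted _ (chart_image CU Uv)) /g mulrC -powRN.
    by congr (_ `^ _ * _); ring.
  rewrite (partial_comp a (h := weighted_curvature p alpha psi)); first last.
  - exact: smooth_differentiable sh Or.
  - by move=> j; exact: smooth_differentiable (smr j) Uu.
  rewrite big1// => j _.
  have -> : partial j (weighted_curvature p alpha psi) (r u) = 0; last by rewrite mul0r.
  transitivity (grad (fun x => F x `^ (1 - p - alpha) * kap x) (r u) 0 j).
    rewrite mxE; apply: (eq_partial_open _ openO Or) => x Ox.
    by rewrite kappa_weighted.
  by rewrite g0 mxE.
have := chart_weighted_curvature p1 openO spsi gpsi hpsi CU (alpha := alpha) Uu (gz _).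
by rewrite -/g => ->; rewrite [dpsi g u]gz mulr0 addr0.
Qed.

Lemma kappa_min_principle (alpha : R) (D : set 'rV[R]_2) :
  0 <= alpha * (alpha + 2 - p) ->
  0 <= 2 * (p - 2) ^+ 2 + alpha * (alpha + 3 * p - 6) ->
  domain D -> bounded_set D -> closure D `<=` Omega ->
  (forall x, closure D x -> 0 <= F x `^ (1 - p - alpha) * kap x) ->
  attains_min_on_boundary D (fun x => F x `^ (1 - p - alpha) * kap x).
Proof.
move=> a1 a2 dD bD cDO h0.
have [|y By ymin] := weighted_curvature_min_principle p1 openO spsi gpsi hpsi a1 a2 dD bD cDO.
  move=> x Dx; have Ox := cDO _ Dx; have := h0 x Dx.
  rewrite (kappaE openO spsi gpsi hpsi Ox) pmulr_rge0//.
  by rewrite powR_gt0// (enorm_grad_gt0 gpsi Ox).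
exists y => // x Dx; have Dy : closure D y by case: By.
have le_eq (a b a' b' : R) : a' = a -> b' = b -> a <= b -> a' <= b' by move=> -> ->.
exact: le_eq (kappa_weighted alpha (cDO _ Dy)) (kappa_weighted alpha (cDO _ Dx)) (ymin x Dx).
Qed.

End planar_results.

Theorem proposition3p1 (R : realType) (p : R) (hp : 1 < p) :
  (* (i), in dimension d = n + 1 >= 2 *)
  (forall (n : nat) (Omega : set 'rV[R]_n.+1) (psi : 'rV[R]_n.+1 -> R),
    (1 <= n)%N -> domain Omega -> smooth_on Omega psi ->
    p_harmonic p Omega psi -> (forall x, Omega x -> grad psi x <> 0) ->
    let F := fun x => enorm (grad psi x) in
    forall (U : set 'rV[R]_n.+1) (r : 'rV[R]_n.+1 -> 'rV[R]_n.+1),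
    curvilinear Omega psi U r ->
    let TrW := fun u => \tr (weingarten psi r u) in
    forall u, U u ->
      dpsi (fun v => scalar_curvature r v / F (r v) `^ p) u =
      1 / (F (r u) `^ (p - 1) * sqrt_g r u) *
      (\sum_i dtan i (fun v =>
        1 / (p - 1) *
          (\sum_j inv_metric r v i j * F (r v) `^ (p - 1) * sqrt_g r v *
             dtan j (fun w => TrW w / F (r w) `^ (p + 1)) v)
        - 2 / p *
          (\sum_j \sum_k inv_metric r v i k * weingarten psi r v j k *
             F (r v) `^ (p - 2) * sqrt_g r v *
             dtan j (fun w => 1 / F (r w) `^ p) v)) u)
      + dpsi (dpsi (fun v => TrW v / F (r v) `^ (p - 1))) u)
  /\
  (* (ii) and (iii), in dimension d = 2 *)
  (forall (Omega : set 'rV[R]_2) (psi : 'rV[R]_2 -> R),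
    domain Omega -> smooth_on Omega psi ->
    p_harmonic p Omega psi -> (forall x, Omega x -> grad psi x <> 0) ->
    let F := fun x => enorm (grad psi x) in
    let k := kappa Omega psi in
    (* (ii) *)
    ((forall (U : set 'rV[R]_2) (r : 'rV[R]_2 -> 'rV[R]_2) (u : 'rV[R]_2),
        curvilinear Omega psi U r -> U u ->
        grad (fun x => F x `^ (1 - p) * k x) (r u) = 0 ->
        level_operator p psi r (fun v => k (r v) / F (r v) `^ (p - 1)) u
        + 2 * (k (r u) / F (r u) `^ (p - 1)) * ((p - 2) ^+ 2 / (p - 1)) *
          darc r (fun v => ln (F (r v))) u ^+ 2 = 0)
     /\
     (forall D : set 'rV[R]_2,
        domain D -> bounded_set D -> closure D `<=` Omega ->
        (forall x, closure D x -> 0 <= F x `^ (1 - p) * k x) ->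
        attains_min_on_boundary D (fun x => F x `^ (1 - p) * k x)))
    /\
    (* (iii) *)
    ((forall alpha : R,
        (forall (U : set 'rV[R]_2) (r : 'rV[R]_2 -> 'rV[R]_2) (u : 'rV[R]_2),
           curvilinear Omega psi U r -> U u ->
           grad (fun x => F x `^ (1 - p - alpha) * k x) (r u) = 0 ->
           F (r u) `^ alpha *
           level_operator p psi r
             (fun v => k (r v) / F (r v) `^ (p - 1 + alpha)) u =
           - (k (r u) ^+ 3 / F (r u) `^ (p - 1)
              * (alpha * (alpha + 2 - p) / (p - 1) ^+ 2))
           - k (r u) / F (r u) `^ (p - 1)
             * ((2 * (p - 2) ^+ 2 + alpha * (alpha + 3 * p - 6)) / (p - 1))
             * darc r (fun v => ln (F (r v))) u ^+ 2)
        /\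
        ((p <= 2 /\ [\/ alpha <= p - 2, 0 <= alpha <= 2 - p
                      | 2 * (2 - p) <= alpha])
         \/ (2 < p /\ [\/ alpha <= 2 * (2 - p), 2 - p <= alpha <= 0
                        | p - 2 <= alpha]) ->
         forall D : set 'rV[R]_2,
           domain D -> bounded_set D -> closure D `<=` Omega ->
           (forall x, closure D x -> 0 <= F x `^ (1 - p - alpha) * k x) ->
           attains_min_on_boundary D
             (fun x => F x `^ (1 - p - alpha) * k x)))
     /\
     (3 / 2 <= p <= 3 ->
      forall D : set 'rV[R]_2,
        domain D -> bounded_set D -> closure D `<=` Omega ->
        (forall x, closure D x -> 0 <= k x) ->
        attains_min_on_boundary D k))).

Proof.
split=> [n Omega psi _ [_ oO _] spsi hpsi gpsi F U r CU TrW u Uu|].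
  have H := level_set_curvature hp oO spsi gpsi hpsi CU Uu.
  exact H.
move=> Omega psi [_ oO _] spsi hpsi gpsi F k.
have minP := kappa_min_principle hp oO spsi gpsi hpsi.
have crit := critical_weighted_curvature hp oO spsi gpsi hpsi.
split; [split|split].
(* Part (ii) is the case alpha = 0. *)
- move=> U r u CU Uu g0; have := crit 0 U r u CU Uu; rewrite subr0 => /(_ g0).
  rewrite powRr0 mul1r addr0 => ->; rewrite !mul0r mulr0 oppr0 sub0r addr0.
  rewrite -/(F (r u)) -/(k (r u)); set a := k (r u) / _; set b := darc _ _ _ ^+ 2.
  by ring.
- move=> D dD bD cDO; have := minP 0 D; rewrite subr0; apply => //.
    by rewrite mul0r.
  by rewrite mul0r addr0 mulr_ge0// sqr_ge0.
- move=> alpha; split; first exact: crit.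
  by move=> /admissible_exponents[a1 a2] D; exact: minP.
(* The exponent alpha = 1 - p removes the weight. It satisfies alpha <= p - 2 exactly when p >= 3/2,
   and alpha <= 2(2 - p) exactly when p <= 3. *)
- move=> /andP[p32 p3] D dD bD cDO k0.
  have kE : (fun x => F x `^ (1 - p - (1 - p)) * k x) = k.
    by apply/funext => x; rewrite subrr powRr0 mul1r.
  have [a1 a2] : 0 <= (1 - p) * (1 - p + 2 - p) /\
      0 <= 2 * (p - 2) ^+ 2 + (1 - p) * (1 - p + 3 * p - 6).
    apply: admissible_exponents; have [p2|p2] := leP p 2; [left|right]; split=> //.
      by apply: Or31; lra.
    by apply: Or31; lra.
  have := minP (1 - p) D a1 a2 dD bD cDO; rewrite kE; apply => x Dx.
  by rewrite subrr powRr0 mul1r; exact: k0.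
Qed.
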